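(* Let $\tilde\rho:M\to S^3$ be a minimal immersion of a torus. If $nnt(M)\le 6$, then the group of isometries of $M$ (with the metric induced by $\tilde\rho$) is not trivial.
   Context: $M$ is an oriented compact surface without boundary diffeomorphic to a torus, $\tilde\rho:M\to S^3\subset\mathbb{R}^4$ is a minimal immersion, and $M$ has the induced metric. $N:M\to S^3$ is a Gauss map: $N(m)\perp d\tilde\rho_m(T_mM)$ and $\langle N(m),\tilde\rho(m)\rangle=0$. $a:M\to\mathbb{R}$ is the nonnegative principal curvature function; for a torus $a$ is everywhere positive (Lawson) and smooth, and $W_1,W_2$ are fixed smooth unit tangent vector fields on $M$ with $dN(W_1)=-aW_1$, $dN(W_2)=aW_2$. $so(4)$ is the space of real skew-symmetric $4\times4$ matrices. For $B\in so(4)$, $f_B(m)=\langle B\tilde\rho(m),N(m)\rangle$. For $\theta\in\mathbb{R}$, $h_\theta=\cos(\theta)a^{-3/2}W_1(a)+\sin(\theta)a^{-3/2}W_2(a)$. The natural nullity is $nnt(M)=\dim NS$, where $NS=\{f_B+\lambda h_\theta: B\in so(4),\ \lambda,\theta\in\mathbb{R}\}$, a linear subspace of $C^\infty(M)$. *)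

(* Defs.v *)
From HB Require Import structures.
From mathcomp Require Import all_boot all_order all_algebra.
From mathcomp Require Import all_classical all_reals all_analysis.

Set Implicit Arguments.
Unset Strict Implicit.
Unset Printing Implicit Defensive.

Import Order.TTheory GRing.Theory Num.Theory numFieldNormedType.Exports.

Local Open Scope classical_set_scope.
Local Open Scope ring_scope.

Fixpoint is_Ck (R : realType) (U V : normedModType R) (k : nat) (f : U -> V)
    : Prop :=
  if k is k'.+1 then
    (forall x, differentiable f x) /\
    (forall v, is_Ck k' (fun x => 'D_v f x))
  else continuous f.

Definition smooth (R : realType) (U V : normedModType R) (f : U -> V) : Prop :=
  forall k, is_Ck k f.

Definition dot (R : realType) (n : nat) (u v : 'cV[R]_n) : R :=
  (u^T *m v) 0 0.

(* A surface diffeomorphic to a torus is a type M with a map p from the plane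
   that identifies M with R^2 / Z^2; the diffeomorphism R^2 / Z^2 -> M carries
   the smooth structure of M. Each dp_x identifies R^2 with the tangent space
   of M at p x, compatibly with Z^2-translations, so a tangent vector at a
   point of M is given by its coordinates in 'cV[R]_2 and a vector field on M
   is a function M -> 'cV[R]_2. *)
Definition is_torus (R : realType) (M : Type) (p : 'cV[R]_2 -> M) : Prop :=
  (forall m, exists x, p x = m) /\
  (forall x y, p x = p y <-> exists k : 'cV[int]_2, y = x + map_mx intr k).

Section Torus.
Context (R : realType) (M : Type) (p : 'cV[R]_2 -> M).

Definition smooth_on (V : normedModType R) (f : M -> V) : Prop :=
  smooth (f \o p).

Definition lift (m : M) : 'cV[R]_2 := xget 0 [set x | p x = m].

(* The derivative of f at m along the tangent vector w. It does not depend on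
   the chosen lift of m, because f \o p is Z^2-periodic. *)
Definition dif (V : normedModType R) (f : M -> V) (m : M) (w : 'cV[R]_2) : V :=
  'D_w (f \o p) (lift m).

Definition immersion_in_S3 (rho : M -> 'cV[R]_4) : Prop :=
  [/\ smooth_on rho,
      forall m, dot (rho m) (rho m) = 1
    & forall m w, dif rho m w = 0 -> w = 0].

Definition gauss_map (rho N : M -> 'cV[R]_4) : Prop :=
  [/\ smooth_on N,
      forall m, dot (N m) (N m) = 1,
      forall m, dot (N m) (rho m) = 0
    & forall m w, dot (N m) (dif rho m w) = 0].

Definition metric (rho : M -> 'cV[R]_4) (m : M) (v w : 'cV[R]_2) : R :=
  dot (dif rho m v) (dif rho m w).

Definition second_form (rho N : M -> 'cV[R]_4) (m : M) (v w : 'cV[R]_2) : R :=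
  - dot (dif N m v) (dif rho m w).

Definition gram (b : 'cV[R]_2 -> 'cV[R]_2 -> R) : 'M[R]_2 :=
  \matrix_(i, j) b (delta_mx i 0) (delta_mx j 0).

Definition mean_curvature (rho N : M -> 'cV[R]_4) (m : M) : R :=
  \tr (invmx (gram (metric rho m)) *m gram (second_form rho N m)) / 2.

Definition minimal (rho N : M -> 'cV[R]_4) : Prop :=
  forall m, mean_curvature rho N m = 0.

Definition principal_curvature (rho N : M -> 'cV[R]_4) (m : M) (k : R) : Prop :=
  exists2 w, w != 0 & dif N m w = - k *: dif rho m w.

Definition nonneg_principal_curvature (rho N : M -> 'cV[R]_4) (a : M -> R)
    : Prop :=
  forall m, 0 <= a m /\ principal_curvature rho N m (a m).

Definition unit_field (rho : M -> 'cV[R]_4) (W : M -> 'cV[R]_2) : Prop :=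
  smooth_on W /\ forall m, metric rho m (W m) (W m) = 1.

(* The tangent vector W i m is viewed in R^4 through the differential of rho. *)
Definition principal_frame (rho N : M -> 'cV[R]_4) (a : M -> R)
    (W1 W2 : M -> 'cV[R]_2) : Prop :=
  [/\ unit_field rho W1,
      unit_field rho W2,
      forall m, dif N m (W1 m) = - a m *: dif rho m (W1 m)
    & forall m, dif N m (W2 m) = a m *: dif rho m (W2 m)].

Definition so4 : set 'M[R]_4 := [set B | B^T = - B].

Definition fB (rho N : M -> 'cV[R]_4) (B : 'M[R]_4) : M -> R :=
  fun m => dot (B *m rho m) (N m).

Definition htheta (a : M -> R) (W1 W2 : M -> 'cV[R]_2) (theta : R) : M -> R :=
  fun m => cos theta * a m `^ (- (3 / 2)) * dif a m (W1 m)
         + sin theta * a m `^ (- (3 / 2)) * dif a m (W2 m).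

Definition NS (rho N : M -> 'cV[R]_4) (a : M -> R) (W1 W2 : M -> 'cV[R]_2)
    : set (M -> R) :=
  [set f | exists B lambda theta, so4 B /\
     f = fB rho N B + lambda *: (htheta a W1 W2 theta : M -> R)].

(* A smooth map of the torus is given by a smooth lift to its universal cover,
   which exists because the plane is simply connected. *)
Definition smooth_lift (phi : M -> M) (F : 'cV[R]_2 -> 'cV[R]_2) : Prop :=
  smooth F /\ forall x, p (F x) = phi (p x).

Definition diffeomorphism (phi : M -> M) : Prop :=
  exists psi, [/\ cancel phi psi, cancel psi phi,
    exists F, smooth_lift phi F & exists G, smooth_lift psi G].

Definition isometries (rho : M -> 'cV[R]_4) : set (M -> M) :=
  [set phi | diffeomorphism phi /\
     exists2 F, smooth_lift phi F &
       forall x v w, metric rho (p (F x)) ('D_v F x) ('D_w F x)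
                     = metric rho (p x) v w].

End Torus.

Definition has_dim (K : fieldType) (V : lmodType K) (S : set V) (n : nat)
    : Prop :=
  exists b : 'I_n -> V,
    (forall c : 'I_n -> K, \sum_i c i *: b i = 0 -> forall i, c i = 0) /\
    S = [set v | exists c : 'I_n -> K, v = \sum_i c i *: b i].

(* nnt(M) = n *)
Definition natural_nullity (R : realType) (M : Type) (p : 'cV[R]_2 -> M)
    (rho N : M -> 'cV[R]_4) (a : M -> R) (W1 W2 : M -> 'cV[R]_2) (n : nat)
    : Prop :=
  has_dim (NS p rho N a W1 W2) n.

(* Main.v *)
Require Import Defs.
From HB Require Import structures.
From mathcomp Require Import all_boot all_order all_algebra.
From mathcomp Require Import all_classical all_reals all_analysis.
From mathcomp Require Import ring lra.

Set Implicit Arguments.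
Unset Strict Implicit.
Unset Printing Implicit Defensive.

Import Order.TTheory GRing.Theory Num.Theory numFieldNormedType.Exports.

Local Open Scope classical_set_scope.
Local Open Scope ring_scope.

(* Work on the universal cover R^2, where r = rho o p and n = N o p are doubly
   periodic, and let e1, e2 be the images of W1, W2 under dr.

   Codazzi's equations make a solve a linear ODE along every line, so that a
   vanishes everywhere or nowhere. If a = 0, then rho is totally geodesic by
   minimality and M has curvature 1, against Gauss-Bonnet.

   If a > 0, Codazzi's equations say that the forms sqrt a <e_i, dr> are closed.
   Their potentials give a global diffeomorphism Phi of the plane, in whose
   coordinates z = (x, y) the metric is lam (dx^2 + dy^2) with lam = 1 / a.
   With u_1, u_2 the partial derivatives of (1/2) log lam, one has
   h_theta = - 2 (cos theta u_1 + sin theta u_2).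

   If nnt <= 6, the six functions f_B of a basis of so(4) and h_theta are
   linearly dependent for every theta. Hence one of the following holds.
   - f_B = 0 for some B <> 0. Then x |-> B x is tangent to M, hence a Killing
     field, which is constant in the coordinate z: lam is invariant under a
     one-parameter group of translations.
   - u_1 = f_B and u_2 = f_B' for some B, B'. The entries of B and B' in the
     moving frame (r, n, r_x, r_y) then solve with lam and a a closed system of
     ODEs, which is invariant under the reflection at a critical point c of a.
     Hence lam (c + v) = lam (c - v).
   A translation or a reflection of the z-plane which preserves lam descends to
   an isometry of M. *)

(** * Calculus of smooth maps *)

(** An isometry has to be built in the whole plane before it can descend, so local coordinates do
    not suffice: [Phi] must be a bijection of the plane. Periodicity supplies this. The frame dual
    to d[Phi] and the second derivatives of [Phi] are bounded over the plane, so the inverse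
    function theorem holds with radii independent of the point, and lifting paths in steps of
    uniform size gives bijectivity. In the second case, two values of theta are what closes the
    system: once u_1 and u_2 are themselves entries f and f', all right-hand sides are polynomials
    in fourteen functions, namely lam, sig = 1 / lam and the six entries of each matrix. Two
    solutions are not compared by a uniqueness theorem; the defects from evenness or oddness about c
    are estimated directly by Gronwall's inequality. The odd functions must vanish at c: for u_1 and
    u_2 this is criticality of a, for the two entries k it follows from u_xy = u_yx, where u = (1/2)
    log lam. *)

Section Smooth.
Context {R : realType} {U : normedModType R}.
Implicit Types (V : normedModType R).

Lemma Ck_continuous V k (f : U -> V) : is_Ck k f -> continuous f.
Proof.
by case: k => [//|k [df _]] x; apply: differentiable_continuous.
Qed.

Lemma CkW V k (f : U -> V) : is_Ck k.+1 f -> is_Ck k f.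
Proof.
elim: k f => [f /Ck_continuous//|k IH f [df Df]].
by split=> // v; apply: IH; exact: Df.
Qed.

Lemma smooth_diff V (f : U -> V) x : smooth f -> differentiable f x.
Proof. by move=> /(_ 1%N) [+ _]; apply. Qed.

Lemma smooth_D V (f : U -> V) v : smooth f -> smooth (fun x => 'D_v f x).
Proof. by move=> sf k; have [_] := sf k.+1; apply. Qed.

Lemma smooth_continuous V (f : U -> V) : smooth f -> continuous f.
Proof. by move=> /(_ 0%N). Qed.

(** Serves for functions whose derivative is an expression in the function itself, such as a square
    root or an inverse map: each order of regularity of [f] then yields the next one. *)
Lemma smooth_bootstrap V (f : U -> V) :
  (forall x, differentiable f x) ->
  (forall k v, is_Ck k f -> is_Ck k (fun x => 'D_v f x)) -> smooth f.
Proof.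
move=> df Df; elim=> [x|k IH]; first exact: differentiable_continuous.
by split=> // v; exact: Df.
Qed.

Lemma Ck_cst V k (c : V) : is_Ck k (cst c : U -> V).
Proof.
elim: k c => [|k IH] c; first by move=> x; exact: cst_continuous.
split=> // v; rewrite (_ : (fun x => _) = cst 0) //.
by apply/funext => x; rewrite derive_cst.
Qed.

Lemma CkD V k (f g : U -> V) : is_Ck k f -> is_Ck k g ->
  is_Ck k (fun x => f x + g x).
Proof.
elim: k f g => [|k IH] f g; first by move=> cf cg x; exact: (cvgD (cf x) (cg x)).
move=> [df Df] [dg Dg]; split=> [x|v]; first exact: differentiableD.
rewrite (_ : (fun x => _) = fun x => 'D_v f x + 'D_v g x); first exact: (IH _ _ (Df v) (Dg v)).
by apply/funext => x; apply: deriveD; exact: diff_derivable.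
Qed.

Lemma CkZ V k (f : U -> V) c : is_Ck k f -> is_Ck k (fun x => c *: f x).
Proof.
elim: k f => [|k IH] f.
  by move=> cf x; apply: continuousZ; [exact: cst_continuous|exact: cf].
move=> [df Df]; split=> [x|v]; first exact: differentiableZ.
rewrite (_ : (fun x => _) = fun x => c *: 'D_v f x); first exact: (IH _ (Df v)).
by apply/funext => x; apply: deriveZ; exact: diff_derivable.
Qed.

Lemma CkM k (f g : U -> R) : is_Ck k f -> is_Ck k g ->
  is_Ck k (fun x => f x * g x).
Proof.
elim: k f g => [|k IH] f g; first by move=> cf cg x; exact: (cvgM (cf x) (cg x)).
move=> Cf Cg; have [df Df] := Cf; have [dg Dg] := Cg.
split=> [x|v]; first exact: differentiableM.
rewrite (_ : (fun x => _) = fun x => f x * 'D_v g x + g x * 'D_v f x).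
  by apply: CkD; apply: IH; [exact: CkW|exact: Dg|exact: CkW|exact: Df].
by apply/funext => x; apply: deriveM; exact: diff_derivable.
Qed.

Lemma Ck_sum V k (I : Type) (s : seq I) (F : I -> U -> V) :
  (forall i, is_Ck k (F i)) -> is_Ck k (fun x => \sum_(i <- s) F i x).
Proof.
move=> CF; elim: s => [|i s IH].
  rewrite (_ : (fun x => _) = cst 0); first exact: Ck_cst.
  by apply/funext => x; rewrite big_nil.
rewrite (_ : (fun x => _) = fun x => F i x + \sum_(j <- s) F j x); first exact: CkD.
by apply/funext => x; rewrite big_cons.
Qed.

Lemma diff_mx m n (f : U -> 'M[R]_(m, n)) x :
  (forall i j, differentiable (fun y => f y i j) x) -> differentiable f x.
Proof.
move=> df.
have -> : f = \sum_(i < m) \sum_(j < n) (fun y => f y i j *: delta_mx i j).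
  apply/funext => y; rewrite fct_sumE [LHS]matrix_sum_delta; apply: eq_bigr => i _.
  by rewrite fct_sumE.
apply: differentiable_sum => i; apply: differentiable_sum => j.
exact: differentiableZl.
Qed.

Lemma diff_entry m n (f : U -> 'M[R]_(m, n)) x i j :
  differentiable f x -> differentiable (fun y => f y i j) x.
Proof.
move=> df; apply: (@differentiable_comp _ _ _ _ f (fun M : 'M[R]_(m, n) => M i j)) => //.
exact: differentiable_coord.
Qed.

Lemma D_entry m n (f : U -> 'M[R]_(m, n)) x v i j :
  differentiable f x -> ('D_v f x) i j = 'D_v (fun y => f y i j) x.
Proof. by move=> df; rewrite derive_mx ?mxE//; exact: diff_derivable. Qed.

Lemma Ck_entry m n k (f : U -> 'M[R]_(m, n)) i j :
  is_Ck k f -> is_Ck k (fun x => f x i j).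
Proof.
elim: k f => [|k IH] f.
  by move=> cf x; apply: (@continuous_comp _ _ _ f (fun M : 'M[R]_(m, n) => M i j));
    [exact: cf|exact: coord_continuous].
move=> [df Df]; split=> [x|v]; first exact: diff_entry.
rewrite (_ : (fun x => _) = fun x => ('D_v f x) i j); first exact: (IH _ (Df v)).
by apply/funext => x; rewrite D_entry.
Qed.

Lemma Ck_mx m n k (f : U -> 'M[R]_(m, n)) :
  (forall i j, is_Ck k (fun x => f x i j)) -> is_Ck k f.
Proof.
elim: k f => [|k IH] f Cf.
  have -> : f = fun y => \sum_(i < m) \sum_(j < n) f y i j *: delta_mx i j.
    by apply/funext => y; rewrite [LHS]matrix_sum_delta.
  suff : is_Ck 0 (fun y => \sum_(i < m) \sum_(j < n)
      f y i j *: (delta_mx i j : 'M[R]_(m, n))) by [].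
  apply: Ck_sum => i; apply: Ck_sum => j x.
  by apply: continuousZ; [exact: (Cf i j x)|exact: cst_continuous].
have df x : differentiable f x by apply: diff_mx => i j; exact: (Cf i j).1.
split=> // v; apply: IH => i j.
rewrite (_ : (fun x => _) = fun x => 'D_v (fun y => f y i j) x); first exact: (Cf i j).2.
by apply/funext => x; rewrite D_entry.
Qed.

Lemma smooth_cst V (c : V) : smooth (cst c : U -> V).
Proof. by move=> k; exact: Ck_cst. Qed.
Lemma smoothD V (f g : U -> V) : smooth f -> smooth g -> smooth (fun x => f x + g x).
Proof. by move=> sf sg k; exact: CkD. Qed.
Lemma smoothZ V (f : U -> V) c : smooth f -> smooth (fun x => c *: f x).
Proof. by move=> sf k; exact: CkZ. Qed.
Lemma smoothM (f g : U -> R) : smooth f -> smooth g -> smooth (fun x => f x * g x).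
Proof. by move=> sf sg k; exact: CkM. Qed.
Lemma smoothN V (f : U -> V) : smooth f -> smooth (fun x => - f x).
Proof.
move=> /smoothZ-/(_ (-1)); congr smooth; apply/funext => x; exact: scaleN1r.
Qed.
Lemma smoothB V (f g : U -> V) : smooth f -> smooth g -> smooth (fun x => f x - g x).
Proof. by move=> sf sg; apply: smoothD => //; exact: smoothN. Qed.
Lemma smooth_sum V (I : Type) (s : seq I) (F : I -> U -> V) :
  (forall i, smooth (F i)) -> smooth (fun x => \sum_(i <- s) F i x).
Proof. by move=> sF k; apply: Ck_sum => i; exact: sF. Qed.
Lemma smooth_entry m n (f : U -> 'M[R]_(m, n)) i j :
  smooth f -> smooth (fun x => f x i j).
Proof. by move=> sf k; exact: Ck_entry. Qed.
Lemma smooth_mx m n (f : U -> 'M[R]_(m, n)) :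
  (forall i j, smooth (fun x => f x i j)) -> smooth f.
Proof. by move=> sf k; apply: Ck_mx => i j; exact: sf. Qed.

Lemma smoothZl m n (c : U -> R) (f : U -> 'M[R]_(m, n)) :
  smooth c -> smooth f -> smooth (fun x => c x *: f x).
Proof.
move=> sc sf; apply: smooth_mx => i j.
rewrite (_ : (fun x => _) = fun x => c x * f x i j).
  by apply: smoothM => //; exact: smooth_entry.
by apply/funext => x; rewrite mxE.
Qed.

Lemma smooth_dot n (f g : U -> 'cV[R]_n) :
  smooth f -> smooth g -> smooth (fun x => dot (f x) (g x)).
Proof.
move=> sf sg; rewrite (_ : (fun x => _) = fun x => \sum_i f x i 0 * g x i 0).
  by apply: smooth_sum => i; apply: smoothM; exact: smooth_entry.
apply/funext => x; rewrite /dot mxE; apply: eq_bigr => i _; by rewrite mxE.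
Qed.

Lemma smooth_mulmx m n (B : 'M[R]_(m, n)) (f : U -> 'cV[R]_n) :
  smooth f -> smooth (fun x => B *m f x).
Proof.
move=> sf; apply: smooth_mx => i j.
rewrite (_ : (fun x => _) = fun x => \sum_k B i k * f x k j).
  by apply: smooth_sum => k; apply: smoothM; [exact: smooth_cst|exact: smooth_entry].
by apply/funext => x; rewrite mxE.
Qed.

Lemma CkV k (f : U -> R) : (forall x, f x != 0) -> is_Ck k f ->
  is_Ck k (fun x => (f x)^-1).
Proof.
move=> f0; elim: k f f0 => [|k IH] f f0.
  by move=> cf x; apply: cvgV => //; exact: cf.
move=> Cf; have [df Df] := Cf; split=> [x|v]; first exact: differentiableV.
rewrite (_ : (fun x => _) = fun x => (-1) * ((f x)^-1 * (f x)^-1) * 'D_v f x).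
  have CfV : is_Ck k (fun x => (f x)^-1) by apply: IH => //; exact: CkW.
  by apply: CkM; [apply: CkM; [exact: Ck_cst|exact: CkM]|exact: Df].
apply/funext => x; rewrite deriveV//; last exact: diff_derivable.
by rewrite expr2 invfM mulN1r.
Qed.

Lemma smoothV (f : U -> R) : (forall x, f x != 0) -> smooth f ->
  smooth (fun x => (f x)^-1).
Proof. by move=> f0 sf k; exact: CkV. Qed.

End Smooth.

Section Rules.
Context {R : realType} {U : normedModType R}.

Lemma D_D (V : normedModType R) (f g : U -> V) x v : smooth f -> smooth g ->
  'D_v (fun y => f y + g y) x = 'D_v f x + 'D_v g x.
Proof. by move=> sf sg; apply: deriveD; apply/diff_derivable/smooth_diff. Qed.
Lemma D_B (V : normedModType R) (f g : U -> V) x v : smooth f -> smooth g ->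
  'D_v (fun y => f y - g y) x = 'D_v f x - 'D_v g x.
Proof. by move=> sf sg; apply: deriveB; apply/diff_derivable/smooth_diff. Qed.
Lemma D_N (V : normedModType R) (f : U -> V) x v : smooth f ->
  'D_v (fun y => - f y) x = - 'D_v f x.
Proof. by move=> sf; apply: deriveN; apply/diff_derivable/smooth_diff. Qed.
Lemma D_Z (V : normedModType R) (f : U -> V) c x v : smooth f ->
  'D_v (fun y => c *: f y) x = c *: 'D_v f x.
Proof. by move=> sf; apply: deriveZ; apply/diff_derivable/smooth_diff. Qed.
Lemma D_M (f g : U -> R) x v : smooth f -> smooth g ->
  'D_v (fun y => f y * g y) x = 'D_v f x * g x + f x * 'D_v g x.
Proof.
move=> sf sg; have df := diff_derivable (v := v) (smooth_diff x sf).
have dg := diff_derivable (v := v) (smooth_diff x sg).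
by have /= -> := deriveM df dg; rewrite addrC; congr (_ + _); exact: mulrC.
Qed.
Lemma D_cst (V : normedModType R) (c : V) x v : 'D_v (fun _ : U => c) x = 0.
Proof. exact: derive_cst. Qed.

Lemma D_V (f : U -> R) x v : (forall x, f x != 0) -> smooth f ->
  'D_v (fun y => (f y)^-1) x = - 'D_v f x / f x ^+ 2.
Proof.
move=> f0 sf; rewrite deriveV//; last exact/diff_derivable/smooth_diff.
by rewrite [LHS]/GRing.scale/= mulNr mulrC mulNr.
Qed.

Lemma D_mxE m n (f : U -> 'M[R]_(m, n)) x v i j : smooth f ->
  ('D_v f x) i j = 'D_v (fun y => f y i j) x.
Proof. by move=> sf; apply: D_entry; exact: smooth_diff. Qed.

Lemma D_sum (V : normedModType R) n (F : 'I_n -> U -> V) x v :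
  (forall i, smooth (F i)) ->
  'D_v (fun y => \sum_i F i y) x = \sum_i 'D_v (F i) x.
Proof.
move=> sF; rewrite -derive_sum; last by move=> i; apply/diff_derivable/smooth_diff.
by congr ('D_v _ x); apply/funext => y; rewrite fct_sumE.
Qed.

Lemma D_Zl m n (c : U -> R) (f : U -> 'M[R]_(m, n)) x v : smooth c -> smooth f ->
  'D_v (fun y => c y *: f y) x = 'D_v c x *: f x + c x *: 'D_v f x.
Proof.
move=> sc sf; apply/matrixP => i j; rewrite !mxE !D_mxE//; last exact: smoothZl.
rewrite -D_M//; last exact: smooth_entry.
by congr ('D_v _ x); apply/funext => y; rewrite mxE.
Qed.

Lemma dotE n (u v : 'cV[R]_n) : dot u v = \sum_i u i 0 * v i 0.
Proof. by rewrite /dot mxE; apply: eq_bigr => i _; rewrite mxE. Qed.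

Lemma D_dot n (f g : U -> 'cV[R]_n) x v : smooth f -> smooth g ->
  'D_v (fun y => dot (f y) (g y)) x = dot ('D_v f x) (g x) + dot (f x) ('D_v g x).
Proof.
move=> sf sg.
rewrite (_ : (fun y => _) = fun y => \sum_i f y i 0 * g y i 0); last first.
  by apply/funext => y; rewrite dotE.
have se i := smooth_entry i 0 sf; have sh i := smooth_entry i 0 sg.
rewrite D_sum; last by move=> i; exact: smoothM.
rewrite !dotE -big_split; apply: eq_bigr => i _.
by rewrite D_M// !D_mxE.
Qed.

Lemma D_mulmx m n (B : 'M[R]_(m, n)) (f : U -> 'cV[R]_n) x v : smooth f ->
  'D_v (fun y => B *m f y) x = B *m 'D_v f x.
Proof.
move=> sf; apply/matrixP => i j; rewrite D_mxE ?mxE; last exact: smooth_mulmx.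
rewrite (_ : (fun x => _) = fun x => \sum_k B i k * f x k j); last first.
  by apply/funext => y; rewrite mxE.
rewrite D_sum; last first.
  by move=> k; apply: smoothM; [exact: smooth_cst|exact: smooth_entry].
apply: eq_bigr => k _; rewrite D_M//; last exact: smooth_entry.
  by rewrite D_cst mul0r add0r D_mxE.
exact: smooth_cst.
Qed.

Lemma D_dirD (V : normedModType R) (f : U -> V) x v w : differentiable f x ->
  'D_(v + w) f x = 'D_v f x + 'D_w f x.
Proof. by move=> df; rewrite !deriveE// linearD. Qed.
Lemma D_dirZ (V : normedModType R) (f : U -> V) x c v : differentiable f x ->
  'D_(c *: v) f x = c *: 'D_v f x.
Proof. by move=> df; rewrite !deriveE// linearZ. Qed.

Lemma D_dirB (V : normedModType R) (f : U -> V) x v w : differentiable f x ->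
  'D_(v - w) f x = 'D_v f x - 'D_w f x.
Proof. by move=> df; rewrite !deriveE// linearB. Qed.

Lemma line_is_derive (V : normedModType R) (f : U -> V) (c v : U) (t : R) :
  differentiable f (c + t *: v) ->
  is_derive t (1 : R) (fun s : R => f (c + s *: v)) ('D_v f (c + t *: v)).
Proof.
move=> df; have dl : is_diff t (fun s : R => c + s *: v) (fun s => s *: v).
  by apply: is_diff_eq; rewrite add0r.
have dc := @is_diff_comp _ _ _ _ (fun s : R => c + s *: v) _ f _ t dl (differentiableP df).
split; first by apply: diff_derivable; case: dc.
by rewrite deriveE; [case: dc => _ ->; rewrite /= scale1r deriveE|case: dc].
Qed.

Lemma line_mvt (f : U -> R) x v : (forall y, differentiable f y) ->
  exists2 t, 0 <= t <= 1 & f (x + v) - f x = 'D_v f (x + t *: v).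
Proof.
move=> df; have [|||t t01] := @MVT _ (fun t => f (x + t *: v)) (fun t => 'D_v f (x + t *: v)) 0 1.
- exact: ltr01.
- by move=> t _; exact: line_is_derive.
- apply: continuous_subspaceT => t; apply/differentiable_continuous/derivable1_diffP.
  by case: (line_is_derive (df (x + t *: v))).
- rewrite scale1r scale0r addr0 subr0 mulr1 => ->.
  by exists t => //; move: t01; rewrite in_itv /= => /andP[/ltW -> /ltW ->].
Qed.

End Rules.

Section Composition.
Context {R : realType} {U : normedModType R}.

Lemma vec_basis n (v : 'cV[R]_n) : v = \sum_i v i 0 *: delta_mx i 0.
Proof.
rewrite [LHS]matrix_sum_delta; apply: eq_bigr => i _.
by rewrite big_ord1.
Qed.

Lemma D_basis (V : normedModType R) n (g : 'cV[R]_n -> V) y v :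
  differentiable g y -> 'D_v g y = \sum_i v i 0 *: 'D_(delta_mx i 0) g y.
Proof.
move=> dg; rewrite {1}(vec_basis v) deriveE// linear_sum; apply: eq_bigr => i _.
by rewrite linearZ deriveE.
Qed.

Lemma D_comp (V W : normedModType R) (f : U -> W) (g : W -> V) x v :
  differentiable f x -> differentiable g (f x) ->
  'D_v (fun y => g (f y)) x = 'D_('D_v f x) g (f x).
Proof.
move=> df dg; rewrite [LHS]deriveE; last exact: differentiable_comp.
by rewrite (diff_comp df dg)/= -deriveE// -deriveE.
Qed.

Lemma Ck_comp n k (f : U -> 'cV[R]_n) (g : 'cV[R]_n -> R) :
  is_Ck k f -> smooth g -> is_Ck k (fun x => g (f x)).
Proof.
elim: k g => [|k IH] g.
  move=> cf /smooth_continuous cg x.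
  by apply: (@continuous_comp _ _ _ f g); [exact: cf|exact: cg].
move=> Cf sg; have [df Df] := Cf; split=> [x|v].
  by apply: differentiable_comp => //; exact: smooth_diff.
rewrite (_ : (fun x => _) = fun x =>
  \sum_i ('D_v f x) i 0 * 'D_(delta_mx i 0) g (f x)).
  apply: Ck_sum => i; apply: CkM; first by apply: Ck_entry; exact: Df.
  by apply: (IH (fun y => 'D_(delta_mx i 0) g y)); [exact: CkW|exact: smooth_D].
apply/funext => x; rewrite (@D_comp _ _ f g)//; last exact: smooth_diff.
by rewrite D_basis//; exact: smooth_diff.
Qed.

Lemma smooth_comp n (f : U -> 'cV[R]_n) (g : 'cV[R]_n -> R) :
  smooth f -> smooth g -> smooth (fun x => g (f x)).
Proof. by move=> sf sg k; exact: Ck_comp. Qed.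

Lemma smooth_compmx n p q (f : U -> 'cV[R]_n) (g : 'cV[R]_n -> 'M[R]_(p, q)) :
  smooth f -> smooth g -> smooth (fun x => g (f x)).
Proof.
move=> sf sg; apply: smooth_mx => i j; apply: (smooth_comp (g := fun y => g y i j)) => //.
exact: smooth_entry.
Qed.

Lemma smooth_id : smooth (fun x : U => x).
Proof.
move=> [|k]; first by move=> x; exact: cvg_id.
split=> // v; rewrite (_ : (fun x => _) = cst v); first exact: Ck_cst.
by apply/funext => x; rewrite derive_id.
Qed.

Lemma smooth_sqrt (f : U -> R) : (forall x, 0 < f x) -> smooth f ->
  smooth (fun x => Num.sqrt (f x)).
Proof.
move=> f0 sf.
have dd x : differentiable (@Num.sqrt R) (f x).
  by apply/derivable1_diffP; case: (is_derive1_sqrt (f0 x)).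
apply: smooth_bootstrap => [x|k v Ck].
  by apply: (@differentiable_comp _ _ _ _ f) => //; exact: smooth_diff.
rewrite (_ : (fun x => _) = fun x => (2 * Num.sqrt (f x))^-1 * 'D_v f x).
  apply: CkM; last exact: smooth_D.
  apply: CkV; last by apply: CkM => //; exact: Ck_cst.
  by move=> x; rewrite mulf_neq0// ?gt_eqF// sqrtr_gt0.
apply/funext => x; rewrite (@D_comp _ _ f)//; last exact: smooth_diff.
have -> : 'D_('D_v f x) (@Num.sqrt R) (f x) = 'D_v f x *: 'D_1 (@Num.sqrt R) (f x).
  by rewrite -(D_dirZ _ _ (dd x)); congr ('D_ _ _ _); rewrite /GRing.scale/= mulr1.
by have [_ ->] := is_derive1_sqrt (f0 x); rewrite [LHS]mulrC.
Qed.

Lemma D_sqrt (f : U -> R) x v : (forall x, 0 < f x) -> smooth f ->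
  'D_v (fun x => Num.sqrt (f x)) x = 'D_v f x / (2 * Num.sqrt (f x)).
Proof.
move=> f0 sf; have ss := smooth_sqrt f0 sf.
have s0 : Num.sqrt (f x) != 0 by rewrite gt_eqF// sqrtr_gt0.
have : 'D_v (fun y => Num.sqrt (f y) * Num.sqrt (f y)) x = 'D_v f x.
  congr ('D_v _ x); apply/funext => y; rewrite -expr2 sqr_sqrtr//; exact: ltW.
rewrite D_M// => <-; field; exact: s0.
Qed.

End Composition.

(** * Symmetry of second derivatives *)

Lemma schwarz_lim (R : realType) (U : normedModType R) (A B : U -> R) (x v w : U) :
  {for x, continuous A} -> {for x, continuous B} ->
  (forall h, 0 < h -> exists s t s' t',
    [/\ 0 <= s <= h, 0 <= t <= h, 0 <= s' <= h, 0 <= t' <= h &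
    A (x + s *: v + t *: w) = B (x + s' *: v + t' *: w)]) -> A x = B x.
Proof.
move=> cA cB H; apply/eqP; rewrite -subr_eq0 -normr_eq0; apply/negPn/negP => AB0.
have e0 : 0 < `|A x - B x| / 2 by rewrite divr_gt0// normr_gt0 -normr_eq0.
have /cvgrPdist_lt/(_ _ e0)/nbhs_normP [d1 /= d10 Hd1] := cA.
have /cvgrPdist_lt/(_ _ e0)/nbhs_normP [d2 /= d20 Hd2] := cB.
set d := Num.min d1 d2; have d0 : 0 < d by rewrite lt_min d10.
have dd1 : d <= d1 by rewrite ge_min lexx.
have dd2 : d <= d2 by rewrite ge_min lexx orbT.
(* With [h = d / K] all points [x + s v + t w] with [0 <= s, t <= h] lie within [d] of [x]; the 1
   keeps [K] positive when [v = w = 0]. *)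
set K := `|v| + `|w| + 1; have K0 : 0 < K by rewrite /K ltr_wpDl// addr_ge0.
have near_x h s t : 0 <= s <= h -> 0 <= t <= h -> h = d / K ->
    `|x - (x + s *: v + t *: w)| < d.
  move=> /andP[s0 sh] /andP[t0 th] hE.
  rewrite -addrA opprD addrA subrr sub0r normrN (le_lt_trans (ler_normD _ _))//.
  rewrite !normrZ !ger0_norm// (@le_lt_trans _ _ (h * (`|v| + `|w|)))//.
    by rewrite mulrDr lerD// ler_wpM2r.
  by rewrite hE mulrAC ltr_pdivrMr// ltr_pM2l// /K ltrDl.
have h0 : 0 < d / K by rewrite divr_gt0.
have [s [t [s' [t' [Hs Ht Hs' Ht' E]]]]] := H _ h0.
have B1 := Hd1 _ (lt_le_trans (near_x _ _ _ Hs Ht erefl) dd1).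
have B2 := Hd2 _ (lt_le_trans (near_x _ _ _ Hs' Ht' erefl) dd2).
have AB : A x - B x = (A x - A (x + s *: v + t *: w)) -
    (B x - B (x + s' *: v + t' *: w)) by rewrite E; ring.
have : `|A x - B x| < `|A x - B x| / 2 + `|A x - B x| / 2.
  by rewrite {1}AB; apply: le_lt_trans (ler_normB _ _) _; exact: (ltrD B1 B2).
by rewrite -splitr ltxx.
Qed.

Section Schwarz.
Context {R : realType} {n : nat}.
Let U : normedModType R := 'cV[R]_n.

Lemma smooth_shift (f : U -> R) (c : U) : smooth f -> smooth (fun y => f (y + c)).
Proof.
move=> sf; apply: (smooth_comp (f := fun y => y + c)) => //.
by apply: smoothD; [exact: smooth_id|exact: smooth_cst].
Qed.

Lemma D_shift (V : normedModType R) (f : U -> V) c x v :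
  'D_v (fun y => f (y + c)) x = 'D_v f (x + c).
Proof.
rewrite /derive; suff -> : (fun h : R => h^-1 *: (((fun y => f (y + c)) \o shift x)
    (h *: v) - f (x + c))) =
  (fun h : R => h^-1 *: ((f \o shift (x + c)) (h *: v) - f (x + c))) by [].
by apply/funext => h /=; rewrite addrA.
Qed.

(** Two uses of the mean value theorem: along [v] for the increment [f (y + w) - f y], then along
    [w] for ['D_v f]. *)
Lemma second_difference (f : U -> R) x v w : smooth f ->
  exists s t, [/\ 0 <= s <= 1, 0 <= t <= 1 &
    f (x + v + w) - f (x + v) - (f (x + w) - f x) =
    'D_w (fun y => 'D_v f y) (x + s *: v + t *: w)].
Proof.
move=> sf.
have [|s s01 H1] := @line_mvt _ _ (fun y => f (y + w) - f y) x v.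
  by move=> y; apply: smooth_diff; apply: smoothB => //; exact: smooth_shift.
have [|t t01 H2] := @line_mvt _ _ (fun y => 'D_v f y) (x + s *: v) w.
  by move=> y; apply: smooth_diff; exact: smooth_D.
exists s, t; split => //; rewrite -H2; move: H1.
rewrite (D_B _ _ (smooth_shift w sf) sf).
by rewrite D_shift => <-; ring.
Qed.

(** The second difference over the parallelogram spanned by [h v] and [h w] is symmetric in the two
    vectors, and equals [h ^ 2] times either mixed derivative at a point close to [x]; continuity
    does the rest. *)
Lemma schwarz (f : U -> R) x v w : smooth f ->
  'D_w (fun y => 'D_v f y) x = 'D_v (fun y => 'D_w f y) x.
Proof.
move=> sf.
apply: (@schwarz_lim R U (fun y => 'D_w (fun y => 'D_v f y) y)
                     (fun y => 'D_v (fun y => 'D_w f y) y) x v w).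
- by apply: smooth_continuous; do 2 apply: smooth_D.
- by apply: smooth_continuous; do 2 apply: smooth_D.
move=> h h0.
have [s [t [s01 t01 E1]]] := second_difference x (h *: v) (h *: w) sf.
have [t' [s' [t01' s01' E2]]] := second_difference x (h *: w) (h *: v) sf.
have sc r : 0 <= r <= 1 -> 0 <= r * h <= h.
  by move=> /andP[r0 r1]; apply/andP; split;
    [apply: mulr_ge0 => //; exact: ltW|apply: ler_piMl => //; exact: ltW].
exists (s * h), (t * h), (s' * h), (t' * h); split; [exact: sc..|].
have dd c u u' y : 'D_(c *: u) (fun y => 'D_(c *: u') f y) y =
    c * c * 'D_u (fun y => 'D_u' f y) y.
  rewrite D_dirZ; last by apply: smooth_diff; exact: smooth_D.
  rewrite (_ : (fun y => _) = fun y => c *: 'D_u' f y); last first.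
    by apply/funext => z; rewrite D_dirZ//; exact: smooth_diff.
  by rewrite D_Z; [rewrite /GRing.scale/= mulrA|exact: smooth_D].
have h2 : h * h != 0 by rewrite mulf_neq0// gt_eqF.
have F1 := etrans E1 (dd h w v _); have F2 := etrans E2 (dd h v w _).
have G1 : x + s *: (h *: v) + t *: (h *: w) = x + (s * h) *: v + (t * h) *: w.
  by rewrite !scalerA.
have G2 : x + t' *: (h *: w) + s' *: (h *: v) = x + (s' * h) *: v + (t' * h) *: w.
  by rewrite !scalerA addrAC.
rewrite {}G1 in F1; rewrite {}G2 (addrAC x (h *: w)) in F2.
have cancel_h (r1 r2 c1 c2 : R) : c1 = h * h * r1 -> c2 = h * h * r2 -> c1 = c2 -> r1 = r2.
  by move=> -> -> /(mulfI h2).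
apply: cancel_h F1 F2 _.
by set a1 := f _; set a2 := f _; set a3 := f _; set a4 := f _; ring.
Qed.

End Schwarz.

(* Otherwise unification unfolds ['D_v f x] down to its defining limit. *)
#[local] Opaque derive.

Section VectorFields.
Context {R : realType} {n : nat}.
Notation U := 'cV[R]_n.

Lemma schwarzmx p q (f : U -> 'M[R]_(p, q)) x v w : smooth f ->
  'D_w (fun y => 'D_v f y) x = 'D_v (fun y => 'D_w f y) x.
Proof.
move=> sf; apply/matrixP => i j.
have E u u' : ('D_u' (fun y => 'D_u f y) x) i j =
    'D_u' (fun y => 'D_u (fun z => f z i j) y) x.
  rewrite D_mxE; last exact: smooth_D.
  by congr ('D_u' _ x); apply/funext => y; rewrite D_mxE.
have F := schwarz x v w (smooth_entry i j sf).
apply: etrans (E v w) _.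
apply: etrans (esym (E w v)).
exact: F.
Qed.

Lemma smooth_Dfield (X : U -> U) (f : U -> R) : smooth X -> smooth f ->
  smooth (fun y => 'D_(X y) f y).
Proof.
move=> sX sf; rewrite (_ : (fun y => _) =
    fun y => \sum_i X y i 0 * 'D_(delta_mx i 0) f y).
  by apply: smooth_sum => i; apply: smoothM; [exact: smooth_entry|exact: smooth_D].
by apply/funext => y; rewrite D_basis//; exact: smooth_diff.
Qed.

Lemma D_Dfield (X : U -> U) (f : U -> R) x v : smooth X -> smooth f ->
  'D_v (fun y => 'D_(X y) f y) x =
  'D_('D_v X x) f x + 'D_v (fun y => 'D_(X x) f y) x.
Proof.
move=> sX sf; rewrite (_ : (fun y => 'D_(X y) f y) =
    fun y => \sum_i X y i 0 * 'D_(delta_mx i 0) f y); last first.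
  by apply/funext => y; rewrite D_basis//; exact: smooth_diff.
rewrite D_sum; last first.
  by move=> i; apply: smoothM; [exact: smooth_entry|exact: smooth_D].
rewrite (_ : (fun y => 'D_(X x) f y) =
    fun y => \sum_i X x i 0 * 'D_(delta_mx i 0) f y); last first.
  by apply/funext => y; rewrite D_basis//; exact: smooth_diff.
rewrite D_sum; last first.
  by move=> i; apply: smoothM; [exact: smooth_cst|exact: smooth_D].
rewrite [X in X + _]D_basis; last exact: smooth_diff.
rewrite -big_split/=; apply: eq_bigr => i _.
rewrite !D_M ?D_cst; [|exact: smooth_cst|exact: smooth_D|exact: smooth_entry|exact: smooth_D].
by rewrite D_mxE// mul0r add0r.
Qed.

Lemma smooth_Dfieldmx p q (X : U -> U) (f : U -> 'M[R]_(p, q)) :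
  smooth X -> smooth f -> smooth (fun y => 'D_(X y) f y).
Proof.
move=> sX sf; apply: smooth_mx => i j.
rewrite (_ : (fun x => _) = fun x => 'D_(X x) (fun y => f y i j) x).
  by apply: smooth_Dfield => //; exact: smooth_entry.
by apply/funext => x; rewrite D_mxE.
Qed.

Lemma D_Dfieldmx p q (X : U -> U) (f : U -> 'M[R]_(p, q)) x v :
  smooth X -> smooth f ->
  'D_v (fun y => 'D_(X y) f y) x =
  'D_('D_v X x) f x + 'D_v (fun y => 'D_(X x) f y) x.
Proof.
move=> sX sf; apply/matrixP => i j.
apply: etrans (D_mxE x v i j (smooth_Dfieldmx sX sf)) _.
rewrite (_ : (fun y => ('D_(X y) f y) i j) =
   fun x => 'D_(X x) (fun y => f y i j) x); last first.
  by apply/funext => y; exact: D_mxE.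
apply: etrans (D_Dfield x v sX (smooth_entry i j sf)) _.
rewrite [RHS]mxE; congr (_ + _); first exact: esym (D_mxE _ _ _ _ sf).
apply: etrans (esym (D_mxE x v i j (smooth_D (X x) sf))).
by congr ('D_v _ x); apply/funext => y; exact: esym (D_mxE _ _ _ _ sf).
Qed.

(** ['D_(X x) Y x - 'D_(Y x) X x] is the Lie bracket of the fields in flat coordinates; the second
    derivatives of [f] cancel by Schwarz. *)
Lemma commutator p q (X Y : U -> U) (f : U -> 'M[R]_(p, q)) x :
  smooth X -> smooth Y -> smooth f ->
  'D_(X x) (fun y => 'D_(Y y) f y) x - 'D_(Y x) (fun y => 'D_(X y) f y) x =
  'D_('D_(X x) Y x - 'D_(Y x) X x) f x.
Proof.
move=> sX sY sf; have alg (a b c d : 'M[R]_(p, q)) : c = d -> a + c - (b + d) = a - b.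
  by move=> ->; rewrite opprD addrACA subrr addr0.
apply: etrans (congr2 (fun a b => a - b) (D_Dfieldmx x (X x) sY sf)
  (D_Dfieldmx x (Y x) sX sf)) _.
apply: etrans (alg _ _ _ _ (schwarzmx x (Y x) (X x) sf)) _.
exact: esym (D_dirB _ _ (smooth_diff x sf)).
Qed.

End VectorFields.

(** * Compactness and lattice-periodic functions *)

Section Compactness.
Context {R : realType} {n : nat}.
Notation U := 'cV[R]_n.

Lemma normv_le (v : U) b : 0 <= b -> (forall i, `|v i 0| <= b) -> `|v| <= b.
Proof.
move=> b0 vb; rewrite /Num.Def.normr/= mx_normrE.
by apply: bigmax_le => // -[i j] _ /=; rewrite ord1.
Qed.

Lemma entry_le_norm (v : U) i : `|v i 0| <= `|v|.
Proof.
rewrite [leRHS]/Num.Def.normr/= mx_normrE.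
exact: (@le_bigmax _ _ _ 0 (fun ij => `|v ij.1 ij.2|) (i, 0)).
Qed.

(** In the sup norm a ball is a box, the image of a product of segments under transposition and
    translation by [c]. *)
Lemma compact_cball (c : U) b : compact [set v : U | `|v - c| <= b].
Proof.
have [b0|b0] := ltP b 0.
  rewrite (_ : mkset _ = set0); first exact: compact0.
  by apply/seteqP; split => // v /= /le_lt_trans/(_ b0); rewrite normr_lt0.
have K : compact [set v : 'rV[R]_n | forall i, v ord0 i \in `[- b, b]].
  apply: (@rV_compact R n (fun=> `[- b, b]%classic)) => _.
  exact: segment_compact.
pose h (v : 'rV[R]_n) : U := v^T + c.
have ch : continuous h.
  have : is_Ck 0 h.
    apply: CkD; last exact: (Ck_cst 0 c).
    apply: Ck_mx => i j; rewrite (_ : (fun x => _) = fun x : 'rV[R]_n => x j i).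
      by move=> x; exact: coord_continuous.
    by apply/funext => x; rewrite mxE.
  by [].
rewrite (_ : mkset _ = image [set v : 'rV[R]_n | forall i, v ord0 i \in `[- b, b]] h).
  by apply: continuous_compact => //; exact: continuous_subspaceT.
apply/seteqP; split => [v /= vb|_ [v /= vb <-]].
  exists (v - c)^T => [i|]; last by rewrite /h trmxK subrK.
  rewrite mxE in_itv/= -ler_norml; exact: le_trans (entry_le_norm (v - c) i) _.
rewrite /h addrK; apply: normv_le => // i.
by rewrite mxE ler_norml; have := vb i; rewrite in_itv.
Qed.

Lemma cball_max (f : U -> R) c b : 0 <= b -> continuous f ->
  exists2 x, `|x - c| <= b & forall y, `|y - c| <= b -> f y <= f x.
Proof.
move=> b0 cf; have [||x] := compact_EVT_max _ (@compact_cball c b) (f := f).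
- by exists c => /=; rewrite subrr normr0.
- exact: continuous_subspaceT.
- rewrite inE /= => xb H; exists x => // y yb; apply: H; by rewrite inE.
Qed.

Lemma cball_bounded (f : U -> R) c b : continuous f ->
  exists2 M, 0 <= M & forall y, `|y - c| <= b -> `|f y| <= M.
Proof.
move=> cf; have [b0|b0] := ltP b 0.
  by exists 0 => // y /le_lt_trans/(_ b0); rewrite normr_lt0.
have [|x _ xmax] := @cball_max (fun y => `|f y|) c b b0.
  by move=> y; apply: (continuous_comp (cf y)); exact: norm_continuous.
by exists `|f x|.
Qed.

Definition lattice_periodic (T : Type) (f : U -> T) :=
  forall x (k : 'cV[int]_n), f (x + map_mx intr k) = f x.

Lemma unit_cell (x : U) : exists k : 'cV[int]_n, `|x + map_mx intr k| <= 1.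
Proof.
exists (\col_i (- Num.floor (x i 0))); apply: normv_le => // i.
rewrite !mxE intrN ger0_norm ?subr_ge0 ?floor_le_tmp//.
by rewrite lerBlDl; apply/ltW; rewrite -intrD1 floorD1_gt.
Qed.

Lemma periodic_max (f : U -> R) : continuous f -> lattice_periodic f ->
  exists c, forall x, f x <= f c.
Proof.
move=> cf pf; have [c _ H] := @cball_max f 0 1 ler01 cf.
exists c => x; have [k xk] := unit_cell x.
by rewrite -(pf x k); apply: H; rewrite subr0.
Qed.

Lemma periodic_bounded (f : U -> R) : continuous f -> lattice_periodic f ->
  exists2 M, 0 <= M & forall x, `|f x| <= M.
Proof.
move=> cf pf; have [||c H] := @periodic_max (fun y => `|f y|).
- by move=> y; apply: (continuous_comp (cf y)); exact: norm_continuous.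
- by move=> x k; rewrite pf.
- by exists `|f c|.
Qed.

Lemma periodic_D (V : normedModType R) (f : U -> V) v :
  lattice_periodic f -> lattice_periodic (fun x => 'D_v f x).
Proof.
move=> pf x k; apply: etrans (esym (D_shift f _ x v)) _; congr ('D_v _ x).
by apply/funext => y; rewrite pf.
Qed.

End Compactness.

(** * Primitives and Gronwall's inequality *)

Section OneVariable.
Context {R : realType}.

Lemma derive0_cst (f : R -> R) (a : R) : (forall t : R, a < t -> is_derive t 1 f 0) ->
  forall x y, a < x -> a < y -> f x = f y.
Proof.
move=> f0; suff H x y : a < x -> x <= y -> f x = f y.
  move=> x y ax ay; have [xy|/ltW yx] := leP x y; first exact: H.
  by apply/esym; exact: H.
move=> ax xy; have [||t _] := @MVT_segment _ f (fun=> 0) x y xy.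
- by move=> t; rewrite in_itv/= => /andP[xt _]; apply: f0; exact: lt_trans xt.
- apply: derivable_within_continuous => t; rewrite in_itv/= => /andP[xt _].
  by have [] := f0 t (lt_le_trans ax xt).
- by rewrite mul0r => /eqP; rewrite subr_eq0 => /eqP.
Qed.

Lemma primitive (g : R -> R) : continuous g ->
  exists2 G : R -> R, G 0 = 0 & forall t : R, is_derive t 1 G (g t).
Proof.
move=> cg.
pose F (a x : R) := (\int[@lebesgue_measure R]_(t in `[a, x]) (g t))%R.
have dF (a t : R) : a < t -> is_derive t 1 (F a) (g t).
  move=> at_; have tt : t < t + 1 by rewrite ltrDl.
  have ig : (@lebesgue_measure R).-integrable `[a, t + 1] (EFin \o g).
    apply: continuous_compact_integrable; first exact: segment_compact.
    exact: continuous_subspaceT.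
  have [d1 d2] := continuous_FTC1_closed tt ig at_ (cg t).
  apply: DeriveDef d1 _; exact: etrans (esym (derive1E _ _)) d2.
(* The integral is known to be differentiable only to the right of its base point. The base point
   [- |x| - 1] lies below both [x] and 0, and by [GE] any other such base point gives the same
   [G]. *)
pose G (x : R) := F (- `|x| - 1) x - F (- `|x| - 1) 0.
have GE (a x : R) : a < x -> a < 0 -> G x = F a x - F a 0.
  move=> ax a0; rewrite /G; set b := - `|x| - 1.
  have bx : b < x by rewrite /b; have := ler_norm (- x); rewrite normrN; lra.
  have b0 : b < 0 by rewrite /b; have := normr_ge0 x; lra.
  suff : F b x - F a x = F b 0 - F a 0 by lra.
  have D0 (t : R) : Num.max a b < t -> is_derive t 1 (fun x => F b x - F a x) 0.
    rewrite gt_max => /andP[at_ bt].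
    rewrite -(subrr (g t)); apply: is_deriveB; exact: dF.
  by apply: (derive0_cst D0); rewrite gt_max; apply/andP.
exists G; first by rewrite /G subrr.
move=> x; set a := - `|x| - 2.
have ax : a < x by rewrite /a; have := ler_norm (- x); rewrite normrN; lra.
have a0 : a < 0 by rewrite /a; have := normr_ge0 x; lra.
rewrite -(subr0 (g x)).
have dH : is_derive x 1 (fun y => F a y - F a 0) (g x - 0).
  by apply: is_deriveB; exact: dF.
apply: near_eq_is_derive dH.
near=> y; apply/esym; apply: GE => //; near: y; exact: lt_nbhsr.
Unshelve. all: by end_near. Qed.

(** The sum of squares [E] satisfies [E' <= K E] on the unit interval and starts at 0, so
    [E exp (- K t)], whose derivative is nonpositive there, is still nonpositive at time 1. *)
Lemma gronwall n (d d' : 'I_n -> R -> R) C :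
  (forall i (t : R), is_derive t 1 (d i) (d' i t)) -> (forall i, d i 0 = 0) ->
  (forall i (t : R), 0 <= t <= 1 -> `|d' i t| <= C * \sum_j `|d j t|) ->
  forall i, d i 1 = 0.
Proof.
move=> dd d0 dC.
have C' i (t : R) : 0 <= t <= 1 -> `|d' i t| <= `|C| * \sum_j `|d j t|.
  move=> t01; apply: le_trans (dC i t t01) _; apply: ler_wpM2r => //.
    by apply: sumr_ge0.
  exact: ler_norm.
pose E (t : R) := \sum_i d i t * d i t.
pose E' (t : R) := \sum_i (d i t * d' i t + d i t * d' i t).
have dE (t : R) : is_derive t 1 E (E' t).
  have -> : E = \sum_i (d i * d i) by apply/funext => s; rewrite /E fct_sumE.
  by apply: is_derive_sum => i; exact: is_deriveM.
(* Bound [2 |d i| |d j|] by [d i ^ 2 + d j ^ 2]; summed over all pairs this is [2 n E]. *)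
pose K := 2 * `|C| * n%:R.
have E'K (t : R) : 0 <= t <= 1 -> E' t <= K * E t.
  move=> t01; apply: (@le_trans _ _ (\sum_i \sum_j `|C| * (d i t ^+ 2 + d j t ^+ 2))).
    apply: ler_sum => i _; rewrite -mulr2n -mulr_sumr.
    apply: (le_trans (ler_norm _)); rewrite -mulr_natl !normrM.
    apply: (@le_trans _ _ (2 * (`|d i t| * (`|C| * \sum_j `|d j t|)))).
      rewrite ger0_norm ?ler0n//; apply: ler_wpM2l => //.
      apply: ler_wpM2l => //; exact: C'.
    rewrite (_ : 2 * _ = `|C| * \sum_j 2 * (`|d i t| * `|d j t|)); last first.
      by rewrite -!mulr_sumr; ring.
    apply: ler_wpM2l => //; apply: ler_sum => j _.
    rewrite -(real_normK (num_real (d i t))) -(real_normK (num_real (d j t))).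
    have := sqr_ge0 (`|d i t| - `|d j t|); lra.
  rewrite le_eqVlt; apply/orP; left; apply/eqP.
  have S i : \sum_j `|C| * (d i t ^+ 2 + d j t ^+ 2) =
      `|C| * (n%:R * (d i t * d i t) + E t).
    rewrite -mulr_sumr big_split/= sumr_const card_ord -[_ ^+ 2 *+ n]mulr_natl.
    by under [X in _ + X]eq_bigr do rewrite expr2; rewrite expr2.
  rewrite (eq_bigr _ (fun i _ => S i)) -mulr_sumr big_split/= -mulr_sumr.
  rewrite sumr_const card_ord -[E t *+ n]mulr_natl -/(E t) /K; ring.
pose G (t : R) := E t * expR (- K * t).
have dG (t : R) : is_derive t 1 G (E t * (- K * expR (- K * t)) + expR (- K * t) * E' t).
  apply: is_deriveM.
  have d1 : is_derive t 1 (fun t : R => - K * t) (- K).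
    by have := is_deriveZ (- K) (is_derive_id t (1:R)); rewrite /GRing.scale/= mulr1.
  have := @is_derive1_comp _ expR (fun t => - K * t) t _ _ (is_derive_expR (- K * t)) d1.
  by rewrite mulrC.
have [|t t01] := @MVT R G
    (fun t => E t * (- K * expR (- K * t)) + expR (- K * t) * E' t) 0 1 ltr01.
- apply: continuous_subspaceT => t.
  by apply/differentiable_continuous/derivable1_diffP; case: (dG t).
- have E0 : E 0 = 0 by rewrite /E big1// => i _; rewrite d0 mul0r.
  rewrite /G E0 mul0r subr0 subr0 mulr1 => GE.
  have : E 1 * expR (- K * 1) <= 0.
    rewrite GE (_ : _ + _ = (E' t - K * E t) * expR (- K * t)); last by ring.
    rewrite mulr_le0_ge0 ?expR_ge0// subr_le0; apply: E'K.
    by move: t01; rewrite in_itv/= => /andP[/ltW -> /ltW ->].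
  rewrite pmulr_lle0 ?expR_gt0// => E1 i; apply/eqP; rewrite -sqrf_eq0 expr2.
  have dd0 j : 0 <= d j 1 * d j 1 by rewrite -expr2 sqr_ge0.
  rewrite eq_le dd0 andbT; apply: le_trans E1; rewrite /E (bigD1 i)//= lerDl.
  by apply: sumr_ge0.
Qed.

End OneVariable.

Section Differentiability.
Context {R : realType}.

Lemma diff_of_bound_lin (U V : normedModType R) (f : U -> V) x (L : {linear U -> V}) :
  continuous L ->
  (forall e, 0 < e -> exists2 d, 0 < d &
    forall h, `|h| < d -> `|f (x + h) - f x - L h| <= e * `|h|) ->
  differentiable f x /\ forall v, 'D_v f x = L v.
Proof.
move=> cL H.
have E : f \o shift x = (cst (f x) + L) +o_ 0 id.
  apply/eqaddoP => e e0; have [d d0 Hd] := H e e0.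
  apply/nbhs_normP; exists d => // h; rewrite /= sub0r normrN => /Hd.
  by rewrite !fctE/= (addrC h x) opprD addrA.
have dE := diff_unique cL E.
have df : differentiable f x by apply/diff_locallyP; split; rewrite dE.
by split => // v; rewrite deriveE// dE.
Qed.

Lemma diff_of_bound n m (f : 'cV[R]_n -> 'cV[R]_m) x (A : 'M[R]_(m, n)) :
  (forall e, 0 < e -> exists2 d, 0 < d &
    forall h, `|h| < d -> `|f (x + h) - f x - A *m h| <= e * `|h|) ->
  differentiable f x /\ forall v, 'D_v f x = A *m v.
Proof.
apply: (@diff_of_bound_lin 'cV[R]_n 'cV[R]_m f x (mulmx A)).
by apply: smooth_continuous; exact: (smooth_mulmx A smooth_id).
Qed.

Lemma diff_of_bound1 n (f : 'cV[R]_n -> R) x (a : 'rV[R]_n) :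
  (forall e, 0 < e -> exists2 d, 0 < d &
    forall h, `|h| < d -> `|f (x + h) - f x - (a *m h) 0 0| <= e * `|h|) ->
  differentiable f x /\ forall v, 'D_v f x = (a *m v) 0 0.
Proof.
move=> H; pose F y : 'cV[R]_1 := \col_(_ < 1) f y.
have [|dF DF] := @diff_of_bound n 1 F x a.
  move=> e e0; have [d d0 Hd] := H e e0; exists d => // h /Hd He.
  apply: normv_le => [|i]; first by rewrite mulr_ge0// ltW.
  by rewrite (ord1 i) !mxE; move: He; rewrite !mxE.
have fE : f = fun y => F y 0 0 by apply/funext => y; rewrite mxE.
rewrite fE; split; first exact: diff_entry.
by move=> v; rewrite -(D_entry v 0 0 dF) DF.
Qed.

End Differentiability.

(** * Primitives along horizontal lines of the plane *)

Section PlanarPrimitive.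
Context {R : realType}.
Notation P := 'cV[R]_2.

Definition pt (s t : R) : P := \col_i (if i == 0 then s else t).
Definition dx : P := delta_mx 0 0.
Definition dy : P := delta_mx 1 0.

Lemma pt0 s t : pt s t 0 0 = s. Proof. by rewrite mxE. Qed.
Lemma pt1 s t : pt s t 1 0 = t. Proof. by rewrite mxE. Qed.

Lemma lift01 : lift ord0 ord0 = 1 :> 'I_2.
Proof. exact: val_inj. Qed.

Lemma ord2P (Q : 'I_2 -> Prop) : Q 0 -> Q 1 -> forall i, Q i.
Proof.
move=> Q0 Q1 [[|[|//]] i2].
- by rewrite (_ : Ordinal _ = 0)//; exact: val_inj.
- by rewrite (_ : Ordinal _ = 1)//; exact: val_inj.
Qed.

Lemma colP2 (u v : P) : u 0 0 = v 0 0 -> u 1 0 = v 1 0 -> u = v.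
Proof. by move=> u0 u1; apply/colP; exact: ord2P. Qed.

Lemma ptE (z : P) : z = pt (z 0 0) (z 1 0).
Proof. by apply: colP2; rewrite mxE. Qed.

Lemma pt_line c s t : pt c t + s *: dx = pt (c + s) t.
Proof. by apply: colP2; rewrite !mxE /= ?mulr1 ?mulr0 ?addr0. Qed.

Lemma pt_liney c s t : pt c t + s *: dy = pt c (t + s).
Proof. by apply: colP2; rewrite !mxE /= ?mulr1 ?mulr0 ?addr0. Qed.

Lemma D_plane (V : normedModType R) (f : P -> V) x v : differentiable f x ->
  'D_v f x = v 0 0 *: 'D_dx f x + v 1 0 *: 'D_dy f x.
Proof. by move=> df; rewrite D_basis// big_ord_recl big_ord1 lift01. Qed.

Lemma continuous_x (g : P -> R) t : continuous g -> continuous (fun s => g (pt s t)).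
Proof.
move=> cg s; apply: (@continuous_comp _ _ _ (fun s => pt s t) g); last exact: cg.
suff : is_Ck 0 (fun s => pt s t) by apply.
have -> : (fun s => pt s t) = fun s => s *: dx + pt 0 t.
  by apply/funext => r; rewrite addrC pt_line add0r.
apply: CkD; last exact: (Ck_cst 0 (pt 0 t)).
move=> r; apply: continuousZ; last exact: cst_continuous.
exact: cvg_id.
Qed.

(** Made total, with a default value for discontinuous [h], so that [prim] makes sense for every
    [g]. *)
Definition antiderivative (h : R -> R) : R -> R :=
  if pselect (continuous h) is left c then sval (cid2 (primitive c)) else fun=> 0.

Lemma antiderivativeP (h : R -> R) : continuous h ->
  antiderivative h 0 = 0 /\ forall t : R, is_derive t 1 (antiderivative h) (h t).
Proof.
by move=> ch; rewrite /antiderivative; case: pselect => // c; case: cid2.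
Qed.

(** For continuous [g], the integral of [g] along the horizontal segment from the axis [x = 0] to
    [z]. *)
Definition prim (g : P -> R) (z : P) : R :=
  antiderivative (fun s => g (pt s (z 1 0))) (z 0 0).

Lemma prim_pt (g : P -> R) s t : prim g (pt s t) = antiderivative (fun s => g (pt s t)) s.
Proof. by rewrite /prim pt0 pt1. Qed.

Lemma prim0 (g : P -> R) (t : R) : continuous g -> prim g (pt 0 t) = 0.
Proof.
by move=> cg; have [A0 _] := antiderivativeP (continuous_x (t := t) cg); rewrite prim_pt.
Qed.

Lemma prim_is_derive (g : P -> R) (s t : R) : continuous g ->
  is_derive s 1 (fun s => prim g (pt s t)) (g (pt s t)).
Proof.
move=> cg; have [_ D] := antiderivativeP (continuous_x (t := t) cg).
have -> : (fun s => prim g (pt s t)) = antiderivative (fun s => g (pt s t)).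
  by apply/funext => r; rewrite prim_pt.
exact: D.
Qed.

Lemma mvt01 (f f' : R -> R) : (forall t : R, is_derive t 1 f (f' t)) ->
  forall x h, exists2 t, 0 <= t <= 1 & f (x + h) - f x = h * f' (x + t * h).
Proof.
move=> df x h; have dff t : differentiable f t.
  by apply/derivable1_diffP; case: (df t).
have [t t01 E] := line_mvt x h dff; exists t => //; rewrite E.
have -> : 'D_h f (x + t *: h) = 'D_(h *: 1) f (x + t *: h).
  by congr ('D_ _ _ _); rewrite /GRing.scale/= mulr1.
by rewrite (D_dirZ _ _ (dff _)); case: (df (x + t *: h)) => _ ->.
Qed.

Lemma plane_mvt_y (g : P -> R) s t h : smooth g ->
  exists2 r, 0 <= r <= 1 & g (pt s (t + h)) - g (pt s t) = h * 'D_dy g (pt s (t + r * h)).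
Proof.
move=> sg; have [|r r01 E] := @line_mvt _ _ g (pt s t) (h *: dy).
  by move=> z; exact: smooth_diff.
exists r => //; move: E; rewrite (D_dirZ _ _ (smooth_diff _ sg)) scalerA !pt_liney.
by [].
Qed.

(** Differentiation under the integral sign. What has to be bounded is the first-order remainder in
    [y], uniformly along the segment of integration. *)
Lemma prim_D (g : P -> R) (z : P) : smooth g -> differentiable (prim g) z /\
  forall v, 'D_v (prim g) z = v 0 0 * g z + v 1 0 * prim (fun y => 'D_dy g y) z.
Proof.
move=> sg; have cg := smooth_continuous sg; have sg1 := smooth_D dy sg.
have cg1 := smooth_continuous sg1; have sg2 := smooth_D dy sg1.
set g1 := (fun y => 'D_dy g y) in sg1 cg1 sg2 *.
pose a : 'rV[R]_2 := \row_i (if i == 0 then g z else prim g1 z).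
have aE h : (a *m h) 0 0 = h 0 0 * g z + h 1 0 * prim g1 z.
  by rewrite mxE big_ord_recl big_ord1 lift01 !mxE/= mulrC [X in _ + X]mulrC.
suff [d1 d2] : differentiable (prim g) z /\ forall v, 'D_v (prim g) z = (a *m v) 0 0.
  by split => // v; rewrite d2 aE.
apply: diff_of_bound1 => e e0.
set x := z 0 0; set y := z 1 0.
have e20 : 0 < e / 2 by rewrite divr_gt0.
have /cvgrPdist_lt/(_ _ e20)/nbhs_normP [d1 /= d10 Hd1] := cg z.
(* The ball is large enough for the points [(s x, y + r h 1 0)] with [s], [r] between 0 and 1 and
   [|h| < 1], where the second [y]-derivative will be evaluated. *)
have [M M0 HM] := cball_bounded z (`|x| + 1) (smooth_continuous sg2).
set c := `|x| * M + 1; have c0 : 0 < c by rewrite /c ltr_wpDl// mulr_ge0.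
exists (Num.min (Num.min d1 1) (e / 2 / c)).
  by rewrite !lt_min d10 ltr01 divr_gt0.
move=> h; rewrite !lt_min => /andP[/andP[hd1 h1] hc].
have h0le : `|h 0 0| <= `|h| by exact: entry_le_norm.
have h1le : `|h 1 0| <= `|h| by exact: entry_le_norm.
have zE : z = pt x y by exact: ptE.
have zhE : z + h = pt (x + h 0 0) (y + h 1 0) by apply: colP2; rewrite !mxE.
have [t t01 E1] := mvt01 (fun s => prim_is_derive s (y + h 1 0) cg) x (h 0 0).
(* [k] is the remainder of the integral up to [s]; its derivative in [s] is the remainder of [g],
   which two mean value steps bound by [M |h| ^ 2]. *)
pose k (s : R) := prim g (pt s (y + h 1 0)) - prim g (pt s y) - h 1 0 * prim g1 (pt s y).
have dk (s : R) : is_derive s 1 k (g (pt s (y + h 1 0)) - g (pt s y) - h 1 0 * g1 (pt s y)).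
  apply: is_deriveB; first by apply: is_deriveB; exact: prim_is_derive.
  exact: (is_deriveZ (h 1 0) (prim_is_derive s y cg1)).
have k0 : k 0 = 0 by rewrite /k !prim0// mulr0 !subr0.
have [s s01 E2] := mvt01 dk 0 x.
have kx : `|k x| <= `|x| * (M * (`|h| * `|h|)).
  move: E2; rewrite k0 subr0 !add0r => ->; rewrite normrM ler_wpM2l//.
  have [r r01 ->] := plane_mvt_y (s * x) y (h 1 0) sg.
  rewrite -mulrBr.
  have [r' r01' ->] := plane_mvt_y (s * x) y (r * h 1 0) sg1.
  rewrite !normrM mulrA mulrC ler_pM// ?mulr_ge0//.
    apply: HM; rewrite zE; apply: normv_le => [|i]; first by rewrite addr_ge0.
    have B (u w v : R) : 0 <= u <= 1 -> 0 <= w <= 1 -> `|u * (w * v)| <= `|v|.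
      move=> /andP[u0 u1] /andP[w0 w1]; rewrite !normrM (ger0_norm u0) (ger0_norm w0) mulrA.
      by rewrite ler_piMl// mulr_ile1.
    move: i; apply: ord2P; rewrite !mxE /=.
      have := s01 => /andP[s0 s1].
      rewrite -{2}(mul1r x) -mulrBl normrM (le_trans _ (_ : `|x| <= _))// ?lerDl//.
      by rewrite ler_piMl// ler_norml; apply/andP; split; lra.
    rewrite addrC addKr (le_trans (B _ _ _ r01' r01))// (le_trans h1le)//.
    by rewrite (le_trans (ltW h1))// lerDr.
  rewrite ler_pM//; have /andP[r0 r1] := r01.
  by rewrite ger0_norm// (le_trans _ h1le)// ler_piMl.
have -> : prim g (z + h) - prim g z - (a *m h) 0 0 =
   h 0 0 * (g (pt (x + t * h 0 0) (y + h 1 0)) - g z) + k x.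
  rewrite aE zhE mulrBr -E1 /k [in prim g z]zE [in prim g1 z]zE; ring.
apply: le_trans (ler_normD _ _) _; rewrite normrM.
have T1 : `|h 0 0| * `|g (pt (x + t * h 0 0) (y + h 1 0)) - g z| <= `|h| * (e / 2).
  apply: ler_pM => //; rewrite distrC; apply/ltW/Hd1 => /=.
  apply: le_lt_trans hd1; rewrite zE; apply: normv_le => // i; move: i.
  apply: ord2P; rewrite !mxE/= opprD addrA subrr sub0r normrN //.
  have /andP[t0 t1] := t01.
  by rewrite normrM ger0_norm// (le_trans _ h0le)// ler_piMl.
have T2 : `|x| * (M * (`|h| * `|h|)) <= `|h| * (e / 2).
  rewrite (_ : _ * _ = `|h| * (`|h| * (`|x| * M))); last by ring.
  rewrite ler_wpM2l// (@le_trans _ _ (`|h| * c))//.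
    by rewrite ler_wpM2l// /c lerDl.
  by rewrite -ler_pdivlMr// ltW.
apply: le_trans (lerD T1 (le_trans kx T2)) _.
rewrite -mulrDr mulrC; apply: ler_wpM2r => //; lra.
Qed.

(** The gradient of [prim g] consists of [g] and of the primitive of another smooth function, so the
    induction runs over all [g] at once. *)
Lemma smooth_prim (g : P -> R) : smooth g -> smooth (prim g).
Proof.
suff H k g' : smooth g' -> is_Ck k (prim g') by move=> sg k; exact: H.
elim: k g' => [|k IH] g' sg.
  by move=> z; apply: differentiable_continuous; exact: (prim_D z sg).1.
split => [z|v]; first exact: (prim_D z sg).1.
rewrite (_ : (fun x => _) = fun x => v 0 0 * g' x + v 1 0 * prim (fun y => 'D_dy g' y) x).
  apply: CkD; apply: CkM; [exact: Ck_cst|exact: sg|exact: Ck_cst|].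
  by apply: IH; exact: smooth_D.
by apply/funext => z; exact: (prim_D z sg).2.
Qed.

Lemma prim_dx (g : P -> R) (z : P) : smooth g -> 'D_dx (prim g) z = g z.
Proof. by move=> sg; rewrite (prim_D z sg).2 !mxE/= mul1r mul0r addr0. Qed.

End PlanarPrimitive.

Section Critical.
Context {R : realType} {n : nat}.
Notation U := 'cV[R]_n.

Lemma local_min_D (f : U -> R) y b v : (forall x, differentiable f x) -> 0 < b ->
  (forall w, `|w - y| <= b -> f y <= f w) -> 'D_v f y = 0.
Proof.
move=> df b0 H; pose h t := f (y + t *: v).
have dh (t : R) : is_derive t 1 h ('D_v f (y + t *: v)) by exact: line_is_derive.
set e := b / (`|v| + 1).
have v1 : 0 < `|v| + 1 by rewrite ltr_wpDl.
have e0 : 0 < e by rewrite divr_gt0.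
have e00 : (0 : R) \in `]- e, e[%R by rewrite in_itv/= oppr_lt0 e0.
have D0 := dh 0; rewrite scale0r addr0 in D0.
have ee : - e <= e by rewrite ge0_cp// ltW.
have dh1 (t : R) : t \in `]- e, e[%R -> derivable h t 1 by move=> _; case: (dh t).
suff hmin (t : R) : t \in `]- e, e[%R -> h 0 <= h t.
  by have [_ <-] := derive1_at_min ee dh1 e00 hmin; case: D0 => _ ->.
rewrite in_itv/= => te; rewrite /h scale0r addr0; apply: H.
rewrite addrC addKr normrZ; apply: (@le_trans _ _ (e * (`|v| + 1))).
  apply: ler_pM => //; last by rewrite lerDl.
  by rewrite ler_norml; case/andP: te => /ltW -> /ltW ->.
by rewrite /e divfK// gt_eqF.
Qed.

Lemma global_max_D (f : U -> R) y v : smooth f -> (forall w, f w <= f y) ->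
  'D_v f y = 0.
Proof.
move=> sf H; apply: oppr_inj; rewrite oppr0 -(D_N _ _ sf).
apply: (local_min_D v (b := 1)) => // [x|w _]; last by rewrite lerN2.
by apply: smooth_diff; exact: smoothN.
Qed.

End Critical.

(** * Periodic coframes of the plane *)

Section GlobalDiffeo.
Context {R : realType}.
Notation P := 'cV[R]_2.

Lemma periodic_lipschitz (h : P -> R) : smooth h ->
  (forall v, lattice_periodic (fun x => 'D_v h x)) ->
  exists2 L, 0 <= L & forall x y, `|h x - h y| <= L * `|x - y|.
Proof.
move=> sh ph.
have [A A0 HA] := periodic_bounded (smooth_continuous (smooth_D dx sh)) (ph dx).
have [B B0 HB] := periodic_bounded (smooth_continuous (smooth_D dy sh)) (ph dy).
exists (A + B); first exact: addr_ge0.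
move=> x y; have [|t t01 E] := @line_mvt _ _ h y (x - y).
  by move=> z; exact: smooth_diff.
move: E; rewrite (addrC y) subrK => ->.
rewrite (D_plane _ (smooth_diff _ sh)) (le_trans (ler_normD _ _))//.
by rewrite mulrDl lerD// normrM mulrC ler_pM ?entry_le_norm.
Qed.

Variables (Phi X0 X1 : P -> P).
Hypotheses (sPhi : smooth Phi) (sX0 : smooth X0) (sX1 : smooth X1).
Hypotheses (pX0 : lattice_periodic X0) (pX1 : lattice_periodic X1).
Hypothesis pPhi : forall v, lattice_periodic (fun x => 'D_v Phi x).
Hypothesis PhiX : forall x v,
  v = ('D_v Phi x) 0 0 *: X0 x + ('D_v Phi x) 1 0 *: X1 x.
Hypotheses (PhiX0 : forall x, 'D_(X0 x) Phi x = dx)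
           (PhiX1 : forall x, 'D_(X1 x) Phi x = dy).

Let sPhii i : smooth (fun x => Phi x i 0). Proof. exact: smooth_entry. Qed.

Let DPhii i v x : 'D_v (fun x => Phi x i 0) x = ('D_v Phi x) i 0.
Proof. exact: esym (D_mxE _ _ _ _ sPhi). Qed.

Lemma frame_bound : exists2 K, 1 <= K &
  forall x (a : P), `|a 0 0 *: X0 x + a 1 0 *: X1 x| <= K * `|a|.
Proof.
have nb (X : P -> P) : smooth X -> lattice_periodic X -> exists2 M, 0 <= M & forall x, `|X x| <= M.
  move=> sX pX; have [||M M0 HM] := @periodic_bounded _ _ (fun x => `|X x|).
  - move=> x; apply: (@continuous_comp _ _ _ X (fun v => `|v|)).
      exact: smooth_continuous.
    exact: norm_continuous.
  - by move=> x k; rewrite pX.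
  - by exists M => // x; have := HM x; rewrite normr_id.
have [A A0 HA] := nb _ sX0 pX0; have [B B0 HB] := nb _ sX1 pX1.
exists (1 + A + B); first by rewrite -addrA lerDl addr_ge0.
move=> x a; rewrite (le_trans (ler_normD _ _))// !normrZ.
have a0 := entry_le_norm a 0; have a1 := entry_le_norm a 1.
rewrite -addrA mulrDl mulrDl -[leLHS]add0r lerD ?mulr_ge0//.
by rewrite [A * _]mulrC [B * _]mulrC lerD// ler_pM.
Qed.

Lemma D_lipschitz : exists2 L, 1 <= L &
  forall x y w, `|'D_w Phi x - 'D_w Phi y| <= L * `|x - y| * `|w|.
Proof.
have H i v : exists2 L, 0 <= L & forall x y,
    `|'D_v (fun x => Phi x i 0) x - 'D_v (fun x => Phi x i 0) y| <= L * `|x - y|.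
  apply: periodic_lipschitz; first exact: smooth_D.
  move=> u x k.
  have -> : (fun x => 'D_v (fun x => Phi x i 0) x) = (fun x => ('D_v Phi x) i 0).
    by apply/funext => z; rewrite DPhii.
  have sD : smooth (fun x => 'D_v Phi x) by exact: smooth_D.
  have E z := D_mxE z u i 0 sD.
  apply: etrans (esym (E _)) _; apply: etrans _ (E _).
  have F := periodic_D u (pPhi v) x k.
  exact: (congr1 (fun M : P => M i 0) F).
have [A A0 HA] := H 0 dx; have [B B0 HB] := H 0 dy.
have [C C0 HC] := H 1 dx; have [D D0 HD] := H 1 dy.
set L := 1 + A + B + C + D.
exists L; first by rewrite /L; lra.
have key i a b : 0 <= a -> 0 <= b -> a + b <= L ->
  (forall x y, `|'D_dx (fun x => Phi x i 0) x - 'D_dx (fun x => Phi x i 0) y| <= a * `|x - y|) ->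
  (forall x y, `|'D_dy (fun x => Phi x i 0) x - 'D_dy (fun x => Phi x i 0) y| <= b * `|x - y|) ->
  forall x y w, `|('D_w Phi x) i 0 - ('D_w Phi y) i 0| <= L * `|x - y| * `|w|.
  move=> a0 b0 abL Ha Hb x y w.
  have G z : ('D_w Phi z) i 0 = w 0 0 * 'D_dx (fun x => Phi x i 0) z +
      w 1 0 * 'D_dy (fun x => Phi x i 0) z.
    exact: etrans (esym (DPhii i w z)) (D_plane w (smooth_diff z (sPhii i))).
  have Ga := Ha x y; have Gb := Hb x y.
  have Gx := G x; have Gy := G y; move: Ga Gb Gx Gy.
  set p := 'D_dx _ x; set q := 'D_dx _ y; set p' := 'D_dy _ x; set q' := 'D_dy _ y.
  move=> Ga Gb -> ->.
  have -> : w 0 0 * p + w 1 0 * p' - (w 0 0 * q + w 1 0 * q') =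
      w 0 0 * (p - q) + w 1 0 * (p' - q') by ring.
  rewrite (le_trans (ler_normD _ _))// !normrM.
  apply: (@le_trans _ _ (`|w| * (a * `|x - y|) + `|w| * (b * `|x - y|))).
    by apply: lerD; apply: ler_pM => //; exact: entry_le_norm.
  rewrite -mulrDr -mulrDl mulrC ler_wpM2r//; exact: ler_wpM2r.
move=> x y w; apply: normv_le => [|i].
  by rewrite !mulr_ge0// /L; lra.
rewrite !mxE; move: i; apply: ord2P.
- by apply: (key 0 A B) => //; rewrite /L; lra.
- by apply: (key 1 C D) => //; rewrite /L; lra.
Qed.

Lemma Phi_taylor L : 0 <= L ->
  (forall x y w, `|'D_w Phi x - 'D_w Phi y| <= L * `|x - y| * `|w|) ->
  forall x k, `|Phi (x + k) - Phi x - 'D_k Phi x| <= L * `|k| * `|k|.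
Proof.
move=> L0 HL x k; apply: normv_le => [|i]; first by rewrite !mulr_ge0.
have [|t /andP[t0 t1] E] := @line_mvt _ _ (fun x => Phi x i 0) x k.
  by move=> z; exact: smooth_diff.
rewrite !mxE E DPhii.
have -> : ('D_k Phi (x + t *: k)) i 0 - ('D_k Phi x) i 0 =
  ('D_k Phi (x + t *: k) - 'D_k Phi x) i 0 by rewrite !mxE.
rewrite (le_trans (entry_le_norm _ _))// (le_trans (HL _ _ _))//.
rewrite addrC addKr normrZ ger0_norm// ler_wpM2r// ler_wpM2l//.
exact: ler_piMl.
Qed.

(** [X0] and [X1] invert d[Phi] with a bound [K], and the Taylor remainder is at most [L |w| ^ 2],
    so [|w| <= K |Phi x - Phi y| + K L |w| ^ 2]. For [|w| <= 1 / (2 K L)] the last term is at most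
    [|w| / 2] and is absorbed. Both constants are independent of the point. *)
Lemma local_expansion : exists c r, [/\ 0 < c, 0 < r &
  forall x y, `|x - y| <= r -> c * `|x - y| <= `|Phi x - Phi y|].
Proof.
have [K K1 HK] := frame_bound; have [L L1 HL] := D_lipschitz.
have K0 : 0 < K by lra. have L0 : 0 < L by lra.
exists (2 * K)^-1, (2 * K * L)^-1.
split; [by rewrite invr_gt0 mulr_gt0|by rewrite invr_gt0 !mulr_gt0|].
move=> x y xy; set w := x - y in xy *.
have := Phi_taylor (ltW L0) HL y w; rewrite /w (addrC y) subrK -/w => T.
have wK : `|w| <= K * `|'D_w Phi y| by rewrite {1}(PhiX y w); exact: HK.
have Dw : `|'D_w Phi y| <= `|Phi x - Phi y| + L * `|w| * `|w|.
  have -> : 'D_w Phi y = (Phi x - Phi y) - (Phi x - Phi y - 'D_w Phi y).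
    by rewrite opprB addrC subrK.
  by apply: le_trans (ler_normB _ _) _; rewrite lerD2l.
rewrite mulrC ler_pdivrMr ?mulr_gt0//.
have KLw : K * (L * `|w|) <= 2^-1.
  rewrite mulrA; apply: (@le_trans _ _ (K * L * (2 * K * L)^-1)).
    by rewrite ler_wpM2l// mulr_ge0// ltW.
  have KL0 : K * L != 0 by rewrite mulf_neq0// gt_eqF.
  rewrite le_eqVlt; apply/orP; left; apply/eqP; field.
  by rewrite !gt_eqF.
have : `|w| <= K * `|Phi x - Phi y| + 2^-1 * `|w|.
  apply: (le_trans wK); apply: le_trans (ler_wpM2l (ltW K0) Dw) _.
  by rewrite mulrDr lerD2l !mulrA ler_wpM2r// -mulrA.
set W := `|w|; set D := `|_ - _|; lra.
Qed.

(** The distance to [z] attains a minimum over the ball of radius [r]; expansion keeps the minimizer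
    off the boundary, and at an interior critical point the surjectivity of d[Phi] forces
    [Phi y = z]. *)
Lemma local_surjection c r : 0 < c -> 0 < r ->
  (forall x y, `|x - y| <= r -> c * `|x - y| <= `|Phi x - Phi y|) ->
  forall x z, `|z - Phi x| <= c * r / 4 -> exists2 y, `|y - x| <= r & Phi y = z.
Proof.
move=> c0 r0 Hc x z zx; set d := c * r / 4 in zx.
have d0 : 0 < d by rewrite /d !mulr_gt0.
(* The Euclidean square of the distance, since the sup norm is not differentiable. *)
pose f y := (Phi y 0 0 - z 0 0) * (Phi y 0 0 - z 0 0) +
            (Phi y 1 0 - z 1 0) * (Phi y 1 0 - z 1 0).
have s0 i : smooth (fun y => Phi y i 0 - z i 0).
  by apply: smoothB => //; exact: (smooth_cst (z i 0)).
have sf : smooth f by apply: smoothD; apply: smoothM; exact: s0.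
have [|y yr ymin] := @cball_max _ _ (fun y => - f y) x r (ltW r0).
  by apply: smooth_continuous; exact: smoothN.
have sq (a b : R) : 0 <= b -> `|a| <= b -> a * a <= b * b.
  move=> b0 ab; rewrite -expr2 -(real_normK (num_real a)) expr2.
  exact: ler_pM.
have fy : f y <= 2 * (d * d).
  have := ymin x; rewrite subrr normr0 lerN2 => /(_ (ltW r0)) /le_trans; apply.
  have zi i : (Phi x i 0 - z i 0) * (Phi x i 0 - z i 0) <= d * d.
    apply: sq; first exact: ltW.
    have := entry_le_norm (z - Phi x) i; rewrite !mxE distrC => /le_trans; exact.
  by have := lerD (zi 0) (zi 1); rewrite /f; lra.
(* On the boundary [|Phi y - Phi x| >= c r = 4 d], whereas [f y <= 2 d ^ 2] gives
   [|Phi y - z| <= 2 d] and hence [|Phi y - Phi x| <= 3 d]. *)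
have yr' : `|y - x| < r.
  rewrite lt_neqAle yr andbT; apply/negP => /eqP yE.
  have H1 := Hc y x yr; rewrite yE in H1.
  have H2 : `|Phi y - z| <= 2 * d.
    apply: normv_le => [|i]; first by rewrite mulr_ge0// ltW.
    rewrite !mxE leNgt; apply/negP => dlt.
    have : (2 * d) * (2 * d) < f y.
      apply: (@lt_le_trans _ _ ((Phi y i 0 - z i 0) * (Phi y i 0 - z i 0))).
        rewrite -[ltRHS]expr2 -(real_normK (num_real (_ - _))) expr2.
        by apply: ltr_pM => //; rewrite mulr_ge0// ltW.
      move: (i); apply: ord2P; rewrite /f ?lerDl ?lerDr -expr2; exact: sqr_ge0.
    have dd : 0 < d * d by rewrite mulr_gt0.
    by move: fy dd; set F := f y; lra.
  have H3 : `|Phi y - Phi x| <= 2 * d + d.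
    have -> : Phi y - Phi x = (Phi y - z) + (z - Phi x) by rewrite addrA subrK.
    by rewrite (le_trans (ler_normD _ _))// lerD.
  have : 4 * d <= 3 * d.
    by apply: (@le_trans _ _ (c * r)); [rewrite /d; lra|apply: (le_trans H1); lra].
  by move: d0; lra.
exists y => //.
have cr v : 'D_v f y = 0.
  have b0 : 0 < r - `|y - x| by rewrite subr_gt0.
  apply: local_min_D b0 _ => [u|w wy]; first exact: smooth_diff.
  rewrite -lerN2; apply: ymin.
  have -> : w - x = (w - y) + (y - x) by rewrite addrA subrK.
  by rewrite (le_trans (ler_normD _ _))//; move: wy; lra.
have Df v : 'D_v f y = 2 * (('D_v Phi y) 0 0 * (Phi y 0 0 - z 0 0) +
                            ('D_v Phi y) 1 0 * (Phi y 1 0 - z 1 0)).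
  have Di i : 'D_v (fun y => Phi y i 0 - z i 0) y = ('D_v Phi y) i 0.
    rewrite (D_B _ _ (sPhii i) (smooth_cst (z i 0))) D_cst subr0; exact: DPhii.
  rewrite (D_D _ _ (smoothM (s0 0) (s0 0)) (smoothM (s0 1) (s0 1))).
  rewrite (D_M _ _ (s0 0) (s0 0)) (D_M _ _ (s0 1) (s0 1)) (Di 0) (Di 1).
  ring.
have := cr (X0 y); rewrite Df PhiX0 !mxE/= => C0.
have := cr (X1 y); rewrite Df PhiX1 !mxE/= => C1.
by apply: colP2; lra.
Qed.

(** The radius [d] of [local_surjection] is uniform, so finitely many steps of length at most [d]
    lead from [Phi 0] to [z] along a segment. *)
Lemma Phi_surj z : exists x, Phi x = z.
Proof.
have [c [r [c0 r0 Hc]]] := local_expansion.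
have ls := local_surjection c0 r0 Hc; set d := c * r / 4 in ls.
have d0 : 0 < d by rewrite /d !mulr_gt0.
set w := z - Phi 0.
pose n := (Num.truncn (`|w| / d)).+1.
have nd : `|w| / n%:R <= d.
  rewrite ler_pdivrMr ?ltr0n// mulrC -ler_pdivrMr// ltW//.
  exact: truncnS_gt.
have n0 : n%:R != 0 :> R by rewrite pnatr_eq0.
have step k : exists x, Phi x = Phi 0 + (k%:R / n%:R) *: w.
  elim: k => [|k [x xE]]; first by exists 0; rewrite mul0r scale0r addr0.
  have [|y _ yE] := ls x (Phi 0 + (k.+1%:R / n%:R) *: w); last by exists y.
  rewrite xE opprD addrACA subrr add0r -scalerBl -mulrBl.
  rewrite -natr1 addrAC subrr add0r normrZ mul1r ger0_norm ?invr_ge0//.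
  by rewrite mulrC.
by have [x xE] := step n; exists x; rewrite xE divff// scale1r addrC subrK.
Qed.

(** Turns a path on the unit interval into a continuous path on the whole line, constant outside, so
    that continuity need not be relativised. *)
Definition clamp (s : R) : R := Num.max 0 (Num.min 1 s).

Lemma clamp_continuous : continuous clamp.
Proof.
move=> s; rewrite /clamp.
apply: continuous_max; first exact: cst_continuous.
by apply: continuous_min; [exact: cst_continuous|exact: cvg_id].
Qed.

Lemma clamp01 s : 0 <= clamp s <= 1.
Proof. by rewrite /clamp le_max lexx ge_max ler01 ge_min lexx. Qed.
Lemma clamp0 : clamp 0 = 0.
Proof. by rewrite /clamp min_r ?ler01// maxxx. Qed.
Lemma clamp1 : clamp 1 = 1.
Proof. by rewrite /clamp minxx max_r. Qed.

Lemma continuous_dist (T : topologicalType) (V : normedModType R) (f : T -> V) a :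
  continuous f -> continuous (fun u => `|f u - a|).
Proof.
by move=> cf s; apply: cvg_norm; apply: cvgB; [exact: cf|exact: cvg_cst].
Qed.

Lemma continuous_epsP (V W : normedModType R) (f : V -> W) :
  continuous f <-> forall s e, 0 < e -> exists2 d, 0 < d &
    forall s', `|s - s'| < d -> `|f s - f s'| < e.
Proof.
split=> [cf s e e0|H s].
  have /cvgrPdist_lt/(_ _ e0)/nbhs_normP [d /= d0 Hd] := cf s.
  by exists d.
apply/cvgrPdist_lt => e e0; have [d d0 Hd] := H s e e0.
by apply/nbhs_normP; exists d.
Qed.

(* The loop [s |-> Phi (x + s (y - x))] contracts linearly to a point; lifting
   the contraction in steps of size [1 / n] by the local inverses of [Phi]
   keeps the end points [x] and [y] of the lifted paths fixed. *)
Lemma Phi_inj x y : Phi x = Phi y -> x = y.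
Proof.
move=> xy.
have [c [r [c0 r0 Hc]]] := local_expansion.
have r30 : 0 < r / 3 by rewrite divr_gt0.
(* A third of [r]: lifting one step moves [g s] and [g s'] by at most [r / 3] each, so the lifts
   stay within [r] of each other when [g s] and [g s'] are within [r / 3]. Expansion at that scale
   makes the new lift continuous. *)
have Hc3 u v : `|u - v| <= r / 3 -> c * `|u - v| <= `|Phi u - Phi v|.
  by move=> uv; apply: Hc; apply: le_trans uv _; lra.
have ls := local_surjection c0 r30 Hc3; set d := c * (r / 3) / 4 in ls.
have d0 : 0 < d by rewrite /d !mulr_gt0.
pose sg s := x + clamp s *: (y - x).
have csg : continuous sg.
  move=> s; apply: (@cvgD _ _ _ _ _ (fun=> x) (fun s => clamp s *: (y - x))).
    exact: cvg_cst.
  by apply: cvgZ; [exact: clamp_continuous|exact: cvg_cst].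
have cPsg : continuous (fun s => Phi (sg s)).
  move=> s; apply: (@continuous_comp _ _ _ sg Phi); first exact: csg.
  exact: smooth_continuous.
have sg0 : sg 0 = x by rewrite /sg clamp0 scale0r addr0.
have sg1 : sg 1 = y by rewrite /sg clamp1 scale1r addrC subrK.
have cdist := continuous_dist (a := Phi x) (smooth_continuous sPhi).
have [B B0 HB] := cball_bounded x `|y - x| cdist.
have {}HB s : `|Phi (sg s) - Phi x| <= B.
  have := HB (sg s); rewrite normr_id; apply.
  rewrite /sg addrC addKr normrZ; have /andP[s0 s1] := clamp01 s.
  by rewrite ger0_norm// ler_piMl.
pose n := (Num.truncn (B / d)).+1.
have n0 : (0 : R) < n%:R by rewrite ltr0n.
have nd : B / n%:R <= d.
  by rewrite ler_pdivrMr// mulrC -ler_pdivrMr// ltW// truncnS_gt.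
(* Stage [j] of the contraction: the loop itself for [j = 0], the constant [Phi x] for [j = n];
   consecutive stages differ by at most [d]. *)
pose target (j : nat) s := Phi x + (1 - j%:R / n%:R) *: (Phi (sg s) - Phi x).
have ctarget j : continuous (target j).
  move=> s; apply: (@cvgD _ _ _ _ _ (fun=> Phi x)
    (fun s => (1 - j%:R / n%:R) *: (Phi (sg s) - Phi x))); first exact: cvg_cst.
  apply: cvgZ; first exact: cvg_cst.
  by apply: cvgB; [exact: cPsg|exact: cvg_cst].
have lift j : exists g : R -> P, [/\ continuous g, g 0 = x, g 1 = y &
    forall s, Phi (g s) = target j s].
  elim: j => [|j [g [cg g0 g1 gE]]].
    exists sg; split => // s; rewrite /target mul0r subr0 scale1r.
    by rewrite addrC subrK.
  have ex s : exists w, `|w - g s| <= r / 3 /\ Phi w = target j.+1 s.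
    have [|w w1 w2] := ls (g s) (target j.+1 s); last by exists w.
    rewrite gE /target opprD addrACA subrr add0r -scalerBl.
    rewrite (_ : 1 - _ - _ = - n%:R^-1); last first.
      by rewrite -natr1 mulrDl mul1r; set a := _ / _; set b := _^-1; ring.
    rewrite normrZ normrN ger0_norm ?invr_ge0 ?ler0n//.
    by apply: (le_trans _ nd); rewrite mulrC ler_pM2r ?invr_gt0.
  have [h hP] := choice ex.
  have hr s s' : `|g s - g s'| <= r / 3 -> `|h s - h s'| <= r.
    move=> gg; have [h1 _] := hP s; have [h2 _] := hP s'.
    have -> : h s - h s' = (h s - g s) + (g s - g s') + (g s' - h s').
      by rewrite !subrKA.
    rewrite (le_trans (ler_normD _ _))//.
    have h3 := ler_normD (h s - g s) (g s - g s').
    by rewrite [`|g s' - _|]distrC; lra.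
  exists h; split => [|||s]; last by have [] := hP s.
  - apply/continuous_epsP => s e e0.
    have ce0 : 0 < c * e by rewrite mulr_gt0.
    have [d1 d10 Hd1] := (continuous_epsP (target j.+1)).1 (ctarget j.+1) s _ ce0.
    have [d2 d20 Hd2] := (continuous_epsP g).1 cg s _ r30.
    exists (Num.min d1 d2); first by rewrite lt_min d10.
    move=> s'; rewrite lt_min => /andP[/Hd1 s1 /Hd2 s2].
    have := Hc _ _ (hr _ _ (ltW s2)).
    rewrite (hP s).2 (hP s').2 => /le_lt_trans /(_ s1).
    by rewrite ltr_pM2l.
  - have [h1 h2] := hP 0; rewrite g0 in h1.
    have := Hc3 _ _ h1; rewrite h2 /target sg0 subrr scaler0 addr0 subrr normr0.
    by rewrite pmulr_rle0// normr_le0 subr_eq0 => /eqP.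
  - have [h1 h2] := hP 1; rewrite g1 in h1.
    have := Hc3 _ _ h1; rewrite h2 /target sg1 -xy subrr scaler0 addr0 subrr normr0.
    by rewrite pmulr_rle0// normr_le0 subr_eq0 => /eqP.
have [g [cg g0 g1 gE]] := lift n.
have gc s : Phi (g s) = Phi x.
  by rewrite gE /target divff ?gt_eqF// subrr scale0r addr0.
(* The last lift stays in the fibre of [Phi x], and [x] is the only point of that fibre within [r]
   of [x]. *)
have gap s : `|g s - x| <= r -> g s = x.
  move=> gr; have := Hc _ _ gr; rewrite gc subrr normr0 pmulr_rle0// normr_le0.
  by rewrite subr_eq0 => /eqP.
have [yr|yr] := leP `|y - x| r; first by rewrite -g1 gap// g1.
have cn := continuous_dist (a := x) cg.
(* A path from [x] to a point [y] farther than [r] would pass at distance [r / 2] from [x], inside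
   the gap. *)
have [||s _ sE] := @IVT R (fun s => `|g s - x|) 0 1 (r / 2) ler01.
- exact: continuous_subspaceT.
- rewrite g0 g1 subrr normr0 min_l// max_r//.
  by apply/andP; split; [rewrite ltW// divr_gt0|move: yr; lra].
- have : g s = x by apply: gap; rewrite sE; lra.
  by move=> gx; move: sE; rewrite gx subrr normr0 => /eqP; rewrite eq_sym gt_eqF// divr_gt0.
Qed.

(** Expansion gives [Psi] a Lipschitz bound at small scale, which turns the Taylor remainder of
    [Phi] into one of [Psi]. The derivative of [Psi] is the frame [X0], [X1] taken along [Psi], so
    smoothness bootstraps. *)
Lemma Phi_inverse : exists Psi, [/\ cancel Phi Psi, cancel Psi Phi, smooth Psi &
  forall z v, 'D_v Psi z = v 0 0 *: X0 (Psi z) + v 1 0 *: X1 (Psi z)].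
Proof.
have [Psi PsiP] := choice Phi_surj.
have PhiK : cancel Phi Psi by move=> x; apply: Phi_inj; rewrite PsiP.
have [c [r [c0 r0 Hc]]] := local_expansion.
have ls := local_surjection c0 r0 Hc; set d := c * r / 4 in ls.
have d0 : 0 < d by rewrite /d !mulr_gt0.
have Psi_lip z z' : `|z - z'| <= d -> c * `|Psi z - Psi z'| <= `|z - z'|.
  move=> zz'; have [|y yr yE] := ls (Psi z') z; first by rewrite PsiP.
  have yz : y = Psi z by rewrite -yE PhiK.
  by have := Hc _ _ yr; rewrite yE PsiP yz.
have [K K1 HK] := frame_bound; have [L L1 HL] := D_lipschitz.
have K0 : 0 < K by lra. have L0 : 0 < L by lra.
pose A z : 'M[R]_2 := \matrix_(i, j) (if j == 0 then X0 (Psi z) i 0 else X1 (Psi z) i 0).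
have AE z v : A z *m v = v 0 0 *: X0 (Psi z) + v 1 0 *: X1 (Psi z).
  apply/colP => i; rewrite !mxE big_ord_recl big_ord1 lift01 !mxE/=.
  by rewrite mulrC [X in _ + X]mulrC.
have dPsi z : differentiable Psi z /\ forall v, 'D_v Psi z = A z *m v.
  apply: diff_of_bound => e e0.
  set q := K * L / c ^+ 2; have q0 : 0 < q by rewrite divr_gt0 ?mulr_gt0 ?exprn_gt0.
  exists (Num.min d (e / q)); first by rewrite lt_min d0 divr_gt0.
  move=> h; rewrite lt_min => /andP[hd he].
  set k := Psi (z + h) - Psi z.
  have hE : h = Phi (Psi z + k) - Phi (Psi z).
    by rewrite /k (addrC (Psi z)) subrK !PsiP (addrC z) addrK.
  have kh : `|k| <= `|h| / c.
    rewrite ler_pdivlMr// mulrC; have := Psi_lip (z + h) z.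
    by rewrite addrC addKr => /(_ (ltW hd)).
  have T := Phi_taylor (ltW L0) HL (Psi z) k; rewrite -hE in T.
  have -> : k - A z *m h = A z *m ('D_k Phi (Psi z) - h).
    by rewrite mulmxBr [X in _ = X - _]AE -PhiX.
  rewrite AE (le_trans (HK _ _))// distrC.
  apply: (@le_trans _ _ (K * (L * (`|h| / c) * (`|h| / c)))).
    apply: ler_wpM2l; first exact: ltW.
    apply: le_trans T _; apply: ler_pM => //; first by rewrite mulr_ge0// ltW.
    by apply: ler_wpM2l => //; exact: ltW.
  rewrite (_ : K * _ = q * `|h| * `|h|); last by rewrite /q; field; rewrite gt_eqF.
  by rewrite ler_wpM2r// mulrC -ler_pdivlMr// ltW.
exists Psi; split => //; last by move=> z v; rewrite (dPsi z).2 AE.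
apply: smooth_bootstrap => [z|k v Ck]; first exact: (dPsi z).1.
have CX (X : P -> P) i : smooth X -> is_Ck k (fun z => X (Psi z) i 0).
  by move=> sX; apply: (Ck_comp (g := fun y : P => X y i 0)) => //; exact: smooth_entry.
rewrite (_ : (fun x => _) = fun z => v 0 0 *: X0 (Psi z) + v 1 0 *: X1 (Psi z)); last first.
  by apply/funext => z; rewrite (dPsi z).2 AE.
by apply: CkD; apply: CkZ; apply: Ck_mx => i j; rewrite (ord1 j); exact: CX.
Qed.

End GlobalDiffeo.

(** * Structure equations and Killing fields in conformal coordinates *)

Section Dot.
Context {R : realType} {n : nat}.
Implicit Types u v w : 'cV[R]_n.

Lemma dotC u v : dot u v = dot v u.
Proof. by rewrite !dotE; apply: eq_bigr => i _; rewrite mulrC. Qed.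
Lemma dotDl u v w : dot (u + v) w = dot u w + dot v w.
Proof. by rewrite /dot linearD mulmxDl mxE. Qed.
Lemma dotZl a u v : dot (a *: u) v = a * dot u v.
Proof. by rewrite /dot linearZ -scalemxAl mxE. Qed.
Lemma dotNl u v : dot (- u) v = - dot u v.
Proof. by rewrite -scaleN1r dotZl mulN1r. Qed.
Lemma dotDr u v w : dot w (u + v) = dot w u + dot w v.
Proof. by rewrite dotC dotDl !(dotC w). Qed.
Lemma dotZr a u v : dot v (a *: u) = a * dot v u.
Proof. by rewrite dotC dotZl dotC. Qed.
Lemma dotNr u v : dot v (- u) = - dot v u.
Proof. by rewrite dotC dotNl dotC. Qed.
Lemma dot0l u : dot 0 u = 0.
Proof. by rewrite -(scale0r u) dotZl mul0r. Qed.

Lemma dot_suml m (F : 'I_m -> 'cV[R]_n) v :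
  dot (\sum_i F i) v = \sum_i dot (F i) v.
Proof. exact: (big_morph (fun u => dot u v) (fun x y => dotDl x y v) (dot0l v)). Qed.

Lemma dot_eq0 u : dot u u = 0 -> u = 0.
Proof.
rewrite dotE => /eqP; rewrite psumr_eq0 => [|i _]; last by rewrite -expr2 sqr_ge0.
move=> /allP H; apply/colP => i; rewrite mxE; apply/eqP.
by have := H i (mem_index_enum i); rewrite /= mulf_eq0 orbb.
Qed.

Lemma dot_skew (B : 'M[R]_n) u v : B^T = - B -> dot (B *m u) v = - dot (B *m v) u.
Proof.
move=> BT; rewrite (dotC (B *m v)) /dot trmx_mul BT mulmxN mulNmx mxE mulmxA.
by rewrite -mulmxA.
Qed.

Lemma dot_skew0 (B : 'M[R]_n) u : B^T = - B -> dot (B *m u) u = 0.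
Proof. by move=> BT; have := dot_skew u u BT; lra. Qed.

End Dot.

Definition dotE_ := (@dotDl, @dotZl, @dotNl, @dotDr, @dotZr, @dotNr).

Section Parseval.
Context {R : realType}.
Notation V := 'cV[R]_4.
Variables (e : 'I_4 -> V).
Hypothesis orth : forall i j, dot (e i) (e j) = (i == j)%:R.

Let E : 'M[R]_4 := \matrix_(i, j) e i j 0.

Let EE : E^T *m E = 1%:M.
Proof.
apply: mulmx1C; apply/matrixP => i j; rewrite !mxE -orth dotE.
by apply: eq_bigr => k _; rewrite !mxE.
Qed.

Lemma parseval_vec (X : V) : X = \sum_i dot X (e i) *: e i.
Proof.
rewrite -{1}(mul1mx X) -EE -mulmxA; apply/colP => k; rewrite mxE summxE.
apply: eq_bigr => i _; rewrite !mxE mulrC; congr (_ * _).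
by rewrite dotE; apply: eq_bigr => j _; rewrite !mxE mulrC.
Qed.

Lemma parseval_dot (X Y : V) : dot X Y = \sum_i dot X (e i) * dot Y (e i).
Proof.
rewrite {1}(parseval_vec X) dot_suml.
by apply: eq_bigr => i _; rewrite dotZl (dotC Y).
Qed.

End Parseval.

Section Parseval4.
Context {R : realType}.
Notation V := 'cV[R]_4.

Definition four (a b c d : V) (i : 'I_4) : V := nth 0 [:: a; b; c; d] i.

Lemma ord4P (Q : 'I_4 -> Prop) : Q (inord 0) -> Q (inord 1) -> Q (inord 2) ->
  Q (inord 3) -> forall i, Q i.
Proof.
move=> Q0 Q1 Q2 Q3 i; rewrite -(inord_val i); case: i => -[|[|[|[|//]]]] ? //.
Qed.

Lemma sum4 (W : nmodType) (F : 'I_4 -> W) :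
  \sum_i F i = F (inord 0) + F (inord 1) + F (inord 2) + F (inord 3).
Proof.
rewrite !big_ord_recl big_ord0 addr0 !addrA.
by congr (F _ + F _ + F _ + F _); apply: val_inj; rewrite /= inordK.
Qed.

Lemma fourP (a b c d : V) :
  dot a a = 1 -> dot b b = 1 -> dot c c = 1 -> dot d d = 1 ->
  dot a b = 0 -> dot a c = 0 -> dot a d = 0 ->
  dot b c = 0 -> dot b d = 0 -> dot c d = 0 ->
  forall i j, dot (four a b c d i) (four a b c d j) = (i == j)%:R.
Proof.
move=> aa bb cc dd ab ac ad bc bd cd.
have E := (aa, bb, cc, dd, ab, ac, ad, bc, bd, cd).
have E' := (etrans (dotC b a) ab, etrans (dotC c a) ac, etrans (dotC d a) ad,
  etrans (dotC c b) bc, etrans (dotC d b) bd, etrans (dotC d c) cd).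
apply: ord4P; apply: ord4P; rewrite /four !inordK//= ?E ?E';
  by rewrite -(inj_eq val_inj) /= !inordK.
Qed.

Lemma parseval4 (a b c d X Y : V) :
  dot a a = 1 -> dot b b = 1 -> dot c c = 1 -> dot d d = 1 ->
  dot a b = 0 -> dot a c = 0 -> dot a d = 0 ->
  dot b c = 0 -> dot b d = 0 -> dot c d = 0 ->
  dot X Y = dot X a * dot Y a + dot X b * dot Y b + dot X c * dot Y c + dot X d * dot Y d.
Proof.
move=> aa bb cc dd ab ac ad bc bd cd.
rewrite (parseval_dot (fourP aa bb cc dd ab ac ad bc bd cd)) sum4.
by rewrite /four !inordK.
Qed.

Lemma parseval4_vec (a b c d X : V) :
  dot a a = 1 -> dot b b = 1 -> dot c c = 1 -> dot d d = 1 ->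
  dot a b = 0 -> dot a c = 0 -> dot a d = 0 ->
  dot b c = 0 -> dot b d = 0 -> dot c d = 0 ->
  X = dot X a *: a + dot X b *: b + dot X c *: c + dot X d *: d.
Proof.
move=> aa bb cc dd ab ac ad bc bd cd.
rewrite {1}(parseval_vec (fourP aa bb cc dd ab ac ad bc bd cd) X) sum4.
by rewrite /four !inordK.
Qed.

End Parseval4.

(** * Frame equations in isothermal curvature-line coordinates *)

Section Conformal.
Context {R : realType}.
Notation P := 'cV[R]_2.
Notation V := 'cV[R]_4.
Variables (r n r1 r2 : P -> V) (lam sig u1 u2 : P -> R).
Hypotheses (sr : smooth r) (sn : smooth n) (sl : smooth lam).
Hypothesis lam_gt0 : forall z, 0 < lam z.
Hypotheses (r1E : forall z, 'D_dx r z = r1 z) (r2E : forall z, 'D_dy r z = r2 z)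
  (sigE : forall z, sig z = (lam z)^-1)
  (lam_x : forall z, 'D_dx lam z = 2 * u1 z * lam z)
  (lam_y : forall z, 'D_dy lam z = 2 * u2 z * lam z).
Hypotheses (rr : forall z, dot (r z) (r z) = 1) (nn : forall z, dot (n z) (n z) = 1)
  (nr : forall z, dot (n z) (r z) = 0)
  (nr1 : forall z, dot (n z) (r1 z) = 0) (nr2 : forall z, dot (n z) (r2 z) = 0)
  (r11E : forall z, dot (r1 z) (r1 z) = lam z)
  (r22E : forall z, dot (r2 z) (r2 z) = lam z)
  (r12E : forall z, dot (r1 z) (r2 z) = 0)
  (n1E : forall z, 'D_dx n z = - sig z *: r1 z)
  (n2E : forall z, 'D_dy n z = sig z *: r2 z).

Let lam0 z : lam z != 0. Proof. by rewrite gt_eqF. Qed.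
Let sigl z : sig z * lam z = 1. Proof. by rewrite sigE mulVf. Qed.
Let sig0 z : sig z != 0. Proof. by rewrite sigE invr_neq0. Qed.
Let ss : smooth sig.
Proof. by rewrite (_ : sig = fun z => (lam z)^-1); [exact: smoothV|exact/funext]. Qed.
Let sr1 : smooth r1.
Proof. by rewrite (_ : r1 = fun z => 'D_dx r z); [exact: smooth_D|exact/funext]. Qed.
Let sr2 : smooth r2.
Proof. by rewrite (_ : r2 = fun z => 'D_dy r z); [exact: smooth_D|exact/funext]. Qed.

Lemma sig_x z : 'D_dx sig z = - 2 * u1 z * sig z.
Proof.
rewrite (_ : sig = fun z => (lam z)^-1); last exact/funext.
rewrite (D_V z dx lam0 sl) lam_x; field; exact: lam0.
Qed.
Lemma sig_y z : 'D_dy sig z = - 2 * u2 z * sig z.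
Proof.
rewrite (_ : sig = fun z => (lam z)^-1); last exact/funext.
rewrite (D_V z dy lam0 sl) lam_y; field; exact: lam0.
Qed.

Lemma dot_cst_D (f g : P -> V) (c : R) z v : smooth f -> smooth g ->
  (forall z, dot (f z) (g z) = c) ->
  dot ('D_v f z) (g z) = - dot (f z) ('D_v g z).
Proof.
move=> sf sg fg; have := D_dot z v sf sg.
have -> : (fun y => dot (f y) (g y)) = cst c by apply/funext => y; exact: fg.
by rewrite derive_cst => /esym/eqP; rewrite addr_eq0 => /eqP.
Qed.

Let rr1 z : dot (r1 z) (r z) = 0.
Proof.
by have := dot_cst_D z dx sr sr rr; rewrite r1E (dotC (r z)); set a := dot _ _; lra.
Qed.
Let rr2 z : dot (r2 z) (r z) = 0.
Proof.
by have := dot_cst_D z dy sr sr rr; rewrite r2E (dotC (r z)); set a := dot _ _; lra.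
Qed.

Lemma r12_sym z : 'D_dy r1 z = 'D_dx r2 z.
Proof.
have <- : (fun z => 'D_dx r z) = r1 by exact/funext.
have <- : (fun z => 'D_dy r z) = r2 by exact/funext.
exact: schwarzmx.
Qed.

(** The algebra of [r12_eq]: with [a] the curvature, [s], [t] the vectors [r1], [r2] and [X] the
    mixed derivative [r_xy], the hypothesis is [n_xy = n_yx] written out. *)
Lemma codazzi_alg (a p q : R) (s t X : V) : a != 0 ->
  - ((- 2 * q * a) *: s + a *: X) = (- 2 * p * a) *: t + a *: X ->
  X = q *: s + p *: t.
Proof.
move=> a0 H; apply: (scalerI a0); apply/colP => i.
have := congr1 (fun M : V => M i 0) H; rewrite !mxE.
by move: (s i 0) (t i 0) (X i 0) => si ti Xi; lra.
Qed.

(** Codazzi: the mixed derivatives of [n] agree. Since [n_x] and [n_y] are multiples of [r_x] and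
    [r_y] by [- sig] and [sig], this single equation determines [r_xy], normal components
    included. *)
Lemma r12_eq z : 'D_dy r1 z = u2 z *: r1 z + u1 z *: r2 z.
Proof.
apply: (codazzi_alg (sig0 z)); rewrite -sig_x -sig_y.
apply: etrans (congr1 -%R (esym (D_Zl z dy ss sr1))) _.
rewrite [in RHS]r12_sym; apply: etrans _ (D_Zl z dx ss sr2).
apply: etrans (esym (D_N z dy (smoothZl ss sr1))) _.
have -> : (fun y => - (sig y *: r1 y)) = (fun y => 'D_dx n y).
  by apply/funext => y; rewrite n1E scaleNr.
have -> : (fun y => sig y *: r2 y) = (fun y => 'D_dy n y).
  by apply/funext => y; rewrite n2E.
exact: (schwarzmx z dx dy sn).
Qed.

Lemma r21_eq z : 'D_dx r2 z = u2 z *: r1 z + u1 z *: r2 z.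
Proof. exact: etrans (esym (r12_sym z)) (r12_eq z). Qed.

Lemma frame_vec z (X : V) : X = dot X (r z) *: r z + dot X (n z) *: n z +
  (sig z * dot X (r1 z)) *: r1 z + (sig z * dot X (r2 z)) *: r2 z.
Proof.
(* [q r1] and [q r2] have length 1, because [sig = 1 / lam]; the two factors [q] recombine to
   [sig]. *)
set q := Num.sqrt (sig z).
have qq : q * q = sig z by rewrite -expr2 sqr_sqrtr// sigE invr_ge0 ltW.
have := @parseval4_vec R (r z) (n z) (q *: r1 z) (q *: r2 z) X.
rewrite !dotE_ rr nn (dotC (r z)) nr (dotC (r z)) rr1 (dotC (r z)) rr2 nr1 nr2.
rewrite r11E r22E r12E !mulr0 !mulrA qq sigl.
move=> /(_ erefl erefl erefl erefl erefl erefl erefl erefl erefl erefl) {1}->.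
have A m (v : V) : (q * m) *: (q *: v) = (sig z * m) *: v.
  by rewrite scalerA mulrAC qq.
by rewrite !A.
Qed.

(** The coefficient of [n] is [sig * lam = 1]: in these coordinates the second fundamental form is
    [dx ^ 2 - dy ^ 2]. The term [- lam r] comes from the unit sphere. *)
Lemma r11_eq z : 'D_dx r1 z =
  u1 z *: r1 z - u2 z *: r2 z + n z - lam z *: r z.
Proof.
have E1 : dot ('D_dx r1 z) (r z) = - lam z.
  by apply: etrans (dot_cst_D z dx sr1 sr rr1) _; rewrite r1E r11E.
have E2 : dot ('D_dx r1 z) (n z) = 1.
  have rn y : dot (r1 y) (n y) = 0 by rewrite dotC.
  apply: etrans (dot_cst_D z dx sr1 sn rn) _.
  by rewrite n1E dotZr r11E mulNr opprK.
have E3 : dot ('D_dx r1 z) (r1 z) = u1 z * lam z.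
  have E : (fun y => dot (r1 y) (r1 y)) = lam by apply/funext.
  have := D_dot z dx sr1 sr1; rewrite E lam_x (dotC (r1 z)).
  by rewrite -mulrA; move: (dot _ _) (u1 z * lam z) => x y; lra.
have E4 : dot ('D_dx r1 z) (r2 z) = - (u2 z * lam z).
  apply: etrans (dot_cst_D z dx sr1 sr2 r12E) _.
  by rewrite r21_eq !dotE_ r11E r12E mulr0 addr0.
apply: etrans (frame_vec z ('D_dx r1 z)) _; rewrite E1 E2 E3 E4.
rewrite mulrN !(mulrCA (sig z)) sigl !mulr1.
apply/colP => i; rewrite !mxE.
by move: (r z i 0) (n z i 0) (r1 z i 0) (r2 z i 0) => *; ring.
Qed.

Lemma r22_eq z : 'D_dy r2 z =
  - u1 z *: r1 z + u2 z *: r2 z - n z - lam z *: r z.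
Proof.
have E1 : dot ('D_dy r2 z) (r z) = - lam z.
  by apply: etrans (dot_cst_D z dy sr2 sr rr2) _; rewrite r2E r22E.
have E2 : dot ('D_dy r2 z) (n z) = - 1.
  have rn y : dot (r2 y) (n y) = 0 by rewrite dotC.
  apply: etrans (dot_cst_D z dy sr2 sn rn) _.
  by rewrite n2E dotZr r22E sigl.
have E3 : dot ('D_dy r2 z) (r2 z) = u2 z * lam z.
  have E : (fun y => dot (r2 y) (r2 y)) = lam by apply/funext.
  have := D_dot z dy sr2 sr2; rewrite E lam_y (dotC (r2 z)).
  by rewrite -mulrA; move: (dot _ _) (u2 z * lam z) => x y; lra.
have E4 : dot ('D_dy r2 z) (r1 z) = - (u1 z * lam z).
  have r21 y : dot (r2 y) (r1 y) = 0 by rewrite dotC.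
  apply: etrans (dot_cst_D z dy sr2 sr1 r21) _.
  by rewrite r12_eq !dotE_ r22E r21 mulr0 add0r.
apply: etrans (frame_vec z ('D_dy r2 z)) _; rewrite E1 E2 E3 E4.
rewrite mulrN !(mulrCA (sig z)) sigl !mulr1.
apply/colP => i; rewrite !mxE.
by move: (r z i 0) (n z i 0) (r1 z i 0) (r2 z i 0) => *; ring.
Qed.

Lemma D_killing (B : 'M[R]_4) (f g : P -> V) z v : smooth f -> smooth g ->
  'D_v (fun y => dot (B *m f y) (g y)) z =
  dot (B *m 'D_v f z) (g z) + dot (B *m f z) ('D_v g z).
Proof.
move=> sf sg; apply: etrans (D_dot z v (smooth_mulmx B sf) sg) _.
congr (_ + _); congr dot; exact: D_mulmx.
Qed.

End Conformal.

(* The equations satisfied by the entries of a skew matrix [B] in the moving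
   frame [(r, n, r_x, r_y)]: [f = <B r, n>], [P_i = <B r, r_i>],
   [Q_i = <B n, r_i>] and [k = <B r_x, r_y>]. *)
Record killing (R : realType) (lam sig u1 u2 f P1 P2 Q1 Q2 k : 'cV[R]_2 -> R) : Prop :=
  Killing {
  killing_smooth : [/\ smooth f, smooth P1, smooth P2 & [/\ smooth Q1, smooth Q2 & smooth k]];
  killing_fx : forall z, 'D_dx f z = - Q1 z - sig z * P1 z;
  killing_fy : forall z, 'D_dy f z = - Q2 z + sig z * P2 z;
  killing_P1x : forall z, 'D_dx P1 z = u1 z * P1 z - u2 z * P2 z + f z;
  killing_P1y : forall z, 'D_dy P1 z = - k z + u2 z * P1 z + u1 z * P2 z;
  killing_P2x : forall z, 'D_dx P2 z = k z + u2 z * P1 z + u1 z * P2 z;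
  killing_P2y : forall z, 'D_dy P2 z = - u1 z * P1 z + u2 z * P2 z - f z;
  killing_Q1x : forall z, 'D_dx Q1 z = u1 z * Q1 z - u2 z * Q2 z + lam z * f z;
  killing_Q1y : forall z, 'D_dy Q1 z = - sig z * k z + u2 z * Q1 z + u1 z * Q2 z;
  killing_Q2x : forall z, 'D_dx Q2 z = - sig z * k z + u2 z * Q1 z + u1 z * Q2 z;
  killing_Q2y : forall z, 'D_dy Q2 z = - u1 z * Q1 z + u2 z * Q2 z + lam z * f z;
  killing_kx : forall z, 'D_dx k z = 2 * u1 z * k z + Q2 z - lam z * P2 z;
  killing_ky : forall z, 'D_dy k z = 2 * u2 z * k z + Q1 z + lam z * P1 z
}.

Section KillingOfSkew.
Context {R : realType}.
Notation P := 'cV[R]_2.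
Notation V := 'cV[R]_4.
Variables (r n r1 r2 : P -> V) (lam sig u1 u2 : P -> R).
Hypotheses (sr : smooth r) (sn : smooth n) (sr1 : smooth r1) (sr2 : smooth r2).
Hypotheses (r1E : forall z, 'D_dx r z = r1 z) (r2E : forall z, 'D_dy r z = r2 z)
  (n1E : forall z, 'D_dx n z = - sig z *: r1 z)
  (n2E : forall z, 'D_dy n z = sig z *: r2 z)
  (r11 : forall z, 'D_dx r1 z = u1 z *: r1 z - u2 z *: r2 z + n z - lam z *: r z)
  (r12 : forall z, 'D_dy r1 z = u2 z *: r1 z + u1 z *: r2 z)
  (r21 : forall z, 'D_dx r2 z = u2 z *: r1 z + u1 z *: r2 z)
  (r22 : forall z, 'D_dy r2 z = - u1 z *: r1 z + u2 z *: r2 z - n z - lam z *: r z).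

(** Skewness leaves six independent pairings of the frame vectors, so differentiation by the frame
    equations closes up into a linear system in these six. *)
Lemma killing_of_skew (B : 'M[R]_4) : B^T = - B ->
  killing lam sig u1 u2
    (fun z => dot (B *m r z) (n z)) (fun z => dot (B *m r z) (r1 z))
    (fun z => dot (B *m r z) (r2 z)) (fun z => dot (B *m n z) (r1 z))
    (fun z => dot (B *m n z) (r2 z)) (fun z => dot (B *m r1 z) (r2 z)).
Proof.
move=> BT.
have sk u v := dot_skew u v BT; have sk0 u := dot_skew0 u BT.
have sd f g : smooth f -> smooth g -> smooth (fun z => dot (B *m f z) (g z)).
  by move=> sf sg; apply: smooth_dot => //; exact: smooth_mulmx.
have bil := (@mulmxDr R, @mulmxN R, @dotDl R, @dotDr R, @dotNl R, @dotNr R, @dotZr R, @dotZl R).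
have scB a (v : V) : B *m (a *: v) = a *: (B *m v) by rewrite -scalemxAr.
have o1 z := sk (r1 z) (n z); have o2 z := sk (r2 z) (n z).
have o3 z := sk (r2 z) (r1 z); have o4 z := sk (n z) (r z).
have o5 z := sk (r1 z) (r z); have o6 z := sk (r2 z) (r z).
split; first by do ?split; exact: sd.
- move=> z; apply: etrans (D_killing B z dx sr sn) _.
  rewrite r1E n1E !bil o1. move: (dot _ _) (dot _ _) => *; ring.
- move=> z; apply: etrans (D_killing B z dy sr sn) _.
  rewrite r2E n2E !bil o2. move: (dot _ _) (dot _ _) => *; ring.
- move=> z; apply: etrans (D_killing B z dx sr sr1) _.
  rewrite r1E r11 !bil !sk0. move: (dot _ _) (dot _ _) (dot _ _) => *; ring.
- move=> z; apply: etrans (D_killing B z dy sr sr1) _.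
  rewrite r2E r12 !bil o3. move: (dot _ _) (dot _ _) (dot _ _) => *; ring.
- move=> z; apply: etrans (D_killing B z dx sr sr2) _.
  rewrite r1E r21 !bil. move: (dot _ _) (dot _ _) (dot _ _) => *; ring.
- move=> z; apply: etrans (D_killing B z dy sr sr2) _.
  rewrite r2E r22 !bil !sk0. move: (dot _ _) (dot _ _) (dot _ _) => *; ring.
- move=> z; apply: etrans (D_killing B z dx sn sr1) _.
  rewrite n1E r11 scB !bil !sk0 o4. move: (dot _ _) (dot _ _) (dot _ _) => *; ring.
- move=> z; apply: etrans (D_killing B z dy sn sr1) _.
  rewrite n2E r12 scB !bil o3. move: (dot _ _) (dot _ _) (dot _ _) => *; ring.
- move=> z; apply: etrans (D_killing B z dx sn sr2) _.
  rewrite n1E r21 scB !bil. move: (dot _ _) (dot _ _) (dot _ _) => *; ring.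
- move=> z; apply: etrans (D_killing B z dy sn sr2) _.
  rewrite n2E r22 scB !bil !sk0 o4. move: (dot _ _) (dot _ _) (dot _ _) => *; ring.
- move=> z; apply: etrans (D_killing B z dx sr1 sr2) _.
  rewrite r11 r21 !bil !scB !bil !sk0. move: (dot _ _) (dot _ _) (dot _ _) => *; ring.
- move=> z; apply: etrans (D_killing B z dy sr1 sr2) _.
  rewrite r12 r22 !bil !scB !bil !sk0 o1 o5. move: (dot _ _) (dot _ _) (dot _ _) => *; ring.
Qed.

End KillingOfSkew.

Section Constant.
Context {R : realType} {n : nat}.

Lemma D0_line_cst (f : 'cV[R]_n -> R) v : smooth f -> (forall z, 'D_v f z = 0) ->
  forall z t, f (z + t *: v) = f z.
Proof.
move=> sf f0 z t; have [|s _ E] := @line_mvt _ _ f z (t *: v).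
  by move=> y; exact: smooth_diff.
apply/eqP; rewrite -subr_eq0 E; apply/eqP.
by rewrite (D_dirZ _ _ (smooth_diff _ sf)) f0 scaler0.
Qed.

Lemma D0_cst (f : 'cV[R]_n -> R) : smooth f -> (forall z v, 'D_v f z = 0) ->
  forall y z, f y = f z.
Proof.
move=> sf f0 y z; have := D0_line_cst sf (f0^~ (y - z)) z 1.
by rewrite scale1r addrC subrK.
Qed.

End Constant.

(** * Vanishing normal component: Killing fields as translations *)

Section Translation.
Context {R : realType}.
Notation P := 'cV[R]_2.
Variables (lam sig u1 u2 f P1 P2 Q1 Q2 k : P -> R).
Hypotheses (sl : smooth lam) (ss : smooth sig).
Hypothesis sig0 : forall z, sig z != 0.
Hypotheses (lam_x : forall z, 'D_dx lam z = 2 * u1 z * lam z)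
  (lam_y : forall z, 'D_dy lam z = 2 * u2 z * lam z)
  (sig_x : forall z, 'D_dx sig z = - 2 * u1 z * sig z)
  (sig_y : forall z, 'D_dy sig z = - 2 * u2 z * sig z).
Hypothesis K : killing lam sig u1 u2 f P1 P2 Q1 Q2 k.
Hypothesis f0 : forall z, f z = 0.

Lemma plane_cst (g : P -> R) : smooth g -> (forall z, 'D_dx g z = 0) ->
  (forall z, 'D_dy g z = 0) -> forall y z, g y = g z.
Proof.
move=> sg gx gy; apply: D0_cst => // z v.
by rewrite (D_plane v (smooth_diff z sg)) gx gy !scaler0 addr0.
Qed.

(** As [f = 0], its two derivatives express [Q1], [Q2] through [P1], [P2]; feeding this into the
    equations of [Q1] determines [k] and makes [(P1, P2)] orthogonal to the gradient of [lam]. For a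
    skew matrix [B], [sig P1] and [sig P2] are the coordinates of the tangent field [B r]; they turn
    out to be constant and give [T]. *)
Lemma killing_translation :
  (exists z, ~ [/\ P1 z = 0, P2 z = 0, Q1 z = 0, Q2 z = 0 & k z = 0]) ->
  exists2 T : P, T != 0 & forall z t, lam (z + t *: T) = lam z.
Proof.
move=> [z0 nz]; have [_ sP1 sP2 [sQ1 sQ2 sk]] := killing_smooth K.
have fD v z : 'D_v f z = 0.
  have -> : f = cst 0 by apply/funext => y; exact: f0.
  exact: derive_cst.
have q1 z : Q1 z = - (sig z * P1 z).
  by have := killing_fx K z; rewrite fD; lra.
have q2 z : Q2 z = sig z * P2 z.
  by have := killing_fy K z; rewrite fD; lra.
have DQ1 v z : 'D_v Q1 z = - ('D_v sig z * P1 z + sig z * 'D_v P1 z).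
  have -> : Q1 = fun z => - (sig z * P1 z) by exact/funext.
  by apply: etrans (D_N z v (smoothM ss sP1)) _; rewrite (D_M z v ss sP1).
have R1 z : u1 z * P1 z + u2 z * P2 z = 0.
  have := DQ1 dx z; rewrite (killing_Q1x K) sig_x (killing_P1x K) f0 q1 q2.
  by move=> H; apply: (mulfI (sig0 z)); lra.
have R2 z : k z = u1 z * P2 z - u2 z * P1 z.
  have := DQ1 dy z; rewrite (killing_Q1y K) sig_y (killing_P1y K) q1 q2.
  by move=> H; apply: (mulfI (sig0 z)); lra.
have T1c : forall y z, sig y * P1 y = sig z * P1 z.
  apply: (plane_cst (g := fun z => sig z * P1 z)) => [|z|z]; first exact: smoothM.
  - rewrite (D_M z dx ss sP1) sig_x (killing_P1x K) f0.
    rewrite [LHS](_ : _ = - sig z * (u1 z * P1 z + u2 z * P2 z)); last by ring.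
    by rewrite R1 mulr0.
  - rewrite (D_M z dy ss sP1) sig_y (killing_P1y K) R2; ring.
have T2c : forall y z, sig y * P2 y = sig z * P2 z.
  apply: (plane_cst (g := fun z => sig z * P2 z)) => [|z|z]; first exact: smoothM.
  - rewrite (D_M z dx ss sP2) sig_x (killing_P2x K) R2; ring.
  - rewrite (D_M z dy ss sP2) sig_y (killing_P2y K) f0.
    rewrite [LHS](_ : _ = - sig z * (u1 z * P1 z + u2 z * P2 z)); last by ring.
    by rewrite R1 mulr0.
exists (pt (sig z0 * P1 z0) (sig z0 * P2 z0)).
  apply/eqP => /colP T0; apply: nz.
  have p1 : P1 z0 = 0.
    by have /eqP := T0 0; rewrite pt0 mxE mulf_eq0 (negbTE (sig0 _)) => /eqP.
  have p2 : P2 z0 = 0.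
    by have /eqP := T0 1; rewrite pt1 mxE mulf_eq0 (negbTE (sig0 _)) => /eqP.
  by rewrite R2 q1 q2 p1 p2 !mulr0 subrr oppr0.
apply: D0_line_cst => // z; rewrite (D_plane _ (smooth_diff z sl)) pt0 pt1.
rewrite (T1c z0 z) (T2c z0 z) lam_x lam_y.
rewrite (_ : _ + _ = 2 * lam z * sig z * (u1 z * P1 z + u2 z * P2 z)).
  by rewrite R1 mulr0.
by rewrite /GRing.scale/=; ring.
Qed.

End Translation.

(** * Parity about a point by Gronwall's inequality *)

Section Parity.
Context {R : realType}.
Notation P := 'cV[R]_2.
Variables (m : nat) (g : 'I_m -> P -> R) (s : 'I_m -> R).
Hypotheses (sg : forall i, smooth (g i)).
Variables (c v : P).

Let S (t : R) := \sum_j `|g j (c + t *: v) - s j * g j (c - t *: v)|.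

(* [S] measures how far the family [g] is from being even ([s j = 1]) or odd
   ([s j = -1]) about [c]; a function of parity [a] is one whose own defect is
   controlled by [S], which is what Gronwall's inequality needs. *)
Definition parity (a : R) (h : P -> R) := continuous h /\
  exists2 K, 0 <= K & forall t : R, 0 <= t <= 1 ->
    `|h (c + t *: v) - a * h (c - t *: v)| <= K * S t.

Let S0 t : 0 <= S t. Proof. exact: sumr_ge0. Qed.

Lemma parity_g i : parity (s i) (g i).
Proof.
split; first exact: smooth_continuous.
exists 1 => // t _; rewrite mul1r /S (bigD1 i)//= lerDl; exact: sumr_ge0.
Qed.

Lemma parityD a h1 h2 : parity a h1 -> parity a h2 -> parity a (fun z => h1 z + h2 z).
Proof.
move=> [c1 [K1 K10 H1]] [c2 [K2 K20 H2]]; split.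
  by move=> z; exact: cvgD (c1 z) (c2 z).
exists (K1 + K2); first exact: addr_ge0.
move=> t t01; rewrite mulrDr opprD addrACA mulrDl.
apply: le_trans (ler_normD _ _) _; exact: lerD (H1 t t01) (H2 t t01).
Qed.

Lemma parityZ a b h : parity a h -> parity a (fun z => b * h z).
Proof.
move=> [c1 [K1 K10 H1]]; split.
  exact: (CkM (k := 0%N) (Ck_cst 0 b) c1).
exists (`|b| * K1); first exact: mulr_ge0.
move=> t t01; rewrite mulrCA -mulrBr normrM -mulrA ler_wpM2l//; exact: H1.
Qed.

(** The usual splitting of a difference of products; continuity bounds the remaining factor on the
    ball of radius [|v|] about [c], so the defect stays linear in [S]. *)
Lemma parityM a b h1 h2 : parity a h1 -> parity b h2 ->
  parity (a * b) (fun z => h1 z * h2 z).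
Proof.
move=> [c1 [K1 K10 H1]] [c2 [K2 K20 H2]]; split.
  by move=> z; exact: cvgM (c1 z) (c2 z).
have [M1 M10 HM1] := cball_bounded c `|v| c1.
have [M2 M20 HM2] := cball_bounded c `|v| c2.
exists (K1 * M2 + `|a| * M1 * K2).
  by rewrite addr_ge0// ?mulr_ge0.
move=> t t01; have /andP[t0 t1] := t01.
have tv : `|t *: v| <= `|v| by rewrite normrZ ger0_norm// ler_piMl.
set x1 := h1 _; set x2 := h2 _; set y1 := h1 (c - _); set y2 := h2 (c - _).
have -> : x1 * x2 - a * b * (y1 * y2) = (x1 - a * y1) * x2 + a * y1 * (x2 - b * y2).
  by ring.
apply: le_trans (ler_normD _ _) _; rewrite !normrM mulrDl; apply: lerD.
  rewrite mulrAC; apply: ler_pM => //; first exact: H1.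
  by apply: HM2; rewrite addrC addKr.
rewrite -(mulrA (`|a| * M1)); apply: ler_pM => //; last exact: H2.
by apply: ler_wpM2l => //; apply: HM1; rewrite addrC addKr normrN.
Qed.

(** The defects vanish at [t = 0]. Reversing the direction flips the sign of a derivative, so the
    defect of [g i] has as derivative the defect of ['D_v (g i)] for the parity [- s i], which is
    bounded by a multiple of [S]. *)
Lemma parity_flow : (forall i, g i c = s i * g i c) ->
  (forall i, parity (- s i) (fun z => 'D_v (g i) z)) ->
  forall i, g i (c + v) = s i * g i (c - v).
Proof.
move=> gc Dg i.
pose d i (t : R) := g i (c + t *: v) - s i * g i (c - t *: v).
pose d' i (t : R) := 'D_v (g i) (c + t *: v) + s i * 'D_v (g i) (c - t *: v).
have dd j (t : R) : is_derive t 1 (d j) (d' j t).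
  have D1 := line_is_derive (t := t) (smooth_diff (c + t *: v) (sg j)).
  have := line_is_derive (v := - v) (t := t) (smooth_diff (c + t *: - v) (sg j)).
  have E (r : R) : c + r *: - v = c - r *: v by rewrite scalerN.
  have -> : (fun r : R => g j (c + r *: - v)) = fun r => g j (c - r *: v).
    by apply/funext => r; rewrite E.
  rewrite E -(scaleN1r v) (D_dirZ _ _ (smooth_diff _ (sg j))) scaleN1r => D2.
  have := is_deriveB D1 (is_deriveZ (s j) D2).
  by rewrite (_ : _ - _ = d' j t)// /d' scalerN opprK.
have /choice [K HK] : forall j, exists K, 0 <= K /\ forall t : R, 0 <= t <= 1 ->
    `|d' j t| <= K * S t.
  move=> j; have [_ [K K0 HK]] := Dg j; exists K; split => // t /HK.
  by rewrite mulNr opprK.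
have d0 j : d j 0 = 0.
  by rewrite /d scale0r addr0 subr0 -gc subrr.
have dC j (t : R) : 0 <= t <= 1 -> `|d' j t| <= (\sum_i K i) * \sum_j `|d j t|.
  move=> t01; have [K0 /(_ t t01) H] := HK j; apply: le_trans H _.
  apply: ler_wpM2r; first exact: S0.
  by rewrite (bigD1 j)//= lerDl; apply: sumr_ge0 => l _; have [] := HK l.
have := gronwall dd d0 dC i; rewrite /d scale1r => /eqP.
by rewrite subr_eq0 => /eqP.
Qed.

End Parity.

(** * Reflection symmetry of the closed system *)

Section Symmetry.
Context {R : realType}.
Notation P := 'cV[R]_2.
Variables (lam sig u1 u2 f P1 P2 Q1 Q2 k f' P1' P2' Q1' Q2' k' : P -> R).
Hypotheses (sl : smooth lam) (ss : smooth sig).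
Hypotheses (lam0 : forall z, lam z != 0) (sig0 : forall z, sig z != 0).
Hypotheses (lam_x : forall z, 'D_dx lam z = 2 * u1 z * lam z)
  (lam_y : forall z, 'D_dy lam z = 2 * u2 z * lam z)
  (sig_x : forall z, 'D_dx sig z = - 2 * u1 z * sig z)
  (sig_y : forall z, 'D_dy sig z = - 2 * u2 z * sig z).
Hypothesis K : killing lam sig u1 u2 f P1 P2 Q1 Q2 k.
Hypothesis K' : killing lam sig u1 u2 f' P1' P2' Q1' Q2' k'.
Hypotheses (u1f : forall z, u1 z = f z) (u2f : forall z, u2 z = f' z).
Variable c : P.
Hypotheses (u1c : u1 c = 0) (u2c : u2 c = 0).

(** The reflection makes [k] and [k'] odd, so they have to vanish at [c], as [f] and [f'] do by
    criticality. At [c], the [x]-derivative of the relation [cross] reads [2 sig k = 0] and its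
    [y]-derivative [2 sig k' = 0]. *)
Lemma critical_k : k c = 0 /\ k' c = 0.
Proof.
have [sf sP1 sP2 [sQ1 sQ2 sk]] := killing_smooth K.
have [sf' sP1' sP2' [sQ1' sQ2' sk']] := killing_smooth K'.
have fc : f c = 0 by rewrite -u1f. have fc' : f' c = 0 by rewrite -u2f.
(* [f = u_x] and [f' = u_y]; differentiate [f_y = f'_x] at [c]. *)
have cross z : - Q2 z + sig z * P2 z = - Q1' z - sig z * P1' z.
  rewrite -(killing_fy K) -(killing_fx K').
  have H := schwarz z dx dy sl.
  have E1 : (fun y => 'D_dx lam y) = fun y => 2 * f y * lam y.
    by apply/funext => y; rewrite lam_x u1f.
  have E2 : (fun y => 'D_dy lam y) = fun y => 2 * f' y * lam y.
    by apply/funext => y; rewrite lam_y u2f.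
  have s2f : smooth (fun y => 2 * f y) by exact: (smoothM (smooth_cst (2 : R)) _).
  have s2f' : smooth (fun y => 2 * f' y) by exact: (smoothM (smooth_cst (2 : R)) _).
  rewrite E1 E2 in H.
  have {}H := etrans (esym (D_M z dy s2f sl)) (etrans H (D_M z dx s2f' sl)).
  have D2 (h : P -> R) (v : P) : smooth h -> 'D_v (fun y => 2 * h y) z = 2 * 'D_v h z.
    by move=> sh; exact: D_Z.
  rewrite (D2 _ _ sf) (D2 _ _ sf') lam_x lam_y u1f u2f in H.
  apply: (mulIf (lam0 z)); move: H.
  by move: ('D_dy f z) ('D_dx f' z) => p q; lra.
have E : (fun z => - Q2 z + sig z * P2 z) = (fun z => - Q1' z - sig z * P1' z).
  exact/funext.
have L v : 'D_v (fun z => - Q2 z + sig z * P2 z) c =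
    - 'D_v Q2 c + ('D_v sig c * P2 c + sig c * 'D_v P2 c).
  apply: etrans (D_D c v (smoothN sQ2) (smoothM ss sP2)) _.
  by congr (_ + _); [exact: D_N|exact: D_M].
have M v : 'D_v (fun z => - Q1' z - sig z * P1' z) c =
    - 'D_v Q1' c - ('D_v sig c * P1' c + sig c * 'D_v P1' c).
  apply: etrans (D_B c v (smoothN sQ1') (smoothM ss sP1')) _.
  by congr (_ - _); [exact: D_N|exact: D_M].
have := M dx; have := M dy; rewrite -E !L.
rewrite (killing_Q2x K) (killing_Q2y K) (killing_P2x K) (killing_P2y K).
rewrite (killing_Q1x K') (killing_Q1y K') (killing_P1x K') (killing_P1y K').
rewrite sig_x sig_y u1c u2c fc fc' => Hy Hx.
by split; apply: (mulfI (sig0 c)); lra.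
Qed.

(** Unrolls a bounded quantifier into a conjunction, so that the fourteen entries of [state] can be
    treated one by one. *)
Fixpoint upto (Q : nat -> Prop) m : Prop :=
  if m is m'.+1 then Q 0%N /\ upto (fun i => Q i.+1) m' else True.

Lemma uptoP m (Q : nat -> Prop) : upto Q m -> forall i, (i < m)%N -> Q i.
Proof.
by elim: m Q => [//|m IH] Q [Q0 /IH H] [|i]// im; exact: H.
Qed.

(** The unknowns of the closed system, followed by their parities about [c]: the functions [f], [k]
    and their primed versions are odd, all others even. [u1] and [u2] are absent because they equal
    [f] and [f']. *)
Let state := [:: lam; sig; f; P1; P2; Q1; Q2; k; f'; P1'; P2'; Q1'; Q2'; k'].
Let sgn : seq R := [:: 1; 1; -1; 1; 1; 1; 1; -1; -1; 1; 1; 1; 1; -1].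
Let g (i : 'I_14) := nth lam state i.
Let s (i : 'I_14) := nth 0 sgn i.

(** Derives the parity of a polynomial expression by recursion on its form; for a product the signs
    of the factors are found by trying the four combinations. *)
Ltac par_tac pD pN pM11 pM22 pM12 pM21 :=
  let rec go := lazymatch goal with
  | |- _ _ (fun z => @?A z + @?B z) => apply: (pD _ A B); [go|go]
  | |- _ _ (fun z => - @?A z) => apply: (pN _ A); go
  | |- _ _ (fun z => @?A z * @?B z) =>
      first [solve [apply: (pM11 A B); [go|go]] | solve [apply: (pM22 A B); [go|go]]
           | solve [apply: (pM12 A B); [go|go]] | solve [apply: (pM21 A B); [go|go]]]
  | |- _ => assumption
  end in go.

Lemma point_symmetry v : lam (c + v) = lam (c - v).
Proof.
have [sf sP1 sP2 [sQ1 sQ2 sk]] := killing_smooth K.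
have [sf' sP1' sP2' [sQ1' sQ2' sk']] := killing_smooth K'.
have fc : f c = 0 by rewrite -u1f. have fc' : f' c = 0 by rewrite -u2f.
have [kc kc'] := critical_k.
have sg i : smooth (g i).
  case: i => i Hi; rewrite /g /=; move: i Hi.
  apply: (uptoP (Q := fun i => smooth (nth lam state i))).
  by do ?split.
have gc i : g i c = s i * g i c.
  case: i => i Hi; rewrite /g /s /=; move: i Hi.
  apply: (uptoP (Q := fun i => nth lam state i c = nth 0 sgn i * nth lam state i c)).
  by do ?split; rewrite /= ?fc ?fc' ?kc ?kc' ?mulr0 ?mul1r.
pose par := parity g s c v.
have pg i : par (s i) (g i) by exact: parity_g.
have p_lam : par 1 lam by exact: (pg (@Ordinal 14 0 isT)).
have p_sig : par 1 sig by exact: (pg (@Ordinal 14 1 isT)).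
have p_f : par (-1) f by exact: (pg (@Ordinal 14 2 isT)).
have p_P1 : par 1 P1 by exact: (pg (@Ordinal 14 3 isT)).
have p_P2 : par 1 P2 by exact: (pg (@Ordinal 14 4 isT)).
have p_Q1 : par 1 Q1 by exact: (pg (@Ordinal 14 5 isT)).
have p_Q2 : par 1 Q2 by exact: (pg (@Ordinal 14 6 isT)).
have p_k : par (-1) k by exact: (pg (@Ordinal 14 7 isT)).
have p_f' : par (-1) f' by exact: (pg (@Ordinal 14 8 isT)).
have p_P1' : par 1 P1' by exact: (pg (@Ordinal 14 9 isT)).
have p_P2' : par 1 P2' by exact: (pg (@Ordinal 14 10 isT)).
have p_Q1' : par 1 Q1' by exact: (pg (@Ordinal 14 11 isT)).
have p_Q2' : par 1 Q2' by exact: (pg (@Ordinal 14 12 isT)).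
have p_k' : par (-1) k' by exact: (pg (@Ordinal 14 13 isT)).
have p_u1 : par (-1) u1 by rewrite (_ : u1 = f)//; exact/funext.
have p_u2 : par (-1) u2 by rewrite (_ : u2 = f')//; exact/funext.
have pD a h1 h2 : par a h1 -> par a h2 -> par a (fun z => h1 z + h2 z).
  exact: parityD.
have pZ a b h : par a h -> par a (fun z => b * h z) by exact: parityZ.
have pN a h : par a h -> par a (fun z => - h z).
  move=> /(pZ _ (-1)); congr par; apply/funext => z; exact: mulN1r.
have pM11 h1 h2 : par 1 h1 -> par 1 h2 -> par 1 (fun z => h1 z * h2 z).
  by move=> H1 H2; have := parityM H1 H2; rewrite mulr1.
have pM22 h1 h2 : par (-1) h1 -> par (-1) h2 -> par 1 (fun z => h1 z * h2 z).
  by move=> H1 H2; have := parityM H1 H2; rewrite mulrNN mulr1.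
have pM12 h1 h2 : par 1 h1 -> par (-1) h2 -> par (-1) (fun z => h1 z * h2 z).
  by move=> H1 H2; have := parityM H1 H2; rewrite mul1r.
have pM21 h1 h2 : par (-1) h1 -> par 1 h2 -> par (-1) (fun z => h1 z * h2 z).
  by move=> H1 H2; have := parityM H1 H2; rewrite mulr1.
have pE a (h hx hy : P -> R) : smooth h -> (forall z, 'D_dx h z = hx z) ->
    (forall z, 'D_dy h z = hy z) -> par a hx -> par a hy ->
    par a (fun z => 'D_v h z).
  move=> sh Ex Ey px py.
  have -> : (fun z => 'D_v h z) = fun z => v 0 0 * hx z + v 1 0 * hy z.
    apply/funext => z; rewrite (D_plane v (smooth_diff z sh)) Ex Ey.
    by [].
  by apply: pD; exact: pZ.
have p_2 : par 1 (fun=> 2).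
  split; first exact: (Ck_cst 0 (2 : R)).
  exists 0 => // t _; rewrite mul1r subrr normr0 mul0r //.
(* Each right-hand side of the system has the parity opposite to the function it differentiates:
   this is the invariance under the reflection. *)
have Dg i : par (- s i) (fun z => 'D_v (g i) z).
  case: i => i Hi; rewrite /g /s /=; move: i Hi.
  apply: (uptoP (Q := fun i => par (- nth 0 sgn i) (fun z => 'D_v (nth lam state i) z))).
  rewrite /state /sgn /= !opprK.
  refine (conj _ (conj _ (conj _ (conj _ (conj _ (conj _ (conj _ (conj _ (conj _
    (conj _ (conj _ (conj _ (conj _ (conj _ I)))))))))))))).
  - by apply: (pE _ _ _ _ _ lam_x lam_y) => //;
    par_tac pD pN pM11 pM22 pM12 pM21.
  - by apply: (pE _ _ _ _ _ sig_x sig_y) => //;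
    par_tac pD pN pM11 pM22 pM12 pM21.
  - by apply: (pE _ _ _ _ _ (killing_fx K) (killing_fy K)) => //;
    par_tac pD pN pM11 pM22 pM12 pM21.
  - by apply: (pE _ _ _ _ _ (killing_P1x K) (killing_P1y K)) => //;
    par_tac pD pN pM11 pM22 pM12 pM21.
  - by apply: (pE _ _ _ _ _ (killing_P2x K) (killing_P2y K)) => //;
    par_tac pD pN pM11 pM22 pM12 pM21.
  - by apply: (pE _ _ _ _ _ (killing_Q1x K) (killing_Q1y K)) => //;
    par_tac pD pN pM11 pM22 pM12 pM21.
  - by apply: (pE _ _ _ _ _ (killing_Q2x K) (killing_Q2y K)) => //;
    par_tac pD pN pM11 pM22 pM12 pM21.
  - by apply: (pE _ _ _ _ _ (killing_kx K) (killing_ky K)) => //;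
    par_tac pD pN pM11 pM22 pM12 pM21.
  - by apply: (pE _ _ _ _ _ (killing_fx K') (killing_fy K')) => //;
    par_tac pD pN pM11 pM22 pM12 pM21.
  - by apply: (pE _ _ _ _ _ (killing_P1x K') (killing_P1y K')) => //;
    par_tac pD pN pM11 pM22 pM12 pM21.
  - by apply: (pE _ _ _ _ _ (killing_P2x K') (killing_P2y K')) => //;
    par_tac pD pN pM11 pM22 pM12 pM21.
  - by apply: (pE _ _ _ _ _ (killing_Q1x K') (killing_Q1y K')) => //;
    par_tac pD pN pM11 pM22 pM12 pM21.
  - by apply: (pE _ _ _ _ _ (killing_Q2x K') (killing_Q2y K')) => //;
    par_tac pD pN pM11 pM22 pM12 pM21.
  - by apply: (pE _ _ _ _ _ (killing_kx K') (killing_ky K')) => //;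
    par_tac pD pN pM11 pM22 pM12 pM21.
have := parity_flow sg gc Dg (@Ordinal 14 0 isT).
by rewrite /g /s /= mul1r.
Qed.

End Symmetry.

(** * Principal frames *)

Section Poincare.
Context {R : realType}.
Notation P := 'cV[R]_2.

Lemma prim_zero (g : P -> R) z : (forall z, g z = 0) -> prim g z = 0.
Proof.
move=> g0; have cg : continuous g.
  by have -> : g = cst 0; [exact/funext|exact: (smooth_continuous (smooth_cst (0 : R)))].
have [t _ E] := mvt01 (fun s => prim_is_derive s (z 1 0) cg) 0 (z 0 0).
by move: E; rewrite g0 mulr0 add0r (prim0 _ cg) subr0 -ptE.
Qed.

Lemma prim_periodic (g : P -> R) s t t' : (forall s, g (pt s t) = g (pt s t')) ->
  prim g (pt s t) = prim g (pt s t').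
Proof.
move=> gt; rewrite !prim_pt.
by have -> : (fun s => g (pt s t)) = (fun s => g (pt s t')) by exact/funext.
Qed.

(** [prim a] solves the equation in [x]; closedness makes its error [m] in the other equation depend
    on [y] alone, so one further integration in [y] corrects it. *)
Lemma poincare (a b : P -> R) : smooth a -> smooth b ->
  (forall z, 'D_dy a z = 'D_dx b z) ->
  exists F : P -> R, [/\ smooth F, forall z, 'D_dx F z = a z & forall z, 'D_dy F z = b z].
Proof.
move=> sa sb ab; have sI := smooth_prim sa; have sIy := smooth_D dy sI.
pose m z := b z - 'D_dy (prim a) z.
have sm : smooth m by exact: smoothB.
have mx z : 'D_dx m z = 0.
  apply: etrans (D_B z dx sb sIy) _; rewrite -ab; apply/eqP; rewrite subr_eq0; apply/eqP.
  apply: etrans _ (schwarz z dx dy sI); congr ('D_dy _ z).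
  by apply/funext => y; rewrite prim_dx.
(* Exchanging the coordinates makes [prim], which integrates in [x], integrate in [y]. *)
pose sw (z : P) : P := pt (z 1 0) (z 0 0).
have ssw : smooth sw.
  apply: smooth_mx => i j; rewrite (ord1 j).
  move: i; apply: ord2P.
    rewrite (_ : (fun x => _) = fun x : P => x 1 0); first exact: (smooth_entry 1 0 smooth_id).
    by apply/funext => x; rewrite pt0.
  rewrite (_ : (fun x => _) = fun x : P => x 0 0); first exact: (smooth_entry 0 0 smooth_id).
  by apply/funext => x; rewrite pt1.
have Dsw v z : 'D_v sw z = sw v.
  have De i : 'D_v (fun z : P => z i 0) z = v i 0.
    by have := D_mxE z v i 0 (@smooth_id R P); rewrite derive_id.
  apply: colP2; rewrite (D_mxE z v _ 0 ssw) ?pt0 ?pt1 -De; congr ('D_v _ z).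
    by apply/funext => y; rewrite pt0.
  by apply/funext => y; rewrite pt1.
have Dcomp (h : P -> R) v z : smooth h -> 'D_v (fun z => h (sw z)) z = 'D_(sw v) h (sw z).
  move=> sh; rewrite -(Dsw v z).
  by apply: (D_comp (f := sw) (g := h)); exact: smooth_diff.
have swx : sw dx = dy by apply: colP2; rewrite /sw ?pt0 ?pt1 !mxE.
have swy : sw dy = dx by apply: colP2; rewrite /sw ?pt0 ?pt1 !mxE.
have swK z : sw (sw z) = z by apply: colP2; rewrite /sw ?pt0 ?pt1.
pose g z := m (sw z).
have sg : smooth g by exact: smooth_comp.
have gy z : 'D_dy g z = 0 by rewrite (Dcomp _ _ _ sm) swy mx.
have spg := smooth_prim sg.
have spgs : smooth (fun z => prim g (sw z)) by exact: smooth_comp.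
exists (fun z => prim a z + prim g (sw z)); split; first exact: smoothD.
- move=> z; rewrite (D_D z dx sI spgs) (prim_dx z sa) (Dcomp _ _ _ spg) swx.
  by rewrite (prim_D (sw z) sg).2 !mxE/= mul0r add0r prim_zero ?mulr0 ?addr0.
- move=> z; rewrite (D_D z dy sI spgs) (Dcomp _ _ _ spg) swy.
  by rewrite (prim_dx _ sg) /g swK /m addrC subrK.
Qed.

(** Stokes' theorem on the torus for the form [a dx + b dy], by Rolle's argument alone. As [a] is
    periodic in [y], [prim a] takes the same value at both ends of the side [x = 1], so its
    [y]-derivative vanishes at some [(1, t)]; on [x = 0] it vanishes anyway. At height [t], [m]
    therefore equals [b] at both ends of the horizontal segment, where [b] agrees, and [m_x], the
    curl, vanishes at some point of it. *)
Lemma gauss_bonnet (a b : P -> R) : smooth a -> smooth b ->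
  lattice_periodic a -> lattice_periodic b ->
  ~ (forall z, 'D_dx b z - 'D_dy a z != 0).
Proof.
move=> sa sb pa pb H; have sI := smooth_prim sa; have sIy := smooth_D dy sI.
pose m z := b z - 'D_dy (prim a) z.
have sm : smooth m by exact: smoothB.
have mx z : 'D_dx m z = 'D_dx b z - 'D_dy a z.
  apply: etrans (D_B z dx sb sIy) _; congr (_ - _).
  apply: etrans (esym (schwarz z dx dy sI)) _; congr ('D_dy _ z).
  by apply/funext => y; rewrite prim_dx.
pose e (i : 'I_2) : 'cV[int]_2 := delta_mx i 0.
have perx t : b (pt 1 t) = b (pt 0 t).
  rewrite -(pb (pt 0 t) (e 0)); congr b.
  by apply: colP2; rewrite !mxE/= ?add0r ?addr0.
have pery s : a (pt s 1) = a (pt s 0).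
  rewrite -(pa (pt s 0) (e 1)); congr a.
  by apply: colP2; rewrite !mxE/= ?add0r ?addr0.
have I0 t : 'D_dy (prim a) (pt 0 t) = 0.
  rewrite (prim_D _ sa).2 !mxE/= mul0r add0r mul1r prim0//.
  by apply: smooth_continuous; exact: smooth_D.
have [t _ E] := plane_mvt_y 1 0 1 sI.
move: E; rewrite add0r (prim_periodic 1 pery) subrr mul1r add0r mulr1 => Et.
have [|s _] := @line_mvt _ _ m (pt 0 t) dx; first by move=> z; exact: smooth_diff.
have -> : pt 0 t + dx = pt 1 t by rewrite -{1}(scale1r dx) pt_line add0r.
rewrite /m perx I0 -Et subrr mx => /esym/eqP.
by rewrite (negbTE (H _)).
Qed.

End Poincare.

Section LinearAlgebra.
Context {R : realType}.
Notation P := 'cV[R]_2.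

Lemma plane_span (w1 w2 : P) :
  (forall a b, a *: w1 + b *: w2 = 0 -> a = 0 /\ b = 0) ->
  forall v, exists a b, v = a *: w1 + b *: w2.
Proof.
move=> ind; set d := w1 0 0 * w2 1 0 - w1 1 0 * w2 0 0.
have d0 : d != 0.
  apply/eqP => d0.
  have [|w21 w11] := ind (w2 1 0) (- w1 1 0).
    by apply: colP2; rewrite !mxE; move: d0; rewrite /d; lra.
  have [|w20 w10] := ind (w2 0 0) (- w1 0 0).
    by apply: colP2; rewrite !mxE; move: d0; rewrite /d; lra.
  have [|/eqP] := ind 1 0; last by rewrite oner_eq0.
  by apply: colP2; rewrite !mxE; lra.
move=> v; exists ((v 0 0 * w2 1 0 - v 1 0 * w2 0 0) / d),
  ((w1 0 0 * v 1 0 - w1 1 0 * v 0 0) / d).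
by apply: colP2; rewrite !mxE /d; field.
Qed.

End LinearAlgebra.

(** A bilinear form of the type ['D_v f . 'D_w r] that is symmetric on two basis vectors is
    symmetric on their span; [f1], [f2] and [e1], [e2] stand for the derivatives along the basis. *)
Lemma alt_form (R : realType) m (f1 f2 e1 e2 : 'cV[R]_m) (a b c d : R) :
  dot f1 e2 = dot f2 e1 ->
  dot (c *: f1 + d *: f2) (a *: e1 + b *: e2) =
  dot (a *: f1 + b *: f2) (c *: e1 + d *: e2).
Proof. move=> H; rewrite !dotE_ H; ring. Qed.

Lemma dot_lin2 (R : realType) m (e a b : 'cV[R]_m) (t c d : R) :
  c * dot (t *: e) a + d * dot (t *: e) b = t * dot e (c *: a + d *: b).
Proof. rewrite dotDr !dotZr !dotZl; ring. Qed.

Lemma dot_comb (R : realType) m (f1 f2 X Y e : 'cV[R]_m) (p q a : R) :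
  dot (p *: f1 + a *: X + (q *: f2 + a *: Y)) e =
  p * dot f1 e + a * dot X e + (q * dot f2 e + a * dot Y e).
Proof. by rewrite !dotE_. Qed.

(** * Codazzi's equations and potentials in a principal frame *)

Section Surface.
Context {R : realType}.
Notation P := 'cV[R]_2.
Notation V := 'cV[R]_4.
Variables (r n e1 e2 : P -> V) (w1 w2 : P -> P) (al : P -> R).
Hypotheses (sr : smooth r) (sn : smooth n) (sw1 : smooth w1) (sw2 : smooth w2).
Hypothesis nD : forall x v, dot (n x) ('D_v r x) = 0.
Hypotheses (e1E : forall x, 'D_(w1 x) r x = e1 x) (e2E : forall x, 'D_(w2 x) r x = e2 x).
Hypotheses (e11 : forall x, dot (e1 x) (e1 x) = 1) (e22 : forall x, dot (e2 x) (e2 x) = 1).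

Lemma e1_smooth : smooth e1.
Proof.
have -> : e1 = fun x => 'D_(w1 x) r x by apply/funext => x; rewrite e1E.
exact: smooth_Dfieldmx.
Qed.
Lemma e2_smooth : smooth e2.
Proof.
have -> : e2 = fun x => 'D_(w2 x) r x by apply/funext => x; rewrite e2E.
exact: smooth_Dfieldmx.
Qed.

(** Differentiating [n . 'D_w r = 0] turns the second form into a second derivative of [r], which is
    symmetric. *)
Lemma second_form_sym x v w :
  dot ('D_v n x) ('D_w r x) = dot ('D_w n x) ('D_v r x).
Proof.
have E u u' : dot ('D_u n x) ('D_u' r x) = - dot (n x) ('D_u (fun y => 'D_u' r y) x).
  by apply: (dot_cst_D (c := 0)) => //; exact: smooth_D.
apply: etrans (E v w) (etrans _ (esym (E w v))).
exact: (congr1 (fun u => - dot (n x) u) (schwarzmx x w v sr)).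
Qed.

Lemma basis_expand x : dot (e1 x) (e2 x) = 0 -> forall v,
  v = dot ('D_v r x) (e1 x) *: w1 x + dot ('D_v r x) (e2 x) *: w2 x.
Proof.
move=> e12 v; have dr := smooth_diff x sr.
have L a b : 'D_(a *: w1 x + b *: w2 x) r x = a *: e1 x + b *: e2 x.
  by rewrite (D_dirD _ _ dr) !(D_dirZ _ _ dr) e1E e2E.
have dots a b : dot (a *: e1 x + b *: e2 x) (e1 x) = a /\
    dot (a *: e1 x + b *: e2 x) (e2 x) = b.
  rewrite !dotE_ e11 e22 (dotC (e2 x)) e12; split; ring.
have [|a [b ->]] := @plane_span R (w1 x) (w2 x) _ v.
  move=> a b ab0; have := L a b; rewrite ab0 derive0 => /esym ab.
  by have [+ +] := dots a b; rewrite ab !dot0l => <- <-.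
by rewrite L; have [-> ->] := dots a b.
Qed.

(** The Lie bracket of the principal fields. Its pairings [c1], [c2] with [e1], [e2] carry all that
    is needed of the connection. *)
Let Z x := 'D_(w1 x) w2 x - 'D_(w2 x) w1 x.
Let c1 x := dot (e1 x) ('D_(Z x) r x).
Let c2 x := dot (e2 x) ('D_(Z x) r x).

Lemma Z_smooth : smooth Z.
Proof. by apply: smoothB; exact: smooth_Dfieldmx. Qed.

Lemma commutator_r x : 'D_(w1 x) e2 x - 'D_(w2 x) e1 x = 'D_(Z x) r x.
Proof.
have <- : (fun x => 'D_(w2 x) r x) = e2 by exact/funext.
have <- : (fun x => 'D_(w1 x) r x) = e1 by exact/funext.
exact: commutator.
Qed.

Lemma De1_e1 x v : dot ('D_v e1 x) (e1 x) = 0.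
Proof.
have := dot_cst_D x v e1_smooth e1_smooth e11; rewrite (dotC (e1 x)).
by move: (dot _ _) => a; lra.
Qed.
Lemma De2_e2 x v : dot ('D_v e2 x) (e2 x) = 0.
Proof.
have := dot_cst_D x v e2_smooth e2_smooth e22; rewrite (dotC (e2 x)).
by move: (dot _ _) => a; lra.
Qed.

Lemma D1e2_e1 x : dot ('D_(w1 x) e2 x) (e1 x) = c1 x.
Proof.
have := congr1 (fun u => dot u (e1 x)) (commutator_r x).
rewrite dotDl dotNl De1_e1 subr0 => ->; exact: dotC.
Qed.
Lemma D2e1_e2 x : dot ('D_(w2 x) e1 x) (e2 x) = - c2 x.
Proof.
have := congr1 (fun u => dot u (e2 x)) (commutator_r x).
rewrite dotDl dotNl De2_e2 add0r => /(congr1 -%R); rewrite opprK => ->.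
by rewrite /c2 dotC.
Qed.

Hypotheses (n1E : forall x, 'D_(w1 x) n x = - al x *: e1 x)
  (n2E : forall x, 'D_(w2 x) n x = al x *: e2 x).

Lemma al_smooth : smooth al.
Proof.
have -> : al = fun x => - dot ('D_(w1 x) n x) (e1 x).
  by apply/funext => x; rewrite n1E dotZl e11 mulr1 opprK.
by apply: smoothN; apply: smooth_dot; [exact: smooth_Dfieldmx|exact: e1_smooth].
Qed.

(** Self-adjointness of the shape operator, with eigenvalues [al] and [- al]. The factor [al] stays:
    where it vanishes the two directions may fail to be orthogonal. *)
Lemma principal_orth x : al x * dot (e1 x) (e2 x) = 0.
Proof.
have := second_form_sym x (w1 x) (w2 x).
rewrite e1E e2E n1E n2E !dotZl (dotC (e2 x)); move: (dot _ _) => d; lra.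
Qed.

(* Codazzi's equation: the commutator [Z] of the principal fields, applied to
   [n]. *)
Lemma commutator_n x : 'D_(w1 x) al x *: e2 x + al x *: 'D_(w1 x) e2 x +
  ('D_(w2 x) al x *: e1 x + al x *: 'D_(w2 x) e1 x) = 'D_(Z x) n x.
Proof.
have := commutator x sw1 sw2 sn.
have -> : (fun y => 'D_(w2 y) n y) = fun y => al y *: e2 y by exact/funext.
have -> : (fun y => 'D_(w1 y) n y) = fun y => - (al y *: e1 y).
  by apply/funext => y; rewrite n1E scaleNr.
move=> <-; congr (_ + _); first exact: esym (D_Zl _ _ al_smooth e2_smooth).
apply: etrans (esym (D_Zl _ _ al_smooth e1_smooth)) _.
by rewrite (D_N _ _ (smoothZl al_smooth e1_smooth)) opprK.
Qed.

(** Pair [commutator_n] with [e2] and with [e1]; on the right, [second_form_sym] exchanges [Z] with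
    a principal direction, along which the derivative of [n] is known. *)
Lemma al_derivatives x : al x != 0 -> 'D_(w1 x) al x = 2 * al x * c2 x /\
  'D_(w2 x) al x = - 2 * al x * c1 x.
Proof.
move=> a0; have e12 : dot (e1 x) (e2 x) = 0.
  by have /eqP := principal_orth x; rewrite mulf_eq0 (negbTE a0) => /eqP.
have e21 : dot (e2 x) (e1 x) = 0 by rewrite dotC.
have C := commutator_n x.
have Zn1 : dot ('D_(Z x) n x) (e1 x) = - al x * c1 x.
  by apply: etrans (congr1 _ (esym (e1E x))) _; rewrite second_form_sym n1E dotZl.
have Zn2 : dot ('D_(Z x) n x) (e2 x) = al x * c2 x.
  by apply: etrans (congr1 _ (esym (e2E x))) _; rewrite second_form_sym n2E dotZl.
split.
- have := etrans (esym (dot_comb _ _ _ _ _ _ _ _)) (congr1 (fun u => dot u (e2 x)) C).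
  rewrite Zn2 e22 e12 De2_e2 D2e1_e2.
  by move: ('D_(w1 x) al x) (c2 x) => q c; lra.
- have := etrans (esym (dot_comb _ _ _ _ _ _ _ _)) (congr1 (fun u => dot u (e1 x)) C).
  rewrite Zn1 e11 e21 De1_e1 D1e2_e1.
  by move: ('D_(w2 x) al x) (c1 x) => q c; lra.
Qed.

Hypothesis al_ge0 : forall x, 0 <= al x.

(** Extends [al_derivatives] across the zeros of [al]: there the nonnegative function [al] has a
    minimum and both sides vanish. *)
Lemma D_al x v : 'D_v al x =
  al x * (2 * (dot ('D_v r x) (e1 x) * c2 x - dot ('D_v r x) (e2 x) * c1 x)).
Proof.
have dal := smooth_diff x al_smooth.
have [a0|a0] := eqVneq (al x) 0.
  rewrite a0 mul0r; apply: (local_min_D (b := 1)) => // [y|w _].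
    by apply: smooth_diff; exact: al_smooth.
  by rewrite a0.
have e12 : dot (e1 x) (e2 x) = 0.
  by have /eqP := principal_orth x; rewrite mulf_eq0 (negbTE a0) => /eqP.
have [E1 E2] := al_derivatives a0.
rewrite {1}(basis_expand e12 v) (D_dirD _ _ dal) !(D_dirZ _ _ dal) E1 E2.
by rewrite /GRing.scale/=; ring.
Qed.

(* By [D_al], [al] solves a linear ODE along every line. *)
Lemma al_zero x0 : al x0 = 0 -> forall x, al x = 0.
Proof.
move=> a0 x; set v := x - x0.
pose zeta y := 2 * (dot ('D_v r y) (e1 y) * c2 y - dot ('D_v r y) (e2 y) * c1 y).
have sDr := smooth_D v sr; have s1 := e1_smooth; have s2 := e2_smooth.
have sZr : smooth (fun y => 'D_(Z y) r y) by apply: smooth_Dfieldmx => //; exact: Z_smooth.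
have sz : smooth zeta.
  apply: (smoothM (smooth_cst (2 : R))); apply: smoothB; apply: smoothM; exact: smooth_dot.
have [M M0 HM] := cball_bounded x0 `|v| (smooth_continuous sz).
have E : x0 + 1 *: v = x by rewrite scale1r /v addrC subrK.
rewrite -E; apply: (@gronwall R 1 (fun _ t => al (x0 + t *: v))
  (fun _ t => 'D_v al (x0 + t *: v)) M _ _ _ ord0).
- by move=> _ t; apply: line_is_derive; apply: smooth_diff; exact: al_smooth.
- by move=> _; rewrite scale0r addr0.
- move=> _ t /andP[t0 t1]; rewrite big_ord1 D_al normrM mulrC ler_wpM2r//.
  by apply: HM; rewrite addrC addKr normrZ ger0_norm// ler_piMl.
Qed.

Section Potential.
Hypothesis al_gt0 : forall x, 0 < al x.
Let t x := Num.sqrt (al x).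

Let st : smooth t. Proof. exact: (smooth_sqrt al_gt0 al_smooth). Qed.
Let t0 x : t x != 0. Proof. by rewrite gt_eqF// sqrtr_gt0. Qed.
Let tt x : t x * t x = al x. Proof. by rewrite -expr2 sqr_sqrtr// ltW. Qed.
Let e12 x : dot (e1 x) (e2 x) = 0.
Proof.
by have /eqP := principal_orth x; rewrite mulf_eq0 gt_eqF//= => /eqP.
Qed.

Lemma t_derivatives x : 'D_(w1 x) t x = t x * c2 x /\ 'D_(w2 x) t x = - t x * c1 x.
Proof.
have a0 : al x != 0 by rewrite gt_eqF.
have [E1 E2] := al_derivatives a0.
by rewrite !(D_sqrt _ _ al_gt0 al_smooth) E1 E2 -/(t x) -(tt x); split; field.
Qed.

(** The exterior derivative of the form [f . dr] on the pair [w1], [w2] is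
    ['D_(w1) f . e2 - 'D_(w2) f . e1], since the second derivatives of [r] cancel. *)
Lemma closed_form (f : P -> V) x : smooth f ->
  dot ('D_(w1 x) f x) (e2 x) = dot ('D_(w2 x) f x) (e1 x) ->
  'D_dy (fun y => dot (f y) ('D_dx r y)) x = 'D_dx (fun y => dot (f y) ('D_dy r y)) x.
Proof.
move=> sf H.
apply: etrans (D_dot x dy sf (smooth_D dx sr)) _.
apply: etrans _ (esym (D_dot x dx sf (smooth_D dy sr))).
apply: (fun H1 H2 => congr2 +%R H1 H2); last first.
  exact: (congr1 (dot (f x)) (schwarzmx x dx dy sr)).
have df := smooth_diff x sf; have dr := smooth_diff x sr.
have [a [b Ex]] : exists a b, dx = a *: w1 x + b *: w2 x.
  by do 2 eexists; exact: (basis_expand (e12 x) dx).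
have [c [d Ey]] : exists a b, dy = a *: w1 x + b *: w2 x.
  by do 2 eexists; exact: (basis_expand (e12 x) dy).
have L (g : P -> V) p q : differentiable g x ->
    'D_(p *: w1 x + q *: w2 x) g x = p *: 'D_(w1 x) g x + q *: 'D_(w2 x) g x.
  by move=> dg; rewrite (D_dirD _ _ dg) !(D_dirZ _ _ dg).
rewrite Ex Ey (L f a b df) (L f c d df) (L r a b dr) (L r c d dr) e1E e2E.
exact: alt_form.
Qed.

(** [sqrt al] is an integrating factor: on [w1], [w2] the exterior derivatives of [e1 . dr] and
    [e2 . dr] are [- c1] and [- c2], and the derivatives of [sqrt al] found in [t_derivatives]
    compensate them exactly. *)
Lemma conformal_coordinates : exists Phi : P -> P, smooth Phi /\
  forall x v, ('D_v Phi x) 0 0 = t x * dot (e1 x) ('D_v r x) /\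
              ('D_v Phi x) 1 0 = t x * dot (e2 x) ('D_v r x).
Proof.
have se1 := e1_smooth; have se2 := e2_smooth.
have e21 x : dot (e2 x) (e1 x) = 0 by rewrite dotC.
have pot (e : P -> V) : smooth e ->
    (forall x, dot ('D_(w1 x) (fun y => t y *: e y) x) (e2 x) =
               dot ('D_(w2 x) (fun y => t y *: e y) x) (e1 x)) ->
    exists F : P -> R, smooth F /\ forall x v, 'D_v F x = t x * dot (e x) ('D_v r x).
  move=> se H; have ste := smoothZl st se.
  have sa v : smooth (fun y => dot (t y *: e y) ('D_v r y)).
    by apply: smooth_dot => //; exact: smooth_D.
  have [F [sF Fx Fy]] := poincare (sa dx) (sa dy) (fun x => closed_form ste (H x)).
  exists F; split => // x v.
  apply: etrans (D_plane v (smooth_diff x sF)) _; rewrite Fx Fy.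
  apply: etrans (dot_lin2 _ _ _ _ _ _) _.
  exact: (congr1 (fun u => t x * dot (e x) u) (esym (D_plane v (smooth_diff x sr)))).
have key (e : P -> V) (se : smooth e) x w v : dot ('D_w (fun y => t y *: e y) x) v =
    'D_w t x * dot (e x) v + t x * dot ('D_w e x) v.
  apply: etrans (congr1 (fun u => dot u v) (D_Zl x w st se)) _.
  by rewrite dotDl !dotZl.
have [|F1 [sF1 DF1]] := pot e1 se1.
  move=> x; have [_ E] := t_derivatives x.
  apply: etrans (key e1 se1 x (w1 x) (e2 x)) (etrans _ (esym (key e1 se1 x (w2 x) (e1 x)))).
  rewrite E e11 e12 De1_e1 (dot_cst_D x (w1 x) se1 se2 e12) (dotC (e1 x)) D1e2_e1.
  by move: (c1 x) (t x) => c s; ring.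
have [|F2 [sF2 DF2]] := pot e2 se2.
  move=> x; have [E _] := t_derivatives x.
  apply: etrans (key e2 se2 x (w1 x) (e2 x)) (etrans _ (esym (key e2 se2 x (w2 x) (e1 x)))).
  rewrite E e22 e21 De2_e2 (dot_cst_D x (w2 x) se2 se1 e21) (dotC (e2 x)) D2e1_e2.
  by move: (c2 x) (t x) => c s; ring.
pose Phi x := pt (F1 x) (F2 x).
have sPhi : smooth Phi.
  apply: smooth_mx => i j; rewrite (ord1 j); move: i; apply: ord2P.
    by rewrite (_ : (fun x => _) = F1)//; apply/funext => x; rewrite pt0.
  by rewrite (_ : (fun x => _) = F2)//; apply/funext => x; rewrite pt1.
exists Phi; split => // x v; rewrite !(D_mxE _ _ _ _ sPhi) -DF1 -DF2.
split; congr ('D_v _ x); apply/funext => y; [exact: pt0|exact: pt1].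
Qed.

End Potential.

End Surface.

(** The columns of [W] are an orthonormal basis for the Gram matrix [G], and the trace of a form
    with respect to [G] can be computed in such a basis. *)
Lemma trace_orthonormal (R : realType) m (G H W : 'M[R]_m) :
  W^T *m G *m W = 1%:M -> \tr (invmx G *m H) = \tr (W^T *m H *m W).
Proof.
rewrite -mulmxA => /mulmx1C E; rewrite -mulmxA in E.
have [Gu _] := mulmx1_unit E.
have -> : invmx G = W *m W^T by rewrite -[RHS](mulKmx Gu) E mulmx1.
by rewrite -(mulmxA W) mxtrace_mulC.
Qed.

Lemma dot_bilin2 (R : realType) m (X Y : 'cV[R]_m) (a b c d : R) :
  dot (a *: X + b *: Y) (c *: X + d *: Y) =
  dot X X * (a * c) + dot X Y * (a * d + b * c) + dot Y Y * (b * d).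
Proof. by rewrite !dotE_ (dotC Y X); ring. Qed.

Lemma eq_opp0 (R : realType) (a : R) : a = - a -> a = 0.
Proof. lra. Qed.

(** Up to sign this is the determinant of the coordinates of [dx], [dy] in [w1], [w2]; were it zero,
    eliminating [w1] or [w2] would give linear relations between [dx] and [dy]. *)
Lemma frame_minor_neq0 (R : realType) (w1 w2 : 'cV[R]_2) (a b c d : R) :
  dx = a *: w1 + b *: w2 -> dy = c *: w1 + d *: w2 -> c * b - a * d != 0.
Proof.
move=> Bx By; apply/eqP => k0.
have H1 : d *: dx - b *: dy = (a * d - b * c) *: w1.
  by rewrite Bx By; apply/colP => i; rewrite !mxE; ring.
have H2 : c *: dx - a *: dy = (c * b - a * d) *: w2.
  by rewrite Bx By; apply/colP => i; rewrite !mxE; ring.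
have k1 : a * d - b * c = 0 by lra.
rewrite k1 scale0r in H1; rewrite k0 scale0r in H2.
have b0 : b = 0.
  have := congr1 (fun M : 'cV[R]_2 => M 1 0) H1; rewrite !mxE/=; lra.
have a0 : a = 0.
  have := congr1 (fun M : 'cV[R]_2 => M 1 0) H2; rewrite !mxE/=; lra.
have := congr1 (fun M : 'cV[R]_2 => M 0 0) Bx; rewrite a0 b0 !mxE/=; lra.
Qed.

(** * The case of zero principal curvature *)

Section TotallyGeodesic.
Context {R : realType}.
Notation P := 'cV[R]_2.
Notation V := 'cV[R]_4.
Variables (r n e1 e2 : P -> V) (w1 : P -> P) (g00 g01 g11 : P -> R).
Hypotheses (sr : smooth r) (sn : smooth n) (sw1 : smooth w1).
Hypotheses (pr : lattice_periodic r) (pw1 : lattice_periodic w1).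
Hypotheses (rr : forall x, dot (r x) (r x) = 1) (nn : forall x, dot (n x) (n x) = 1)
  (nr : forall x, dot (n x) (r x) = 0).
Hypothesis nD : forall x v, dot (n x) ('D_v r x) = 0.
Hypothesis imm : forall x v, 'D_v r x = 0 -> v = 0.
Hypotheses (e1E : forall x, 'D_(w1 x) r x = e1 x)
  (e11 : forall x, dot (e1 x) (e1 x) = 1).
Hypothesis n1E : forall x, 'D_(w1 x) n x = 0.
Hypotheses (g00E : forall x, g00 x = dot ('D_dx r x) ('D_dx r x))
  (g01E : forall x, g01 x = dot ('D_dx r x) ('D_dy r x))
  (g11E : forall x, g11 x = dot ('D_dy r x) ('D_dy r x)).
Hypothesis trace0 : forall x,
  \tr (invmx (\matrix_(i, j) dot ('D_(delta_mx i 0) r x) ('D_(delta_mx j 0) r x)) *m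
       (\matrix_(i, j) - dot ('D_(delta_mx i 0) n x) ('D_(delta_mx j 0) r x)) : 'M[R]_2) = 0.

Lemma gram_eval x v w : dot ('D_v r x) ('D_w r x) =
  g00 x * (v 0 0 * w 0 0) + g01 x * (v 0 0 * w 1 0 + v 1 0 * w 0 0) +
  g11 x * (v 1 0 * w 1 0).
Proof.
have dr := smooth_diff x sr.
rewrite g00E g01E g11E.
exact: etrans (congr2 (@dot R 4) (D_plane v dr) (D_plane w dr)) (dot_bilin2 _ _ _ _ _ _).
Qed.

Let Delta x := g00 x * g11 x - g01 x * g01 x.

(** Positivity of the metric on the vector [(- g01, g00)], whose squared length is [g00 * Delta]. *)
Lemma Delta_gt0 x : 0 < Delta x.
Proof.
have dotN0 v : v != 0 -> 0 < dot ('D_v r x) ('D_v r x).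
  move=> v0; rewrite lt_neqAle eq_sym; apply/andP; split.
    by apply: contra v0 => /eqP/dot_eq0/imm/eqP.
  by rewrite dotE; apply: sumr_ge0 => i _; rewrite -expr2 sqr_ge0.
have g0 : 0 < g00 x.
  rewrite g00E; apply: dotN0; apply/eqP => /colP/(_ 0)/eqP.
  by rewrite !mxE/= oner_eq0.
have := dotN0 (pt (- g01 x) (g00 x)); rewrite gram_eval !pt0 !pt1.
rewrite (_ : _ + _ = g00 x * Delta x); last by rewrite /Delta; ring.
rewrite pmulr_rgt0//; apply; apply/eqP => /colP/(_ 1)/eqP.
by rewrite pt1 mxE gt_eqF.
Qed.

(* [w2] is [w1] turned by a right angle. The given second principal field is of
   no use here: where [a = 0] it may be parallel to the first. *)
Let delta x := (Num.sqrt (Delta x))^-1.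
Let xi0 x := - (g01 x * w1 x 0 0 + g11 x * w1 x 1 0).
Let xi1 x := g00 x * w1 x 0 0 + g01 x * w1 x 1 0.
Let w2 x : P := delta x *: pt (xi0 x) (xi1 x).

Hypothesis e2E : forall x, 'D_(w2 x) r x = e2 x.

Lemma metric_smooth : [/\ smooth g00, smooth g01 & smooth g11].
Proof.
have sd u v : smooth (fun x => dot ('D_u r x) ('D_v r x)).
  by apply: smooth_dot; exact: smooth_D.
have E (g : P -> R) u v : (forall x, g x = dot ('D_u r x) ('D_v r x)) -> smooth g.
  by move=> gE; rewrite (_ : g = fun x => dot ('D_u r x) ('D_v r x)); [exact: sd|exact/funext].
by split; [exact: E g00E|exact: E g01E|exact: E g11E].
Qed.

Lemma w2_smooth : smooth w2.
Proof.
have [s0 s1 s2] := metric_smooth.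
have sD : smooth Delta by apply: smoothB; exact: smoothM.
have se i := smooth_entry i 0 sw1.
apply: smoothZl.
  apply: smoothV; last exact: (smooth_sqrt Delta_gt0 sD).
  by move=> x; rewrite gt_eqF// sqrtr_gt0 Delta_gt0.
apply: smooth_mx => i j; rewrite (ord1 j); move: i; apply: ord2P.
  rewrite (_ : (fun x => _) = xi0); last by apply/funext => x; rewrite pt0.
  by apply: smoothN; apply: smoothD; exact: smoothM.
rewrite (_ : (fun x => _) = xi1); last by apply/funext => x; rewrite pt1.
by apply: smoothD; exact: smoothM.
Qed.

Let e12 x : dot (e1 x) (e2 x) = 0.
Proof.
rewrite -e1E -e2E gram_eval !mxE/= -/(xi0 x) -/(xi1 x) /xi0 /xi1; ring.
Qed.

Let e22 x : dot (e2 x) (e2 x) = 1.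
Proof.
have dd : delta x * delta x * Delta x = 1.
  rewrite -invfM -expr2 sqr_sqrtr ?ltW ?Delta_gt0// mulVf// gt_eqF//.
  exact: Delta_gt0.
rewrite -[RHS]mulr1 -{1}dd -(e11 x) -e1E -e2E !gram_eval !mxE/= /xi0 /xi1 /Delta.
by move: (delta x) => d; ring.
Qed.

(** The shape operator kills [w1] by hypothesis; symmetry then kills the mixed entry, and the
    vanishing trace, read in the orthonormal frame, the entry of [w2]. *)
Lemma second_form0 x v w : dot ('D_v n x) ('D_w r x) = 0.
Proof.
have sym := second_form_sym sr sn nD x.
have L (g : P -> V) a b : differentiable g x ->
    'D_(a *: w1 x + b *: w2 x) g x = a *: 'D_(w1 x) g x + b *: 'D_(w2 x) g x.
  move=> dg; apply: etrans (D_dirD _ _ dg) _.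
  exact: (congr2 +%R (D_dirZ a (w1 x) dg) (D_dirZ b (w2 x) dg)).
have n1 u : dot ('D_u n x) (e1 x) = 0 by rewrite -e1E sym n1E dot0l.
have n22 : dot ('D_(w2 x) n x) (e2 x) = 0.
  pose W : 'M[R]_2 := \matrix_(i, j) (if j == 0 then w1 x i 0 else w2 x i 0).
  pose J (f : P -> V) : 'M[R]_(4, 2) := \matrix_(k, i) ('D_(delta_mx i 0) f x) k 0.
  have JW (f : P -> V) k i : differentiable f x ->
      (J f *m W) k i = ('D_(if i == 0 then w1 x else w2 x) f x) k 0.
    move=> df; rewrite (D_basis _ df) summxE mxE; apply: eq_bigr => l _.
    rewrite [RHS]mxE mulrC; congr (_ * _); last by rewrite mxE.
    by rewrite mxE; case: (i == 0).
  have bilin (f h : P -> V) i j : differentiable f x -> differentiable h x ->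
    (W^T *m (\matrix_(k, l) dot ('D_(delta_mx k 0) f x) ('D_(delta_mx l 0) h x)) *m W) i j
    = dot ('D_(if i == 0 then w1 x else w2 x) f x) ('D_(if j == 0 then w1 x else w2 x) h x).
    move=> df dh.
    have -> : \matrix_(k, l) dot ('D_(delta_mx k 0) f x) ('D_(delta_mx l 0) h x) =
        (J f)^T *m J h.
      by apply/matrixP => k l; rewrite !mxE dotE; apply: eq_bigr => q _; rewrite !mxE.
    rewrite mulmxA -trmx_mul -mulmxA mxE dotE; apply: eq_bigr => k _.
    by rewrite mxE (JW f) ?(JW h).
  have dr := smooth_diff x sr; have dn := smooth_diff x sn.
  have WGW : W^T *m (\matrix_(k, l) dot ('D_(delta_mx k 0) r x) ('D_(delta_mx l 0) r x)) *m W
      = 1%:M.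
    have e21 : dot (e2 x) (e1 x) = 0 by rewrite dotC e12.
    apply/matrixP => i j; rewrite (bilin r r i j dr dr) mxE; move: i j.
    apply: ord2P; apply: ord2P; rewrite /= ?e1E ?e2E.
    - exact: e11.
    - exact: e12.
    - exact: e21.
    - exact: e22.
  have := etrans (esym (trace_orthonormal _ WGW)) (trace0 x).
  have -> : (\matrix_(i, j) - dot ('D_(delta_mx i 0) n x) ('D_(delta_mx j 0) r x)) =
      - (\matrix_(i < 2, j < 2) dot ('D_(delta_mx i 0) n x) ('D_(delta_mx j 0) r x)).
    by apply/matrixP => i j; rewrite !mxE.
  rewrite mulmxN mulNmx linearN /= /mxtrace big_ord_recl big_ord1 lift01.
  rewrite (bilin n r 0 0 dn dr) (bilin n r 1 1 dn dr) /= e1E e2E n1E dot0l add0r.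
  by move/eqP; rewrite oppr_eq0 => /eqP.
have n2 u : dot ('D_u n x) (e2 x) = 0.
  have dn := smooth_diff x sn.
  rewrite (basis_expand sr e1E e2E e11 e22 (e12 x) u).
  move: (dot ('D_u r x) (e1 x)) (dot ('D_u r x) (e2 x)) => a b.
  rewrite (L n a b dn) dotDl !dotZl n1E n22 dot0l.
  by rewrite !mulr0 addr0.
have dr := smooth_diff x sr.
rewrite (basis_expand sr e1E e2E e11 e22 (e12 x) w).
move: (dot ('D_w r x) (e1 x)) (dot ('D_w r x) (e2 x)) => a b.
rewrite (L r a b dr) dotDr !dotZr e1E e2E.
by rewrite n1 n2 !mulr0 addr0.
Qed.

(* Gauss-Bonnet for the connection form of the unit frame [(e1, e2)]: the
   curvature is everywhere [1], but the torus has Euler characteristic [0]. *)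
Lemma no_totally_geodesic_torus : False.
Proof.
have sw2 := w2_smooth.
have se1 := e1_smooth sr sw1 e1E; have se2 := e2_smooth sr sw2 e2E.
have [s0 s1 s2] := metric_smooth.
have pDr v := periodic_D v pr.
have pg u v : lattice_periodic (fun x => dot ('D_u r x) ('D_v r x)).
  by move=> x k; exact: (congr2 (@dot R 4) (pDr u x k) (pDr v x k)).
have pg00 : lattice_periodic g00 by move=> x k; rewrite !g00E; exact: pg.
have pg01 : lattice_periodic g01 by move=> x k; rewrite !g01E; exact: pg.
have pg11 : lattice_periodic g11 by move=> x k; rewrite !g11E; exact: pg.
have pw2 : lattice_periodic w2.
  by move=> x k; rewrite /w2 /delta /Delta /xi0 /xi1 pg00 pg01 pg11 pw1.
have pe (w : P -> P) (e : P -> V) : lattice_periodic w -> (forall x, 'D_(w x) r x = e x) ->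
    lattice_periodic e.
  by move=> pw eE x k; rewrite -!eE pw; exact: pDr.
have pe1 := pe _ _ pw1 e1E; have pe2 := pe _ _ pw2 e2E.
have sD u (e e' : P -> V) : smooth e -> smooth e' ->
    smooth (fun x => dot ('D_u e x) (e' x)).
  by move=> se se'; apply: smooth_dot => //; exact: smooth_D.
have pD u : lattice_periodic (fun x => dot ('D_u e1 x) (e2 x)).
  by move=> x k; exact: (congr2 (@dot R 4) (periodic_D u pe1 x k) (pe2 x k)).
have sub_alg (p q s s' : R) : s = s' -> s + p - (s' + q) = p - q.
  by move=> ->; rewrite opprD addrACA subrr add0r.
apply: (gauss_bonnet (sD dx _ _ se1 se2) (sD dy _ _ se1 se2) (pD dx) (pD dy)) => x.
have E1 := D_dot x dx (smooth_D dy se1) se2.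
have E2 := D_dot x dy (smooth_D dx se1) se2.
apply/eqP => E0; move: E0; apply/eqP.
have -> : 'D_dx (fun x => dot ('D_dy e1 x) (e2 x)) x - 'D_dy (fun x => dot ('D_dx e1 x) (e2 x)) x
  = dot ('D_dy e1 x) ('D_dx e2 x) - dot ('D_dx e1 x) ('D_dy e2 x).
  apply: etrans (congr2 (fun a b => a - b) E1 E2) _.
  have S := congr1 (fun u => dot u (e2 x)) (schwarzmx x dx dy se1).
  exact: (sub_alg _ _ _ _ (esym S)).
have rE (e : P -> V) (w : P -> P) : (forall x, 'D_(w x) r x = e x) ->
    forall x, dot (e x) (r x) = 0.
  move=> eE y; rewrite -eE.
  have := etrans (dot_cst_D y (w y) sr sr rr) (congr1 -%R (dotC _ _)).
  exact: eq_opp0.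
have er1 := rE e1 w1 e1E; have er2 := rE e2 w2 e2E.
have en1 y : dot (e1 y) (n y) = 0 by rewrite -e1E; exact: etrans (dotC _ _) (nD _ _).
have en2 y : dot (e2 y) (n y) = 0 by rewrite -e2E; exact: etrans (dotC _ _) (nD _ _).
have rn y : dot (r y) (n y) = 0 by rewrite dotC nr.
have De1r v : dot ('D_v e1 x) (r x) = - dot (e1 x) ('D_v r x).
  exact: dot_cst_D x v se1 sr er1.
have De2r v : dot ('D_v e2 x) (r x) = - dot (e2 x) ('D_v r x).
  exact: dot_cst_D x v se2 sr er2.
have De1n v : dot ('D_v e1 x) (n x) = 0.
  apply: etrans (dot_cst_D x v se1 sn en1) _.
  by rewrite dotC -e1E second_form0 oppr0.
have D11 := De1_e1 sr sw1 e1E e11 x.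
have D22 := De2_e2 sr sw2 e2E e22 x.
(* Gauss' equation: expanded in the frame [e1, e2, r, n], only the [r]-components contribute,
   because [e1], [e2] are unit vectors and [second_form0] removes the normal part. What remains is
   the curvature of the unit sphere. *)
have key v w : dot ('D_v e1 x) ('D_w e2 x) = dot (e1 x) ('D_v r x) * dot (e2 x) ('D_w r x).
  rewrite (parseval4 _ _ (e11 x) (e22 x) (rr x) (nn x) (e12 x) (er1 x) (en1 x)
    (er2 x) (en2 x) (rn x)).
  rewrite D11 D22 De1r De2r De1n mul0r mulr0 mul0r add0r add0r addr0.
  by rewrite mulrNN.
have key' v w : dot ('D_v e1 x) ('D_w e2 x) = dot ('D_v r x) (e1 x) * dot ('D_w r x) (e2 x).
  exact: etrans (key v w) (congr2 *%R (dotC _ _) (dotC _ _)).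
have Bx := basis_expand sr e1E e2E e11 e22 (e12 x) dx.
have By := basis_expand sr e1E e2E e11 e22 (e12 x) dy.
rewrite (key' dy dx) (key' dx dy).
exact: frame_minor_neq0 Bx By.
Qed.

End TotallyGeodesic.

(** * From the torus to its universal cover *)

Section Lifts.
Context {R : realType} (M : Type) (p : 'cV[R]_2 -> M).
Hypothesis torus : is_torus p.

Lemma p_shift x k : p (x + map_mx intr k) = p x.
Proof. by apply/esym/(torus.2 _ _).2; exists k. Qed.

Lemma p_periodic (T : Type) (f : M -> T) : lattice_periodic (f \o p).
Proof. by move=> x k /=; rewrite p_shift. Qed.

Lemma p_lift m : p (Defs.lift p m) = m.
Proof. have [x xm] := torus.1 m; exact: (@xgetPex _ 0 [set x | p x = m] (ex_intro _ x xm)). Qed.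

Lemma lift_p x : exists k, Defs.lift p (p x) = x + map_mx intr k.
Proof. by apply/(torus.2 _ _).1; rewrite p_lift. Qed.

Lemma dif_p (V : normedModType R) (f : M -> V) x w :
  dif p f (p x) w = 'D_w (f \o p) x.
Proof.
rewrite /dif; have [k ->] := lift_p x.
exact: (periodic_D w (p_periodic f)).
Qed.

End Lifts.

Lemma int_vec_small (R : realType) m (k : 'cV[int]_m) :
  `|map_mx intr k : 'cV[R]_m| < 1 -> k = 0.
Proof.
move=> k1; apply/colP => i; rewrite mxE.
have := le_lt_trans (entry_le_norm (map_mx intr k : 'cV[R]_m) i) k1.
by rewrite mxE -intr_norm -[ltRHS]/(1%:~R) ltr_int; case: (k i 0) => [[|?]|?].
Qed.

(** * The dichotomy and the isometries *)

Section SkewMatrices.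
Context {R : realType}.

Definition skew_pos (i : 'I_6) : 'I_4 * 'I_4 :=
  nth (0, 0) [:: (0, 1); (0, 2%:R); (0, 3%:R); (1, 2%:R); (1, 3%:R); (2%:R, 3%:R)] i.

Definition skew_basis (i : 'I_6) : 'M[R]_4 :=
  delta_mx (skew_pos i).1 (skew_pos i).2 - delta_mx (skew_pos i).2 (skew_pos i).1.

Definition skew_mx (c : 'I_6 -> R) : 'M[R]_4 := \sum_i c i *: skew_basis i.

Lemma skew_basisP i : (skew_basis i)^T = - skew_basis i.
Proof. by rewrite /skew_basis linearB /= !trmx_delta opprB. Qed.

Lemma skew_mxP c : (skew_mx c)^T = - skew_mx c.
Proof.
rewrite /skew_mx linear_sum -sumrN; apply: eq_bigr => i _.
by rewrite linearZ /= skew_basisP scalerN.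
Qed.

Lemma skew_mx_eq0 c : skew_mx c = 0 -> forall i, c i = 0.
Proof.
move=> c0 i; have := congr1 (fun A : 'M[R]_4 => A (skew_pos i).1 (skew_pos i).2) c0.
rewrite mxE /skew_mx summxE (bigD1 i)//= big1 ?addr0 => [|j ji].
  rewrite !mxE !eqxx /=; move: i => -[[|[|[|[|[|[|//]]]]]] Hi] /=;
  by rewrite subr0 mulr1.
move: i j ji => -[i Hi] -[j Hj]; rewrite -(inj_eq val_inj) /= !mxE /skew_pos /=.
move: i Hi j Hj => [|[|[|[|[|[|//]]]]]] Hi [|[|[|[|[|[|//]]]]]] Hj //= _;
by rewrite subrr ?mulr0.
Qed.

End SkewMatrices.

Lemma linear_dependence (K : fieldType) (V : lmodType K) m n (b : 'I_n -> V)
    (v : 'I_m -> V) : (n < m)%N ->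
  (forall i, exists c : 'I_n -> K, v i = \sum_j c j *: b j) ->
  exists2 u : 'I_m -> K, (exists i, u i != 0) & \sum_i u i *: v i = 0.
Proof.
move=> nm /choice [c cE].
pose C : 'M[K]_(m, n) := \matrix_(i, j) c i j.
have : kermx C != 0.
  rewrite -mxrank_eq0 mxrank_ker -lt0n subn_gt0.
  exact: leq_ltn_trans (rank_leq_col C) nm.
move=> /rowV0Pn [u /sub_kermxP uC u0].
exists (fun i => u 0 i).
  apply/existsP; apply: contraR u0 => /existsPn H; apply/eqP/rowP => i.
  by rewrite mxE; apply/eqP; have := H i; rewrite negbK.
rewrite (eq_bigr (fun i => \sum_j (u 0 i * c i j) *: b j)) => [|i _].
  rewrite exchange_big big1//= => j _; rewrite -scaler_suml.
  have := congr1 (fun A : 'rV_n => A 0 j) uC; rewrite !mxE => E.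
  rewrite (_ : \sum_i _ = 0) ?scale0r//; apply: etrans _ E.
  by apply: eq_bigr => i _; rewrite mxE.
by rewrite cE scaler_sumr; apply: eq_bigr => j _; rewrite scalerA.
Qed.

Section Dichotomy.
Context {R : realType} (M : Type) (p : 'cV[R]_2 -> M).
Variables (rho N : M -> 'cV[R]_4) (a : M -> R) (W1 W2 : M -> 'cV[R]_2).

Lemma fB_sum m (c : 'I_m -> R) (B : 'I_m -> 'M[R]_4) :
  fB rho N (\sum_i c i *: B i) = \sum_i c i *: (fB rho N (B i) : M -> R).
Proof.
apply/funext => x; rewrite fct_sumE /fB mulmx_suml dot_suml; apply: eq_bigr => i _.
by rewrite -scalemxAl dotZl.
Qed.

Lemma fBZ c B : fB rho N (c *: B) = c *: (fB rho N B : M -> R).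
Proof. by apply/funext => x; rewrite /fB -scalemxAl dotZl. Qed.

Lemma nullity_dichotomy n : natural_nullity p rho N a W1 W2 n -> (n <= 6)%N ->
  (exists B, [/\ B^T = - B, B != 0 & fB rho N B = 0]) \/
  (forall theta, exists2 B, B^T = - B & fB rho N B = htheta p a W1 W2 theta).
Proof.
move=> [b [_ NSE]] n6.
have [H|H] := pselect (exists B, [/\ B^T = - B, B != 0 & fB rho N B = 0]); first by left.
right => theta; set h := htheta p a W1 W2 theta.
(* Seven functions in a space of dimension at most 6; the index [ord_max] carries [h]. *)
pose v (i : 'I_7) : M -> R := if unlift ord_max i is Some j then fB rho N (skew_basis j) else h.
have vNS i : exists c : 'I_n -> R, v i = \sum_j c j *: b j.
  suff : NS p rho N a W1 W2 (v i) by rewrite NSE.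
  rewrite /v; case: unliftP => [j _|_].
    exists (skew_basis j), 0, 0; split; first exact: skew_basisP.
    by rewrite scale0r addr0.
  exists 0, 1, theta; split; first by rewrite /so4/= trmx0 oppr0.
  by rewrite scale1r (_ : fB _ _ 0 = 0) ?add0r//; apply/funext => x; rewrite /fB mul0mx dot0l.
have [u [i ui] uv] := linear_dependence (n6 : (n < 7)%N) vNS.
pose c (j : 'I_6) := u (widen_ord (leqnSn 6) j).
have uE : fB rho N (skew_mx c) + u ord_max *: h = 0.
  move: uv; rewrite big_ord_recr /=.
  rewrite {2}/v unlift_none => <-; congr (_ + _); rewrite fB_sum.
  apply: eq_bigr => j _; congr (_ *: _).
  rewrite /v (_ : widen_ord _ j = lift ord_max j); last first.
    by apply: val_inj => /=; rewrite /bump leqNgt ltn_ord.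
  by rewrite liftK.
(* If the coefficient of [h] vanishes, the relation is among the f_B alone, which was excluded
   above; otherwise it can be solved for [h]. *)
have [um|um] := eqVneq (u ord_max) 0.
  exfalso; apply: H; exists (skew_mx c); split; first exact: skew_mxP.
    apply/eqP => /skew_mx_eq0 c0.
    have := ui; case: (unliftP ord_max i) => [j ->|->]; last by rewrite um eqxx.
    have := c0 j; rewrite /c (_ : widen_ord _ j = lift ord_max j) => [->|]; first by rewrite eqxx.
    by apply: val_inj => /=; rewrite /bump leqNgt ltn_ord.
  by move: uE; rewrite um scale0r addr0.
exists (- (u ord_max)^-1 *: skew_mx c).
  by rewrite linearZ /= skew_mxP scalerN.
move/eqP: uE; rewrite addr_eq0 fBZ => /eqP ->.
by rewrite scalerN scaleNr opprK scalerA mulVf// scale1r.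
Qed.

End Dichotomy.

(** * Motions of the coordinate plane and isometries of the torus *)

Section Motion.
Context {R : realType} (M : Type) (p : 'cV[R]_2 -> M).
Notation P := 'cV[R]_2.
Hypothesis torus : is_torus p.
Variables (rho : M -> 'cV[R]_4) (Phi Psi : P -> P) (lam : P -> R).
Hypotheses (sPhi : smooth Phi) (sPsi : smooth Psi).
Hypotheses (PhiK : cancel Phi Psi) (PsiK : cancel Psi Phi).
Hypothesis pPhi : forall v, lattice_periodic (fun x => 'D_v Phi x).
Hypothesis conformal : forall x v w, metric p rho (p x) v w =
  lam (Phi x) * dot ('D_v Phi x) ('D_w Phi x).

(** The difference has derivative 0 because ['D_v Phi] is periodic. Thus [Phi] carries a lattice
    translation to a translation. *)
Lemma Phi_shift (k : 'cV[int]_2) x y :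
  Phi (x + map_mx intr k) - Phi x = Phi (y + map_mx intr k) - Phi y.
Proof.
have sh (i : 'I_2) : smooth (fun x => Phi x i 0) by exact: smooth_entry.
apply/colP => i.
have ss : smooth (fun x => Phi (x + map_mx intr k) i 0 - Phi x i 0).
  by apply: smoothB => //; exact: (smooth_shift _ (sh i)).
have := D0_cst ss _ x y; rewrite !mxE; apply => z v.
apply: etrans (D_B z v (smooth_shift _ (sh i)) (sh i)) _.
apply/eqP; rewrite subr_eq0; apply/eqP.
apply: etrans (D_shift (fun x => Phi x i 0) _ z v) _.
apply: etrans (esym (D_mxE _ v i 0 sPhi)) (etrans _ (D_mxE z v i 0 sPhi)).
exact: (congr1 (fun u : P => u i 0) (pPhi v z k)).
Qed.

(** In the coordinate [z = Phi x] this is [z -> e z + b]: a translation for [e = 1], a reflection in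
    a point for [e = -1]. *)
Let motion (e : R) (b : P) x := Psi (e *: Phi x + b).

Lemma motion_smooth e b : smooth (motion e b).
Proof.
apply: smooth_compmx => //; apply: smoothD; last exact: (smooth_cst b).
exact: smoothZ.
Qed.

(** A translation of the coordinate plane commutes with the lattice translations and a point
    reflection inverts them, so [k'] is [k] or [- k]. Hence the motion descends to [M]. *)
Lemma motion_shift e b x (k : 'cV[int]_2) : e = 1 \/ e = -1 ->
  exists k', motion e b (x + map_mx intr k) = motion e b x + map_mx intr k'.
Proof.
move=> e1; set y := motion e b x.
have yE : Phi y = e *: Phi x + b by rewrite /y /motion PsiK.
case: e1 => eE.
  exists k; rewrite /motion -[RHS]PhiK; congr Psi.
  rewrite -[RHS](subrK (Phi y)) (Phi_shift k y x) yE eE !scale1r addrA subrK //.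
exists (- k); rewrite /motion -[RHS]PhiK; congr Psi.
have mE : map_mx intr (- k) = - map_mx intr k :> P by exact: raddfN.
have := Phi_shift k (y + map_mx intr (- k)) x.
rewrite mE subrK => E.
have -> : Phi (y - map_mx intr k) = Phi y - (Phi (x + map_mx intr k) - Phi x).
  by rewrite -E subKr.
by rewrite yE eE !scaleN1r; apply/colP => i; rewrite !mxE; ring.
Qed.

Lemma motionK e b : e * e = 1 -> cancel (motion e b) (motion e (- (e *: b))).
Proof.
by move=> ee x; rewrite /motion PsiK scalerDr scalerA ee scale1r addrK PhiK.
Qed.

(* A displacement smaller than [1] is not a nonzero vector of the lattice, so
   that the induced map of [M] is not the identity. *)
Lemma motion_isometry e b : e = 1 \/ e = -1 ->
  (forall z, lam (e *: z + b) = lam z) ->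
  (exists z, e *: z + b != z /\ `|Psi (e *: z + b) - Psi z| < 1) ->
  exists2 phi : M -> M, isometries p rho phi & phi <> id.
Proof.
move=> e1 lamE [z0 [z0N z0lt]].
have ee : e * e = 1 by case: e1 => ->; rewrite ?mulrNN mulr1.
set F := motion e b; set b' := - (e *: b); set G := motion e b'.
have GF : cancel F G by exact: motionK.
have FG : cancel G F.
  have := @motionK e b' ee; rewrite (_ : - (e *: b') = b)//.
  by rewrite /b' scalerN opprK scalerA ee scale1r.
have desc c x : p (motion e c (Defs.lift p (p x))) = p (motion e c x).
  have [k ->] := lift_p torus x; have [k' ->] := motion_shift c x k e1.
  exact: p_shift.
pose phi m := p (F (Defs.lift p m)); pose psi m := p (G (Defs.lift p m)).
have phiE x : phi (p x) = p (F x) by exact: desc.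
have psiE x : psi (p x) = p (G x) by exact: desc.
have sF : smooth_lift p phi F by split; [exact: motion_smooth|move=> x; rewrite phiE].
exists phi.
  split.
    exists psi; split.
    - by move=> m; rewrite /phi psiE GF p_lift.
    - by move=> m; rewrite /psi phiE FG p_lift.
    - by exists F.
    - by exists G; split; [exact: motion_smooth|move=> x; rewrite psiE].
  exists F; first exact: sF.
  move=> x v w.
  apply: etrans (conformal (F x) _ _) (etrans _ (esym (conformal x v w))).
  have DF u : 'D_('D_u F x) Phi (F x) = e *: 'D_u Phi x.
    apply: etrans (esym (D_comp _ (smooth_diff x (motion_smooth e b)) (smooth_diff _ sPhi))) _.
    rewrite (_ : (fun y => Phi _) = fun y => e *: Phi y + b); last first.
      by apply/funext => y; rewrite /motion PsiK.
    apply: etrans (D_D _ _ (smoothZ e sPhi) (smooth_cst b)) _.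
    rewrite derive_cst addr0; exact: D_Z.
  have lamF : lam (Phi (F x)) = lam (Phi x) by rewrite /F /motion PsiK lamE.
  apply: (congr2 *%R lamF); apply: etrans (congr2 (@dot R 2) (DF v) (DF w)) _.
  by rewrite dotZl dotZr mulrA ee mul1r.
move=> phi_id; have := phiE (Psi z0); rewrite phi_id /= => /(torus.2 _ _).1 [k].
rewrite /F /motion PsiK => kE; have : k = 0.
  by apply: (@int_vec_small R); move: z0lt; rewrite kE addrC addKr.
move=> k0; move: kE; rewrite k0 (_ : map_mx intr 0 = 0 :> P) ?addr0; last exact: raddf0.
by move=> /(can_inj PsiK) /eqP; rewrite (negbTE z0N).
Qed.

End Motion.

Section Existence.
Context {R : realType} (M : Type) (p : 'cV[R]_2 -> M).
Notation P := 'cV[R]_2.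
Hypothesis torus : is_torus p.
Variables (rho : M -> 'cV[R]_4) (Phi Psi : P -> P) (lam : P -> R).
Hypotheses (sPhi : smooth Phi) (sPsi : smooth Psi).
Hypotheses (PhiK : cancel Phi Psi) (PsiK : cancel Psi Phi).
Hypothesis pPhi : forall v, lattice_periodic (fun x => 'D_v Phi x).
Hypothesis conformal : forall x v w, metric p rho (p x) v w =
  lam (Phi x) * dot ('D_v Phi x) ('D_w Phi x).

(** One half, because a reflection in [c] takes [c + s u] to [c - s u]: the displacements of both
    from [c] then add up to less than 1. *)
Lemma Psi_close z u : u != 0 -> exists t : R, 0 < t /\ forall s, `|s| <= t ->
  `|Psi (z + s *: u) - Psi z| < 2^-1.
Proof.
move=> u0; have h0 : 0 < (2^-1 : R) by rewrite invr_gt0.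
have [d d0 Hd] := (continuous_epsP Psi).1 (smooth_continuous sPsi) z _ h0.
have u1 : 0 < `|u| by rewrite normr_gt0.
exists (d / (2 * `|u|)); split; first by rewrite divr_gt0// mulr_gt0.
move=> s st; rewrite distrC; apply: Hd; rewrite opprD addrA subrr sub0r normrN normrZ.
apply: (@le_lt_trans _ _ (d / (2 * `|u|) * `|u|)); first exact: ler_wpM2r.
rewrite invfM mulrA divfK ?gt_eqF// ltr_pdivrMr// ltr_pMr//; lra.
Qed.

Lemma translation_isometry T : T != 0 -> (forall z t, lam (z + t *: T) = lam z) ->
  exists2 phi : M -> M, isometries p rho phi & phi <> id.
Proof.
move=> T0 H; have [t [t0 Ht]] := Psi_close 0 T0.
apply: (motion_isometry torus sPhi sPsi PhiK PsiK pPhi conformal (e := 1) (b := t *: T)).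
- by left.
- by move=> z; rewrite scale1r.
- exists 0; rewrite scale1r; split; first by rewrite add0r scaler_eq0 gt_eqF.
  have tt : `|t| <= t by rewrite ger0_norm// ltW.
  by have /lt_trans := Ht t tt; apply; lra.
Qed.

Lemma reflection_isometry c : (forall v, lam (c + v) = lam (c - v)) ->
  exists2 phi : M -> M, isometries p rho phi & phi <> id.
Proof.
move=> H.
have dx0 : dx != 0 :> P.
  by apply/eqP => /colP/(_ 0)/eqP; rewrite !mxE/= oner_eq0.
have [t [t0 Ht]] := Psi_close c dx0.
(* [z -> - z + 2 c] is the reflection in [c]; it takes [c + t dx] to [c - t dx]. *)
apply: (motion_isometry torus sPhi sPsi PhiK PsiK pPhi conformal (e := -1) (b := c + c)).
- by right.
- move=> z; rewrite scaleN1r (_ : - z + (c + c) = c - (z - c)); last first.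
    by apply/colP => i; rewrite !mxE; ring.
  by rewrite -H addrC subrK.
- exists (c + t *: dx); rewrite scaleN1r.
  have -> : - (c + t *: dx) + (c + c) = c + (- t) *: dx.
    by apply/colP => i; rewrite !mxE; ring.
  split.
    rewrite (inj_eq (addrI c)) -subr_eq0 -scalerBl scaler_eq0 (negbTE dx0) orbF.
    by rewrite -opprD oppr_eq0 -mulr2n mulrn_eq0/= gt_eqF.
  have tt : `|t| <= t by rewrite ger0_norm// ltW.
  have tt' : `|- t| <= t by rewrite normrN.
  have -> : Psi (c + - t *: dx) - Psi (c + t *: dx) =
      (Psi (c + - t *: dx) - Psi c) - (Psi (c + t *: dx) - Psi c).
    by rewrite opprB addrA subrK.
  apply: le_lt_trans (ler_normB _ _) _.
  by apply: lt_le_trans (ltrD (Ht _ tt') (Ht _ tt)) _; lra.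
Qed.

End Existence.

Lemma powR_N3_2 (R : realType) (a : R) : 0 < a ->
  a `^ (- (3 / 2)) = (Num.sqrt a)^-1 ^+ 3.
Proof.
move=> a0; rewrite powRN (mulrC 3) powRrM powR12_sqrt ?ltW//.
by rewrite powR_mulrn ?sqrtr_ge0// exprVn.
Qed.

Lemma dot_conformal (R : realType) (a b c d l : R) (p q : 'cV[R]_4) :
  dot p p = l -> dot q q = l -> dot p q = 0 ->
  dot (a *: p + b *: q) (c *: p + d *: q) = l * (a * c + b * d).
Proof. by move=> pp qq pq; rewrite !dotE_ (dotC q) pp qq pq; ring. Qed.

(** * Conformal coordinates on the universal cover *)

Section Uniformization.
Context {R : realType}.
Notation P := 'cV[R]_2.
Notation V := 'cV[R]_4.
Variables (r n e1 e2 : P -> V) (w1 w2 : P -> P) (al : P -> R).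
Hypotheses (sr : smooth r) (sn : smooth n) (sw1 : smooth w1) (sw2 : smooth w2).
Hypotheses (pr : lattice_periodic r) (pw1 : lattice_periodic w1)
  (pw2 : lattice_periodic w2) (pal : lattice_periodic al).
Hypotheses (rr : forall x, dot (r x) (r x) = 1) (nn : forall x, dot (n x) (n x) = 1)
  (nr : forall x, dot (n x) (r x) = 0).
Hypothesis nD : forall x v, dot (n x) ('D_v r x) = 0.
Hypotheses (e1E : forall x, 'D_(w1 x) r x = e1 x) (e2E : forall x, 'D_(w2 x) r x = e2 x).
Hypotheses (e11 : forall x, dot (e1 x) (e1 x) = 1) (e22 : forall x, dot (e2 x) (e2 x) = 1).
Hypotheses (n1E : forall x, 'D_(w1 x) n x = - al x *: e1 x)
  (n2E : forall x, 'D_(w2 x) n x = al x *: e2 x).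
Hypothesis al_gt0 : forall x, 0 < al x.

Let t (x : P) : R := Num.sqrt (al x).
Let h1 (x : P) : R := al x `^ (- (3 / 2)) * 'D_(w1 x) al x.
Let h2 (x : P) : R := al x `^ (- (3 / 2)) * 'D_(w2 x) al x.

Lemma frame_orth x : dot (e1 x) (e2 x) = 0.
Proof.
have /eqP := principal_orth sr sn nD e1E e2E n1E n2E x.
by rewrite mulf_eq0 gt_eqF//= => /eqP.
Qed.

Lemma uniformization : exists Phi Psi : P -> P, exists lam : P -> R,
  [/\ [/\ smooth Phi, smooth Psi, cancel Phi Psi & cancel Psi Phi],
      forall v, lattice_periodic (fun x => 'D_v Phi x),
      forall x v w, dot ('D_v r x) ('D_w r x) = lam (Phi x) * dot ('D_v Phi x) ('D_w Phi x),
      forall B, B^T = - B -> B != 0 -> (forall x, dot (B *m r x) (n x) = 0) ->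
        exists2 T : P, T != 0 & forall z s, lam (z + s *: T) = lam z
    & forall B1 B2, B1^T = - B1 -> B2^T = - B2 ->
        (forall x, dot (B1 *m r x) (n x) = h1 x) ->
        (forall x, dot (B2 *m r x) (n x) = h2 x) ->
        exists c, forall v, lam (c + v) = lam (c - v)].
Proof.
have sal : smooth al by exact: (al_smooth sr sn sw1 e1E e11 n1E).
have al_ge0 x : 0 <= al x by rewrite ltW.
have st : smooth t by exact: smooth_sqrt.
have t_gt0 x : 0 < t x by rewrite sqrtr_gt0.
have t0 x : t x != 0 by rewrite gt_eqF.
have tt x : t x * t x = al x by rewrite -expr2 sqr_sqrtr// ltW.
have al0 x : al x != 0 by rewrite gt_eqF.
have se1 := e1_smooth sr sw1 e1E; have se2 := e2_smooth sr sw2 e2E.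
have e12 := frame_orth.
have e21 x : dot (e2 x) (e1 x) = 0 by rewrite dotC.
have stV : smooth (fun x => (t x)^-1) by exact: smoothV.
have [Phi [sPhi DPhi]] :=
  conformal_coordinates sr sn sw1 sw2 nD e1E e2E e11 e22 n1E n2E al_ge0 al_gt0.
(* The frame dual to the two components of d[Phi]; it is periodic, as [Phi_inverse] requires. *)
pose X0 (x : P) : P := (t x)^-1 *: w1 x; pose X1 x := (t x)^-1 *: w2 x.
have sX0 : smooth X0 by exact: smoothZl.
have sX1 : smooth X1 by exact: smoothZl.
have pt_ : lattice_periodic t by move=> x k; rewrite /t pal.
have pX0 : lattice_periodic X0 by move=> x k; rewrite /X0 pt_ pw1.
have pX1 : lattice_periodic X1 by move=> x k; rewrite /X1 pt_ pw2.
have pe1 : lattice_periodic e1.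
  by move=> x k; rewrite -!e1E pw1; exact: (periodic_D (w1 x) pr).
have pe2 : lattice_periodic e2.
  by move=> x k; rewrite -!e2E pw2; exact: (periodic_D (w2 x) pr).
have pPhi v : lattice_periodic (fun x => 'D_v Phi x).
  move=> x k; have [E0 E1] := DPhi (x + map_mx intr k) v; have [E0' E1'] := DPhi x v.
  have Dr := periodic_D v pr x k.
  apply: colP2.
    apply: etrans E0 (etrans _ (esym E0')).
    exact: (congr2 *%R (pt_ x k) (congr2 (@dot R 4) (pe1 x k) Dr)).
  apply: etrans E1 (etrans _ (esym E1')).
  exact: (congr2 *%R (pt_ x k) (congr2 (@dot R 4) (pe2 x k) Dr)).
have cancel_t x (d : R) (w : P) : d *: w = (t x * d) *: ((t x)^-1 *: w).
  by rewrite scalerA mulrAC divff// mul1r.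
have PhiX x v : v = ('D_v Phi x) 0 0 *: X0 x + ('D_v Phi x) 1 0 *: X1 x.
  have [E0 E1] := DPhi x v.
  have E (u : V) (w : P) : (t x * dot u ('D_v r x)) *: ((t x)^-1 *: w) = dot ('D_v r x) u *: w.
    by apply: etrans (esym (cancel_t x _ w)) _; rewrite (dotC u).
  apply: etrans (basis_expand sr e1E e2E e11 e22 (e12 x) v) _.
  apply: congr2.
    apply: etrans (esym (E (e1 x) (w1 x))) _; rewrite /X0.
    exact: (congr1 (fun d : R => d *: ((t x)^-1 *: w1 x : P)) (esym E0)).
  apply: etrans (esym (E (e2 x) (w2 x))) _; rewrite /X1.
  exact: (congr1 (fun d : R => d *: ((t x)^-1 *: w2 x : P)) (esym E1)).
have DX0 x : 'D_(X0 x) r x = (t x)^-1 *: e1 x.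
  by apply: etrans (D_dirZ _ _ (smooth_diff x sr)) _; rewrite e1E.
have DX1 x : 'D_(X1 x) r x = (t x)^-1 *: e2 x.
  by apply: etrans (D_dirZ _ _ (smooth_diff x sr)) _; rewrite e2E.
have [dx0 dx1] : (dx : P) 0 0 = 1 /\ (dx : P) 1 0 = 0 by split; rewrite !mxE.
have [dy0 dy1] : (dy : P) 0 0 = 0 /\ (dy : P) 1 0 = 1 by split; rewrite !mxE.
have PhiX0 x : 'D_(X0 x) Phi x = dx.
  have [E0 E1] := DPhi x (X0 x); apply: colP2.
    by apply: etrans E0 _; rewrite DX0 dotZr e11 mulr1 dx0; exact: (divff (t0 x)).
  by apply: etrans E1 _; rewrite DX0 dotZr e21 dx1; move: (t x) => q; ring.
have PhiX1 x : 'D_(X1 x) Phi x = dy.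
  have [E0 E1] := DPhi x (X1 x); apply: colP2.
    by apply: etrans E0 _; rewrite DX1 dotZr e12 dy0; move: (t x) => q; ring.
  by apply: etrans E1 _; rewrite DX1 dotZr e22 mulr1 dy1; exact: (divff (t0 x)).
have [Psi [PhiK PsiK sPsi DPsi]] :=
  Phi_inverse sPhi sX0 sX1 pX0 pX1 pPhi PhiX PhiX0 PhiX1.
have DPx z : 'D_dx Psi z = X0 (Psi z).
  by rewrite DPsi dx0 dx1 scale1r scale0r addr0.
have DPy z : 'D_dy Psi z = X1 (Psi z).
  by rewrite DPsi dy0 dy1 scale1r scale0r add0r.
pose lam (z : P) : R := (al (Psi z))^-1; pose sig (z : P) : R := al (Psi z).
have lam0 z : lam z != 0 by rewrite invr_neq0.
have sig0 z : sig z != 0 by rewrite al0.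
have ss : smooth sig by exact: (smooth_comp sPsi sal).
have sl : smooth lam by exact: smoothV.
(* The logarithmic [x]-derivative of [lam = 1 / al] is that along [w1 / t], namely [- al ^ (-3/2)]
   times ['D_(w1) al], which is [- h1]; [u1] is half of it, and likewise [u2]. *)
pose u1 (z : P) : R := - 2^-1 * h1 (Psi z); pose u2 (z : P) : R := - 2^-1 * h2 (Psi z).
have h1E x : h1 x = (t x)^-1 ^+ 3 * 'D_(w1 x) al x by rewrite /h1 powR_N3_2.
have h2E x : h2 x = (t x)^-1 ^+ 3 * 'D_(w2 x) al x by rewrite /h2 powR_N3_2.
have dal x := smooth_diff x sal.
have Dsx z : 'D_dx sig z = (t (Psi z))^-1 * 'D_(w1 (Psi z)) al (Psi z).
  apply: etrans (D_comp dx (smooth_diff z sPsi) (dal _)) _.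
  by rewrite DPx; exact: D_dirZ.
have Dsy z : 'D_dy sig z = (t (Psi z))^-1 * 'D_(w2 (Psi z)) al (Psi z).
  apply: etrans (D_comp dy (smooth_diff z sPsi) (dal _)) _.
  by rewrite DPy; exact: D_dirZ.
have lam_x z : 'D_dx lam z = 2 * u1 z * lam z.
  rewrite (D_V z dx sig0 ss) Dsx /u1 h1E /lam /sig -tt.
  by move: ('D_(w1 (Psi z)) al (Psi z)) => q; field; exact: t0.
have lam_y z : 'D_dy lam z = 2 * u2 z * lam z.
  rewrite (D_V z dy sig0 ss) Dsy /u2 h2E /lam /sig -tt.
  by move: ('D_(w2 (Psi z)) al (Psi z)) => q; field; exact: t0.
pose rh (z : P) : V := r (Psi z); pose nh (z : P) : V := n (Psi z).
pose r1 (z : P) : V := (t (Psi z))^-1 *: e1 (Psi z).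
pose r2 (z : P) : V := (t (Psi z))^-1 *: e2 (Psi z).
have srh : smooth rh by exact: smooth_compmx.
have snh : smooth nh by exact: smooth_compmx.
have sr1 : smooth r1.
  by exact: (smooth_compmx (g := fun x => (t x)^-1 *: e1 x) sPsi (smoothZl stV se1)).
have sr2 : smooth r2.
  by exact: (smooth_compmx (g := fun x => (t x)^-1 *: e2 x) sPsi (smoothZl stV se2)).
have r1E z : 'D_dx rh z = r1 z.
  by apply: etrans (D_comp dx (smooth_diff z sPsi) (smooth_diff _ sr)) _; rewrite DPx DX0.
have r2E z : 'D_dy rh z = r2 z.
  by apply: etrans (D_comp dy (smooth_diff z sPsi) (smooth_diff _ sr)) _; rewrite DPy DX1.
have nh1 z : 'D_dx nh z = - sig z *: r1 z.
  apply: etrans (D_comp dx (smooth_diff z sPsi) (smooth_diff _ sn)) _; rewrite DPx.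
  apply: etrans (D_dirZ _ _ (smooth_diff _ sn)) _.
  by rewrite n1E /r1 !scalerA mulrC.
have nh2 z : 'D_dy nh z = sig z *: r2 z.
  apply: etrans (D_comp dy (smooth_diff z sPsi) (smooth_diff _ sn)) _; rewrite DPy.
  apply: etrans (D_dirZ _ _ (smooth_diff _ sn)) _.
  by rewrite n2E /r2 !scalerA mulrC.
have ttV x : (t x)^-1 * (t x)^-1 = (al x)^-1 by rewrite -invfM tt.
have lam_gt0 z : 0 < lam z by rewrite invr_gt0.
have sigE z : sig z = (lam z)^-1 by rewrite invrK.
have hr1 z : dot (nh z) (r1 z) = 0 by rewrite -r1E; rewrite r1E dotZr -e1E nD mulr0.
have hr2 z : dot (nh z) (r2 z) = 0 by rewrite dotZr -e2E nD mulr0.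
have r11E z : dot (r1 z) (r1 z) = lam z by rewrite dotZl dotZr e11 mulr1 ttV.
have r22E z : dot (r2 z) (r2 z) = lam z by rewrite dotZl dotZr e22 mulr1 ttV.
have r12E z : dot (r1 z) (r2 z) = 0 by rewrite dotZl dotZr e12 !mulr0.
have rrh z : dot (rh z) (rh z) = 1 by exact: rr.
have nnh z : dot (nh z) (nh z) = 1 by exact: nn.
have nrh z : dot (nh z) (rh z) = 0 by exact: nr.
have sigx := sig_x sl lam_gt0 sigE lam_x.
have sigy := sig_y sl lam_gt0 sigE lam_y.
have r11 := r11_eq srh snh sl lam_gt0 r1E r2E sigE lam_x lam_y rrh nnh nrh hr1 hr2
  r11E r22E r12E nh1 nh2.
have r12 := r12_eq srh snh sl lam_gt0 r1E r2E sigE lam_x lam_y nh1 nh2.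
have r21 := r21_eq srh snh sl lam_gt0 r1E r2E sigE lam_x lam_y nh1 nh2.
have r22 := r22_eq srh snh sl lam_gt0 r1E r2E sigE lam_x lam_y rrh nnh nrh hr1 hr2
  r11E r22E r12E nh1 nh2.
have K B (BT : B^T = - B) :=
  killing_of_skew srh snh sr1 sr2 r1E r2E nh1 nh2 r11 r12 r21 r22 BT.
exists Phi, Psi, lam; split=> //.
- move=> x v w.
  have E u : 'D_u r x = ('D_u Phi x) 0 0 *: r1 (Phi x) + ('D_u Phi x) 1 0 *: r2 (Phi x).
    rewrite {1}(PhiX x u) /r1 /r2 PhiK -DX0 -DX1.
    apply: etrans (D_dirD _ _ (smooth_diff x sr)) _.
    by congr (_ + _); apply: D_dirZ; exact: smooth_diff.
  rewrite (E v) (E w) (dotE ('D_v Phi x)) big_ord_recl big_ord1 lift01.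
  exact: dot_conformal (r11E _) (r22E _) (r12E _).
- move=> B BT B0 fB0.
  apply: (killing_translation sl ss sig0 lam_x lam_y sigx sigy (K B BT)).
    by move=> z; exact: fB0.
  (* Were all pairings zero at one point, [B] would kill the frame there, which spans the space, and
     so [B] would be 0. *)
  exists 0 => -[p1 p2 q1 q2 k0]; move/eqP: B0; apply.
  have f0 : dot (B *m rh 0) (nh 0) = 0 by exact: fB0.
  have fv := frame_vec srh lam_gt0 r1E r2E sigE rrh nnh nrh hr1 hr2 r11E r22E r12E 0.
  have sk u v := dot_skew u v BT; have sk0 u := dot_skew0 u BT.
  have Br : B *m rh 0 = 0.
    by apply: etrans (fv _) _; rewrite sk0 f0 p1 p2 !mulr0 !scale0r !addr0.
  have Bn : B *m nh 0 = 0.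
    by apply: etrans (fv _) _; rewrite sk0 q1 q2 sk f0 oppr0 !mulr0 !scale0r !addr0.
  have B1 : B *m r1 0 = 0.
    apply: etrans (fv _) _.
    by rewrite sk0 k0 (sk _ (rh 0)) (sk _ (nh 0)) p1 q1 oppr0 !mulr0 !scale0r !addr0.
  have B2 : B *m r2 0 = 0.
    apply: etrans (fv _) _.
    by rewrite sk0 (sk _ (r1 0)) (sk _ (rh 0)) (sk _ (nh 0)) p2 q2 k0 oppr0 !mulr0
      !scale0r !addr0.
  have BX (X : V) : B *m X = 0.
    move: fv Br Bn B1 B2; move: (rh 0) (nh 0) (r1 0) (r2 0) => a b c d fv Ba Bb Bc Bd.
    rewrite (fv X) !mulmxDr -!scalemxAr Ba Bb Bc Bd.
    by rewrite !scaler0 !addr0.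
  apply/matrixP => i j; have := congr1 (fun u : V => u i 0) (BX (delta_mx j 0)).
  by rewrite -colE !mxE.
- move=> B1 B2 B1T B2T f1 f2.
  (* The given matrices represent [h1] and [h2]; the factor - 1 / 2 rescales them to represent [u1]
     and [u2]. *)
  have skZ B : B^T = - B -> (- 2^-1 *: B : 'M[R]_4)^T = - (- 2^-1 *: B).
    by move=> BT; rewrite linearZ/= BT scalerN.
  (* A maximum of [al], which exists by periodicity, supplies the critical point where [u1] and [u2]
     vanish. *)
  have [x0 x0max] := periodic_max (smooth_continuous sal) pal.
  have al_c v : 'D_v al x0 = 0 by exact: (global_max_D v sal x0max).
  exists (Phi x0).
  apply: (point_symmetry sl ss lam0 sig0 lam_x lam_y sigx sigy
    (K _ (skZ _ B1T)) (K _ (skZ _ B2T))).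
  + by move=> z; rewrite -scalemxAl dotZl /u1 -f1.
  + by move=> z; rewrite -scalemxAl dotZl /u2 -f2.
  + by rewrite /u1 PhiK /h1 al_c !mulr0.
  + by rewrite /u2 PhiK /h2 al_c !mulr0.
Qed.

End Uniformization.

Theorem theorem5p11 (R : realType) (M : Type) (p : 'cV[R]_2 -> M)
    (rho N : M -> 'cV[R]_4) (a : M -> R) (W1 W2 : M -> 'cV[R]_2) (nnt : nat)
    (M_torus : is_torus p)
    (rho_immersion : immersion_in_S3 p rho)
    (N_gauss : gauss_map p rho N)
    (rho_minimal : minimal p rho N)
    (a_curvature : nonneg_principal_curvature p rho N a)
    (W_frame : principal_frame p rho N a W1 W2)
    (nntE : natural_nullity p rho N a W1 W2 nnt)
    (nnt_le6 : (nnt <= 6)%N) :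
  exists2 phi : M -> M, isometries p rho phi & phi <> id.
Proof.
have [sr rr imm0] := rho_immersion; have [sn nn nr nD0] := N_gauss.
have [[sw1 u1] [sw2 u2] dN1 dN2] := W_frame.
pose r := rho \o p; pose n := N \o p; pose w1 := W1 \o p; pose w2 := W2 \o p.
pose al : 'cV[R]_2 -> R := a \o p.
pose e1 x := 'D_(w1 x) r x; pose e2 x := 'D_(w2 x) r x.
have difr x w : dif p rho (p x) w = 'D_w r x by exact: dif_p.
have difn x w : dif p N (p x) w = 'D_w n x by exact: dif_p.
have metricE x v w : metric p rho (p x) v w = dot ('D_v r x) ('D_w r x).
  by rewrite /metric (difr x v) (difr x w).
have imm x v : 'D_v r x = 0 -> v = 0.
  by rewrite -(difr x v); exact: imm0.
have nD x v : dot (n x) ('D_v r x) = 0.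
  by rewrite -(difr x v); exact: nD0.
have e11 x : dot (e1 x) (e1 x) = 1.
  by rewrite /e1 -(metricE x (w1 x) (w1 x)); exact: u1.
have e22 x : dot (e2 x) (e2 x) = 1.
  by rewrite /e2 -(metricE x (w2 x) (w2 x)); exact: u2.
have n1E x : 'D_(w1 x) n x = - al x *: e1 x.
  by rewrite /e1 -(difn x (w1 x)) -(difr x (w1 x)); exact: dN1.
have n2E x : 'D_(w2 x) n x = al x *: e2 x.
  by rewrite /e2 -(difn x (w2 x)) -(difr x (w2 x)); exact: dN2.
have e1E x : 'D_(w1 x) r x = e1 x by [].
have e2E x : 'D_(w2 x) r x = e2 x by [].
have al_ge0 x : 0 <= al x by have [] := a_curvature (p x).
have rrx x : dot (r x) (r x) = 1 by exact: rr.
have nnx x : dot (n x) (n x) = 1 by exact: nn.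
have nrx x : dot (n x) (r x) = 0 by exact: nr.
have pr := p_periodic M_torus rho; have pal := p_periodic M_torus a.
have pw1 := p_periodic M_torus W1; have pw2 := p_periodic M_torus W2.
(* A zero of [al] makes [al] vanish identically, so [n] is constant along [w1]; with zero mean
   curvature this is the situation excluded by [no_totally_geodesic_torus]. *)
have al_gt0 x : 0 < al x.
  rewrite lt0r al_ge0 andbT; apply/eqP => x0.
  have al0 := al_zero sr sn sw1 sw2 nD e1E e2E e11 e22 n1E n2E al_ge0 x0.
  have n10 y : 'D_(w1 y) n y = 0 by rewrite n1E al0 oppr0 scale0r.
  have gramE y : gram (metric p rho (p y)) =
      \matrix_(i, j) dot ('D_(delta_mx i 0) r y) ('D_(delta_mx j 0) r y).
    by apply/matrixP => i j; rewrite [LHS]mxE [RHS]mxE metricE.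
  have gramE' y : gram (second_form p rho N (p y)) =
      \matrix_(i, j) - dot ('D_(delta_mx i 0) n y) ('D_(delta_mx j 0) r y).
    by apply/matrixP => i j; rewrite [LHS]mxE [RHS]mxE /second_form difr difn.
  have tr0 y : \tr (invmx (gram (metric p rho (p y))) *m gram (second_form p rho N (p y))) = 0.
    have /eqP := rho_minimal (p y).
    by rewrite mulf_eq0 invr_eq0 pnatr_eq0 orbF => /eqP.
  have {}tr0 y := etrans (esym (congr2 (fun A B : 'M[R]_2 => \tr (invmx A *m B))
    (gramE y) (gramE' y))) (tr0 y).
  exact: (no_totally_geodesic_torus sr sn sw1 pr pw1 rrx nnx nrx nD imm e1E e11 n10
    (fun=> erefl) (fun=> erefl) (fun=> erefl) tr0 (fun=> erefl)).
have [Phi [Psi [lam [[sPhi sPsi PhiK PsiK] pPhi conf case1 case2]]]] :=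
  uniformization sr sn sw1 sw2 pr pw1 pw2 pal rrx nnx nrx nD e1E e2E e11 e22 n1E n2E al_gt0.
have conf_p x v w : metric p rho (p x) v w = lam (Phi x) * dot ('D_v Phi x) ('D_w Phi x).
  exact: etrans (metricE x v w) (conf x v w).
have [[B [BT B0 fB0]]|h] := nullity_dichotomy nntE nnt_le6.
  have [x|T T0 HT] := case1 B BT B0; first exact: (congr1 (@^~ (p x)) fB0).
  exact: (translation_isometry M_torus sPhi sPsi PhiK PsiK pPhi conf_p T0 HT).
(* These two angles isolate the terms in [W1] and [W2], which are [h1] and [h2] on the universal
   cover. *)
have [B1 B1T f1] := h 0; have [B2 B2T f2] := h (pi / 2).
have difa x w : dif p a (p x) w = 'D_w al x by exact: dif_p.
have [x|x|c Hc] := case2 B1 B2 B1T B2T; last first.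
- exact: (reflection_isometry M_torus sPhi sPsi PhiK PsiK pPhi conf_p Hc).
- apply: etrans (congr1 (@^~ (p x)) f2) _.
  rewrite /htheta cos_pihalf sin_pihalf !mul0r add0r mul1r.
  by rewrite -(difa x (w2 x)).
- apply: etrans (congr1 (@^~ (p x)) f1) _.
  rewrite /htheta cos0 sin0 !mul0r addr0 mul1r.
  by rewrite -(difa x (w1 x)).
Qed.
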